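(* Let $\alpha\in\mathbb{R}^n\setminus\{0\}$, $s>0$, $\varepsilon>0$, and let $X=X_\alpha+P$ where $X_\alpha=\alpha$ is the constant vector field and $P$ is a bounded real-analytic vector field on $\mathbb{T}^n_s$ with $|P|_s\le\varepsilon$. Let $d$ be the number of effective frequencies of $\alpha$, define $$Q(\varepsilon)=\Delta_\alpha^*\bigl((2\varepsilon)^{-1}\bigr),\qquad \kappa_{d,\alpha}=2^6d^2(2^d-1)|\alpha|^{-1},$$ and assume that $$Q(\varepsilon)>\max(1,d|\alpha|^{-1}),\qquad Q(\varepsilon)\ge\kappa_{d,\alpha}s^{-1}.$$ Then there exists a real-analytic embedding $\Phi:\mathbb{T}^n_{s/2}\to\mathbb{T}^n_s$ such that $$\Phi^*X=X_\alpha+N+R,\qquad [X_\alpha,N]=0,$$ with the estimates $|\Phi-\mathrm{Id}|_{s/2}<d^2|\alpha|^{-1}Q(\varepsilon)^{-1}$ and $$|N|_{s/2}<2\varepsilon,\qquad |R|_{s/2}<2\varepsilon\exp\bigl(-(\ln 2)\,\kappa_{d,\alpha}^{-1}\,s\,Q(\varepsilon)\bigr).$$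
   Context: Let $n\ge2$, $\mathbb{T}^n=\mathbb{R}^n/\mathbb{Z}^n$, $\mathbb{T}^n_{\mathbb{C}}=\mathbb{C}^n/\mathbb{Z}^n$. On $\mathbb{R}^n$ and $\mathbb{C}^n$, $|\cdot|$ is the maximum norm. For $s>0$, $\mathbb{T}^n_s=\{\theta\in\mathbb{T}^n_{\mathbb{C}} : |\mathrm{Im}\,\theta|<s\}$, and $|Y|_s=\sup_{z\in\mathbb{T}^n_s}|Y(z)|$ for a vector field (a $\mathbb{C}^n$-valued map) $Y$ on $\mathbb{T}^n_s$; $|\Phi-\mathrm{Id}|_r$ is the analogous supremum norm on $\mathbb{T}^n_r$. Real-analytic means analytic and real-valued at real arguments. $[\cdot,\cdot]$ is the Lie bracket of vector fields and $\Phi^*Y$ is the pull-back of $Y$ by $\Phi$. Write $\alpha=(\alpha_0,\dots,\alpha_{n-1})$, with coordinates labelled so that $|\alpha|=|\alpha_0|$ (standing convention). A subspace of $\mathbb{R}^n$ is rational if it has a basis of vectors in $\mathbb{Q}^n$; $F_\alpha$ is the smallest rational subspace of $\mathbb{R}^n$ containing $\alpha$, and $d=\dim F_\alpha$ is the number of effective frequencies of $\alpha$. For $Q\ge1$, $\Psi_\alpha(Q)$ is the infimum of the set of $K>0$ such that there exist $d$ linearly independent vectors $x=(x_0,\dots,x_{n-1})\in\mathbb{Z}^n\cap F_\alpha$ with $|x|\le K$ and $|x_0\alpha-\alpha_0x|\le Q^{-1}$. Put $\Delta_\alpha(Q)=Q\Psi_\alpha(Q)$ for $Q\ge 1$ and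 $\Delta_\alpha^*(x)=\sup\{Q\ge1 : \Delta_\alpha(Q)\le x\}$ (defined when this set is non-empty, i.e. for $x\ge\Delta_\alpha(1)$; the assumptions on $Q(\varepsilon)$ presuppose that it is defined). *)

(* Defs.v *)
From HB Require Import structures.
From mathcomp Require Import all_boot all_order all_algebra.
From mathcomp Require Import all_classical all_reals all_analysis.
From mathcomp Require Import complex.

Set Implicit Arguments.
Unset Strict Implicit.
Unset Printing Implicit Defensive.

Import Order.TTheory GRing.Theory Num.Theory.
Import numFieldNormedType.Exports.

Local Open Scope classical_set_scope.
Local Open Scope ring_scope.

Lemma memv_rows (F : fieldType) (n m : nat) (A : 'M[F]_(m, n.+1)) v :
  (v \in <<[tuple row i A | i < m]>>%VS) = (v <= A)%MS.
Proof.
apply/idP/submxP => [/coord_span ->|[D ->]].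
  exists (\row_i coord [tuple row i A | i < m] i v).
  by rewrite mulmx_sum_row; apply: eq_bigr => i _; rewrite mxE (nth_map i) ?size_enum_ord// nth_ord_enum.
rewrite mulmx_sum_row; apply: memv_suml => i _; apply: memvZ.
by apply: memv_span; apply/mapP; exists i; rewrite ?mem_enum.
Qed.

Lemma free_rows (F : fieldType) (n m : nat) (A : 'M[F]_(m, n.+1)) :
  row_free A -> free [tuple row i A | i < m].
Proof.
move=> fA; apply/freeP => k.
under eq_bigr => i _ do rewrite (nth_map i) ?size_enum_ord// nth_ord_enum.
move=> k0 i.
have : (\row_i k i) *m A = 0.
  by rewrite mulmx_sum_row -[RHS]k0; apply: eq_bigr => j _; rewrite mxE.
rewrite -[X in _ = X](mul0mx _ A) => /(row_free_inj fA) /rowP /(_ i).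
by rewrite !mxE.
Qed.

(* The dimension is written n.+1 so that the distinguished coordinate with
   index 0 exists. Norms of row vectors are the library ones, which are maximum
   norms; on 'rV[R[i]]_n.+1 the norm takes its (real) values in R[i]. *)

Section EffectiveFrequencies.
Variables (R : realType) (n : nat).
Implicit Types (alpha : 'rV[R]_n.+1) (F V : {vspace 'rV[R]_n.+1}).

Definition rational_subspace V : Prop :=
  exists b : seq 'rV[rat]_n.+1, basis_of V (map (map_mx ratr) b).

Definition smallest_rational_subspace alpha F : Prop :=
  [/\ rational_subspace F, alpha \in F &
      forall V, rational_subspace V -> alpha \in V -> (F <= V)%VS].

Definition rational_hull alpha : {vspace 'rV[R]_n.+1} :=
  xget fullv (smallest_rational_subspace alpha).

Local Notation up := (map_mx (ratr : rat -> R)).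

Lemma rational_subspace_rows m (A : 'M[rat]_(m, n.+1)) :
  rational_subspace <<[tuple row i (up A) | i < m]>>%VS.
Proof.
exists [tuple row i (row_base A) | i < \rank A].
have -> : map up [tuple row i (row_base A) | i < \rank A] =
  [tuple row i (up (row_base A)) | i < \rank A].
  rewrite /= -map_comp; apply: eq_map => i /=; exact: map_row.
rewrite /basis_of free_rows ?andbT; last by rewrite /row_free mxrank_map; exact: row_base_free.
apply/eqP/vspaceP => v; rewrite !memv_rows.
have /eqmxP -> // : (up (row_base A) == up A)%MS.
by rewrite !map_submx !eq_row_base submx_refl.
Qed.

Lemma rational_subspaceE V : rational_subspace V ->
  exists m (A : 'M[rat]_(m, n.+1)), forall v, (v \in V) = (v <= up A)%MS.
Proof.
move=> [b bV]; exists (size b), (\matrix_i b`_i) => v.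
rewrite -memv_rows -(span_basis bV); congr (_ \in <<_>>%VS).
apply: (@eq_from_nth _ 0); first by rewrite size_map size_tuple.
rewrite size_map => i ib; rewrite (nth_map 0)// (nth_map (Ordinal ib)) ?size_enum_ord//.
by rewrite (nth_ord_enum _ (Ordinal ib)) -map_row rowK.
Qed.

Lemma rational_hullP (alpha : 'rV[R]_n.+1) :
  smallest_rational_subspace alpha (rational_hull alpha).
Proof.
rewrite /rational_hull; apply: (@xgetPex _ _ (smallest_rational_subspace alpha)).
pose p (r : nat) := `[< exists A : 'M[rat]_n.+1, \rank A = r /\ (alpha <= up A)%MS >].
have p1 : exists r, p r.
  by exists n.+1; apply/asboolP; exists 1%:M; rewrite mxrank1 map_mx1 submx1.
have /asboolP[A [rA aA]] : p (ex_minn p1) by case: ex_minnP.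
exists <<[tuple row i (up A) | i < n.+1]>>%VS; split.
- exact: rational_subspace_rows.
- by rewrite memv_rows.
move=> V /rational_subspaceE[m [B VB]]; rewrite VB => aB.
apply/subvP => v; rewrite memv_rows VB => /submx_trans; apply.
rewrite map_submx; move: rA; case: ex_minnP => r _ rmin rA.
have : p (\rank (A :&: B)%MS).
  by apply/asboolP; exists (A :&: B)%MS; rewrite map_capmx sub_capmx aA aB.
move=> /rmin; rewrite -rA => rAB.
have : (A :&: B :=: A)%MS by apply/eqmxP; rewrite -mxrank_leqif_eq ?capmxSl// eqn_leq rAB mxrankS// capmxSl.
by move/eqmxP/andP => [_]; rewrite sub_capmx => /andP[].
Qed.

Definition num_frequencies alpha : nat := \dim (rational_hull alpha).

(* The infimum is taken in \bar R, so that it is +oo on the empty set. *)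
Definition Psi alpha (Q : R) : \bar R :=
  ereal_inf [set K%:E | K in [set K : R | 0 < K /\
    exists x : (num_frequencies alpha).-tuple 'rV[int]_n.+1,
      free [seq map_mx intr y : 'rV[R]_n.+1 | y <- x] /\
      forall y, y \in x ->
        [/\ map_mx intr y \in rational_hull alpha,
            `|map_mx intr y : 'rV[R]_n.+1| <= K &
            `|(y 0 0)%:~R *: alpha - alpha 0 0 *: map_mx intr y| <= Q^-1]]].

Definition Delta alpha (Q : R) : \bar R := (Q%:E * Psi alpha Q)%E.

(* For alpha != 0 one has d >= 1, and nonzero integer vectors have norm at least
   1, so Psi alpha Q >= 1 and the set below is bounded by x. If it is empty, the value is 0. *)
Definition Delta_star alpha (x : R) : R :=
  sup [set Q : R | 1 <= Q /\ (Delta alpha Q <= x%:E)%E].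

Definition kappa alpha : R :=
  let d := num_frequencies alpha in
  2 ^+ 6 * d%:R ^+ 2 * (2 ^+ d - 1) * `|alpha|^-1.

End EffectiveFrequencies.

(* Objects on the complex torus C^n / Z^n are represented on the universal cover
   C^n: vector fields as Z^n-periodic maps, and maps Phi of the torus for which
   Phi - Id is a C^n-valued map as lifts commuting with integer translations.
   All maps are total; only their values on a strip |Im z| < r matter. *)
Section ComplexTorus.
Variables (R : realType) (n : nat).
Local Notation Cn := ('rV[(R[i] : numFieldType)]_n.+1).
Implicit Types (r s : R) (z w : Cn) (k : 'rV[int]_n.+1) (X Y Phi : Cn -> Cn).

Definition cnorm z : R := complex.Re `|z|.

Definition strip r : set Cn := [set z | `|map_mx (@complex.Im R) z| < r].

Definition int_vec k : Cn := map_mx intr k.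

Definition is_real_vec z : Prop := map_mx (@complex.Im R) z = 0.

Definition sup_norm r Y : \bar R := ereal_sup [set (cnorm (Y z))%:E | z in strip r].

(* Fréchet differentiability over the field R[i], i.e. holomorphy. *)
Definition analytic_on_strip r Y : Prop :=
  forall z, strip r z -> differentiable Y z.

Definition real_on_reals r Y : Prop :=
  forall z, strip r z -> is_real_vec z -> is_real_vec (Y z).

Definition periodic_on_strip r Y : Prop :=
  forall z k, strip r z -> Y (z + int_vec k) = Y z.

Definition real_analytic_vector_field r Y : Prop :=
  [/\ periodic_on_strip r Y, analytic_on_strip r Y & real_on_reals r Y].

Definition const_field (alpha : 'rV[R]_n.+1) : Cn -> Cn :=
  fun=> map_mx (real_complex R) alpha.

Definition lie_bracket X Y : Cn -> Cn :=
  fun z => 'd Y z (X z) - 'd X z (Y z).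

(* (D Phi(z))^-1 (Y (Phi z)); vectors are rows, so the Jacobian acts on the
   right. *)
Definition pullback Phi Y : Cn -> Cn :=
  fun z => Y (Phi z) *m invmx ('J Phi z).

Definition torus_map r s Phi : Prop :=
  (forall z k, strip r z -> Phi (z + int_vec k) = Phi z + int_vec k) /\
  (forall z, strip r z -> strip s (Phi z)).

Definition torus_injective r Phi : Prop :=
  forall z w, strip r z -> strip r w ->
    (exists k, Phi w = Phi z + int_vec k) -> exists k, w = z + int_vec k.

Definition immersion r Phi : Prop :=
  forall z, strip r z -> 'J Phi z \in unitmx.

(* Continuity of the inverse of the map induced by Phi between the tori; no
   integer translation is needed on the image side, because w may be translated
   by any integer vector. *)
Definition torus_inverse_continuous r Phi : Prop :=
  forall z, strip r z -> forall e : R, 0 < e ->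
    exists2 delta : R, 0 < delta &
      forall w, strip r w -> cnorm (Phi w - Phi z) < delta ->
        exists k, cnorm (w + int_vec k - z) < e.

Definition real_analytic_embedding r s Phi : Prop :=
  [/\ torus_map r s Phi, analytic_on_strip r Phi /\ real_on_reals r Phi,
      torus_injective r Phi, immersion r Phi & torus_inverse_continuous r Phi].

End ComplexTorus.

(* Main.v *)
Require Import Defs.
From HB Require Import structures.
From mathcomp Require Import all_boot all_order all_algebra.
From mathcomp Require Import all_classical all_reals all_analysis.
From mathcomp Require Import complex ring lra zify.

Set Implicit Arguments.
Unset Strict Implicit.
Unset Printing Implicit Defensive.

Import Order.TTheory GRing.Theory Num.Theory.
Import numFieldNormedType.Exports.

Local Open Scope classical_set_scope.
Local Open Scope ring_scope.

(** Why the theorem holds.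

    Arithmetic. If [Q] is as in the statement, there are [d] linearly independent
    integer vectors [x] in the rational hull of [alpha], with [`|x|] of order at
    most [(eps * Q)^-1], for which [(x_0 / alpha_0) alpha] is within a multiple of
    [(Q * `|alpha|)^-1] of [x] ([resonant_directions]). They span the hull, which
    contains [alpha]; so a field invariant under the translations along all these
    [x] commutes with the constant field [alpha].

    One step ([averaging_step]). Consider [alpha + N + P] with [N] already
    invariant and [`|P| <= rho], and average [P] successively along the vectors
    [x], which gives [A_0 = P, A_1, ..., A_d]. Translation by an integer vector is
    the identity of the torus, so the equation [DV_j x_j = A_(j-1) - A_j] has an
    explicit solution without small divisors: the mean of
    [(t - 1/2) A_(j-1) (z + t x_j)] over [0 <= t <= 1], which is bounded by
    [rho / 2] ([primitive_derivative]). With [U = \sum_j (x_j0 / alpha_0) V_j] one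
    has [DU alpha = P - A_d] up to an error controlled by the distance between
    [(x_j0 / alpha_0) alpha] and [x_j]. The change of variables [id + U] thus
    conjugates the field to [alpha + (N + A_d) + P'], where [P'] is defined by
    inverting the Jacobian [1 + DU]. Cauchy's estimates give [`|P'| <= rho / 2]
    on a strip that is narrower by [32 d^2 / (Q * `|alpha|)].

    Iteration ([near_identity_iteration]). There is room for
    [m = floor (s * Q / kappa)] steps before half of the width is used up. The
    remainder becomes [eps / 2 ^ m], while the invariant parts and the changes of
    variables add up to geometric sums. Every change of variables shrinks
    distances by a factor 2 at most, so the composite is an embedding.

    Complex analysis. Analyticity means differentiability over the complex field
    at every point, without continuity of the derivative, so Goursat's theorem
    enters. Its bisection argument is applied to trapezoidal sums over triangles
    ([goursat]), and the comparison of such sums over two concentric diamonds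
    yields [`|f'(0)| <= 3 M / rho] for [`|f| <= M] on the disc of radius [rho]
    ([cauchy_estimate]). This inequality carries the rest. It bounds the
    second-order Taylor remainder uniformly ([holo_quadratic]); hence
    differentiability survives limits of bounded sequences with a geometric rate
    ([holo_limit]), in particular for averages, realised as limits of Riemann
    sums, and for partial derivatives, realised as limits of difference
    quotients. The value of [kappa] leaves enough room for the constant 3. *)

(** * Modulus and geometric limits *)

Section ComplexModulus.
Variable R : realType.
Local Notation C := R[i].
Implicit Types x y : C.

(** The norm of [R[i]] takes its values in [R[i]], which is only partially ordered;
    estimates are carried out with this real-valued modulus. *)
Definition cabs x : R := complex.Re `|x|.

Lemma normC_cabs x : `|x| = (cabs x)%:C%C. Proof. by case: x. Qed.

Lemma cabs_ge0 x : 0 <= cabs x.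
Proof. by have := normr_ge0 x; rewrite normC_cabs lecR. Qed.

Lemma cabs0 : cabs 0 = 0. Proof. by rewrite /cabs normr0. Qed.

Lemma cabsN x : cabs (- x) = cabs x. Proof. by rewrite /cabs normrN. Qed.

Lemma cabsC x y : cabs (x - y) = cabs (y - x).
Proof. by rewrite -cabsN opprB. Qed.

Lemma cabsD x y : cabs (x + y) <= cabs x + cabs y.
Proof.
by rewrite -lecR rmorphD /= -!normC_cabs; exact: ler_normD.
Qed.

Lemma cabsB x y z : cabs (x - z) <= cabs (x - y) + cabs (y - z).
Proof. by apply: le_trans (cabsD _ _); rewrite addrA subrK. Qed.

Lemma cabsM x y : cabs (x * y) = cabs x * cabs y.
Proof. by apply: (@complexI R); rewrite rmorphM /= -!normC_cabs normrM. Qed.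

Lemma cabsV x : cabs x^-1 = (cabs x)^-1.
Proof.
by apply: (@complexI R); rewrite fmorphV /= -!normC_cabs normfV.
Qed.

Lemma cabs_eq0 x : (cabs x == 0) = (x == 0).
Proof. by rewrite -(inj_eq (@complexI R)) -normC_cabs /= normr_eq0. Qed.

Lemma cabs_gt0 x : (0 < cabs x) = (x != 0).
Proof. by rewrite lt0r cabs_ge0 cabs_eq0 andbT. Qed.

Lemma cabs_real (r : R) : cabs r%:C%C = `|r|.
Proof. by rewrite /cabs normc_def /= expr0n /= addr0 sqrtr_sqr. Qed.

Lemma cabs_nat k : cabs k%:R = k%:R.
Proof. by rewrite -(rmorph_nat (real_complex R)) cabs_real normr_nat. Qed.

Lemma cabs_sqr x : cabs x ^+ 2 = complex.Re x ^+ 2 + complex.Im x ^+ 2.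
Proof. by apply: (@complexI R); rewrite add_Re2_Im2 normC_cabs rmorphXn. Qed.

Lemma Re_le_cabs x : `|complex.Re x| <= cabs x.
Proof. by have := normc_ge_Re x; rewrite normC_cabs lecR. Qed.

Lemma Im_le_cabs x : `|complex.Im x| <= cabs x.
Proof.
by rewrite -(@ler_pXn2r _ 2) ?nnegrE ?cabs_ge0// real_normK ?num_real// cabs_sqr lerDr sqr_ge0.
Qed.

Lemma cabs_le_ReIm x : cabs x <= `|complex.Re x| + `|complex.Im x|.
Proof.
rewrite -(@ler_pXn2r _ 2) ?nnegrE ?cabs_ge0 ?addr_ge0// cabs_sqr sqrrD.
by rewrite !real_normK ?num_real// lerD2r lerDl mulrn_wge0 ?mulr_ge0.
Qed.

Lemma cabs_sum (I : Type) (r : seq I) (P : pred I) (F : I -> C) :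
  cabs (\sum_(i <- r | P i) F i) <= \sum_(i <- r | P i) cabs (F i).
Proof.
elim/big_ind2 : _ => [|x1 x2 y1 y2 h1 h2|//]; first by rewrite cabs0.
exact: le_trans (cabsD _ _) (lerD h1 h2).
Qed.

End ComplexModulus.

Section GeometricLimit.
Variable R : realType.
Local Notation C := R[i].

Lemma geometric_small (K e : R) : 0 < e -> exists k, K / 2 ^+ k < e.
Proof.
move=> e0; exists (Num.bound (K / e)); set k := Num.bound _.
rewrite ltr_pdivrMr ?exprn_gt0// mulrC -ltr_pdivrMr//.
apply: (@le_lt_trans _ _ `|K / e|); first exact: ler_norm.
apply: lt_le_trans (archi_boundP (normr_ge0 _)) _.
have -> : Num.bound `|K / e| = k by rewrite /k /Num.bound normr_id.
by rewrite -natrX ler_nat ltnW// ltn_expl.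
Qed.

Lemma geometric_le0 (x K : R) : (forall k, x <= K / 2 ^+ k) -> x <= 0.
Proof.
move=> h; rewrite leNgt; apply/negP => /(geometric_small K)[k].
by rewrite ltNge h.
Qed.

(** The intervals of radius [2 * K / 2 ^+ k] about [x k] are nested. *)
Lemma real_geometric_cvg (x : nat -> R) (K : R) :
  (forall k, `|x k.+1 - x k| <= K / 2 ^+ k) ->
  exists p, forall k, `|x k - p| <= 2 * K / 2 ^+ k.
Proof.
move=> h; pose lo k := x k - 2 * K / 2 ^+ k; pose hi k := x k + 2 * K / 2 ^+ k.
have half k : K / 2 ^+ k = 2 * (K / 2 ^+ k.+1).
  by rewrite exprS; field; rewrite expf_neq0.
have lo_mono j k : lo j <= lo (j + k)%N.
  elim: k => [|k IH]; first by rewrite addn0.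
  apply: le_trans IH _; rewrite addnS /lo.
  have := h (j + k)%N; rewrite ler_norml => /andP[+ _].
  by rewrite -!(mulrA 2 K) (half (j + k)%N); lra.
have hi_mono j k : hi (j + k)%N <= hi j.
  elim: k => [|k IH]; first by rewrite addn0.
  apply: le_trans _ IH; rewrite addnS /hi.
  have := h (j + k)%N; rewrite ler_norml => /andP[_].
  by rewrite -!(mulrA 2 K) (half (j + k)%N); lra.
have K0 : 0 <= K by have := h 0%N; rewrite expr0 divr1; apply: le_trans.
have lohi k : lo k <= hi k.
  by have := divr_ge0 K0 (exprn_ge0 k (ler0n R 2)); rewrite /lo /hi -!(mulrA 2 K); lra.
have lo_hi j k : lo j <= hi k.
  apply: le_trans (lo_mono j k) _; apply: le_trans (lohi _) _.
  by rewrite addnC hi_mono.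
have hs : has_sup [set y | exists k, y = lo k].
  by split; [exists (lo 0%N), 0%N | exists (hi 0%N) => _ [k ->]].
exists (sup [set y | exists k, y = lo k]) => k; set p := sup _.
have h1 : lo k <= p by apply: ub_le_sup; [exact: hs.2 | exists k].
have h2 : p <= hi k by apply: ge_sup; [exact: hs.1 | move=> _ [j ->]].
by rewrite ler_norml; move: h1 h2; rewrite /lo /hi; lra.
Qed.

(** Limits are taken along sequences with a geometric rate only; such a rate is
    available for all dyadic approximations below, and estimates pass to the
    limit by [geometric_le0]. *)
Definition glim (u : nat -> C) : C :=
  xget 0 [set p | exists K, forall k, cabs (u k - p) <= K / 2 ^+ k].

Lemma glim_unique (u : nat -> C) p K :
  (forall k, cabs (u k - p) <= K / 2 ^+ k) -> glim u = p.
Proof.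
move=> h; rewrite /glim; case: xgetP => [q _ [L hq]|/(_ p)]; last by case; exists K.
apply/eqP; rewrite -subr_eq0 -cabs_eq0 eq_le cabs_ge0 andbT.
apply: (@geometric_le0 _ (L + K)) => k; rewrite mulrDl.
by apply: le_trans (cabsB _ (u k) _) (lerD _ (h k)); rewrite cabsC.
Qed.

Lemma geometric_cvg (u : nat -> C) K :
  (forall k, cabs (u k.+1 - u k) <= K / 2 ^+ k) ->
  forall k, cabs (u k - glim u) <= 4 * K / 2 ^+ k.
Proof.
move=> h.
have [k|a ha] := @real_geometric_cvg (fun k => complex.Re (u k)) K.
  by apply: le_trans (h k); apply: le_trans (Re_le_cabs _); case: (u k.+1) (u k) => ? ? [].
have [k|b hb] := @real_geometric_cvg (fun k => complex.Im (u k)) K.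
  by apply: le_trans (h k); apply: le_trans (Im_le_cabs _); case: (u k.+1) (u k) => ? ? [].
have hp k : cabs (u k - (a +i* b)%C) <= 4 * K / 2 ^+ k.
  apply: le_trans (cabs_le_ReIm _) _; move: (ha k) (hb k).
  by case: (u k) => x y /=; lra.
by rewrite (glim_unique hp).
Qed.

End GeometricLimit.

(** * Goursat's lemma for trapezoidal sums *)

Section Trapezoids.
Variable R : realType.
Local Notation C := R[i].
Implicit Types (F G : C -> C) (a b c t : C).

(** Composite trapezoidal sum with [2 ^ k] pieces. With this recursion the sum is
    exactly additive under bisection of the segment and changes sign with its
    orientation, as the integral does. *)
Fixpoint trap F k a b : C :=
  if k is k'.+1 then trap F k' a ((a + b) / 2) + trap F k' ((a + b) / 2) b
  else (b - a) * (F a + F b) / 2.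

Definition tri F k a b c : C := trap F k a b + trap F k b c + trap F k c a.

Lemma trap_rev F k a b : trap F k b a = - trap F k a b.
Proof.
elim: k a b => [|k IH] a b /=; first by ring.
by rewrite (addrC b a) (IH a) (IH _ b) opprD [RHS]addrC.
Qed.

Lemma trapZ F q k a b : trap (fun t => q * F t) k a b = q * trap F k a b.
Proof.
elim: k a b => [|k IH] a b /=; first by ring.
by rewrite !IH mulrDr.
Qed.

(** The trapezoidal rule is exact on affine functions, which therefore have zero
    sums over closed polygons. *)
Lemma trap_affine p q k a b :
  trap (fun t => p + q * t) k a b = (b - a) * (p + q * ((a + b) / 2)).
Proof.
elim: k a b => [|k IH] a b /=; first by field.
by rewrite !IH; field.
Qed.

Lemma trap_scale F k q a b :
  trap F k (q * a) (q * b) = q * trap (fun t => F (q * t)) k a b.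
Proof.
elim: k a b => [|k IH] a b /=; first by ring.
by rewrite -mulrDr -mulrA !IH mulrDr.
Qed.

Lemma trapB F G k a b :
  trap (fun t => F t - G t) k a b = trap F k a b - trap G k a b.
Proof.
elim: k a b => [|k IH] a b /=; first by ring.
by rewrite !IH; ring.
Qed.

Definition midconvex (D : C -> Prop) := forall a b, D a -> D b -> D ((a + b) / 2).

Lemma trap_bound (D : C -> Prop) F M k a b : midconvex D -> D a -> D b ->
  (forall t, D t -> cabs (F t) <= M) -> cabs (trap F k a b) <= M * cabs (b - a).
Proof.
move=> Dc Da Db h; elim: k a b Da Db => [|k IH] a b Da Db /=.
  rewrite !cabsM cabsV cabs_nat -mulrA [leRHS]mulrC ler_wpM2l ?cabs_ge0//.
  by rewrite ler_pdivrMr// mulr_natr mulr2n (le_trans (cabsD _ _))// lerD// h.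
have Dm := Dc _ _ Da Db.
apply: le_trans (cabsD _ _) _; apply: le_trans (lerD (IH _ _ Da Dm) (IH _ _ Dm Db)) _.
have -> : (a + b) / 2 - a = (b - a) / 2 by field.
have -> : b - (a + b) / 2 = (b - a) / 2 by field.
by rewrite cabsM cabsV cabs_nat; lra.
Qed.

(** Lower bound needed for the sums of [t^-1] around the origin; [e] is the
    direction of the initial segment, common to all subsegments. *)
Lemma trap_Im_ge (D : C -> Prop) F (mu l : R) e k a b : midconvex D -> D a -> D b ->
  (forall t, D t -> mu <= complex.Im (e * F t)) -> 0 <= l -> b - a = l%:C%C * e ->
  l * mu <= complex.Im (trap F k a b).
Proof.
move=> Dc Da Db h; elim: k a b l Da Db => [|k IH] a b l Da Db l0 bal /=.
  have -> : (b - a) * (F a + F b) / 2 = (l / 2)%:C%C * (e * F a + e * F b).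
    by rewrite bal rmorphM fmorphV /= rmorph_nat; field.
  move: (h _ Da) (h _ Db); case: (e * F a) (e * F b) => x y [x' y'] /= h1 h2.
  rewrite mul0r addr0 -mulrA ler_wpM2l//; lra.
have Dm := Dc _ _ Da Db.
have l20 : 0 <= l / 2 by rewrite divr_ge0.
have h1 := IH a ((a + b) / 2) (l / 2) Da Dm l20.
have h2 := IH ((a + b) / 2) b (l / 2) Dm Db l20.
have e1 : (a + b) / 2 - a = (l / 2)%:C%C * e.
  by rewrite rmorphM fmorphV /= rmorph_nat mulrAC -bal; field.
have e2 : b - (a + b) / 2 = (l / 2)%:C%C * e.
  by rewrite rmorphM fmorphV /= rmorph_nat mulrAC -bal; field.
move: (h1 e1) (h2 e2); case: (trap F k a _) (trap F k _ b) => x y [x' y'] /=; lra.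
Qed.

(** The sums over the inner edges cancel, each being run twice in opposite
    directions. *)
Lemma tri_split F k a b c :
  tri F k.+1 a b c =
    tri F k a ((a + b) / 2) ((c + a) / 2) + tri F k ((a + b) / 2) b ((b + c) / 2) +
    tri F k ((c + a) / 2) ((b + c) / 2) c +
    tri F k ((b + c) / 2) ((c + a) / 2) ((a + b) / 2).
Proof.
rewrite /tri /= (trap_rev F k ((a + b) / 2) ((c + a) / 2)).
rewrite (trap_rev F k ((b + c) / 2) ((a + b) / 2)) (trap_rev F k ((c + a) / 2) ((b + c) / 2)).
ring.
Qed.

End Trapezoids.

Section Goursat.
Variable R : realType.
Local Notation C := R[i].
Implicit Types (F : C -> C) (a b c t : C).

Definition cderiv F t l := forall e : R, 0 < e -> exists2 d : R, 0 < d &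
  forall u, cabs u < d -> cabs (F (t + u) - F t - l * u) <= e * cabs u.

(** Failure of convergence to zero of the sums over the triangle [T], in a
    quantitative form that passes to subtriangles. *)
Definition tri_large F (eta : R) (T : C * C * C) :=
  forall K, exists k, (K <= k)%N /\ eta < cabs (tri F k T.1.1 T.1.2 T.2).

Definition quarter (i : 'I_4) (T : C * C * C) : C * C * C :=
  let: (a, b, c) := T in
  match val i with
  | 0 => (a, (a + b) / 2, (c + a) / 2)
  | 1 => ((a + b) / 2, b, (b + c) / 2)
  | 2 => ((c + a) / 2, (b + c) / 2, c)
  | _ => ((b + c) / 2, (c + a) / 2, (a + b) / 2)
  end.

(** Pigeonhole: if the sums over all four quarters were eventually at most
    [eta / 4], their total would eventually be at most [eta]. *)
Lemma tri_large_quarter F eta T :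
  tri_large F eta T -> exists i, tri_large F (eta / 4) (quarter i T).
Proof.
move=> hT; apply: contrapT => /forallNP hN.
have {}hN i : exists K, forall k, (K <= k)%N ->
    cabs (tri F k (quarter i T).1.1 (quarter i T).1.2 (quarter i T).2) <= eta / 4.
  have /existsNP[K hK] := hN i; exists K => k Kk.
  by rewrite leNgt; apply/negP => h; apply: hK; exists k.
have {hN}/choice[N hN] := hN.
have [k [Nk]] := hT (\max_i N i).+1.
case: k Nk => // k Nk; rewrite ltNge => /negP; apply.
have h i := hN i k (leq_trans (leq_bigmax i) Nk).
case: T {hT hN} h => [[a b] c] h; rewrite tri_split.
move: (h ord0) (h (@Ordinal 4 1 isT)) (h (@Ordinal 4 2 isT)) (h (@Ordinal 4 3 isT)) => /= h0 h1 h2 h3.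
have -> : eta = eta / 4 + eta / 4 + eta / 4 + eta / 4 by field.
by do 3! [apply: le_trans (cabsD _ _) _; apply: lerD => //].
Qed.

Definition diam_le (T : C * C * C) (L : R) :=
  [/\ cabs (T.1.2 - T.1.1) <= L, cabs (T.2 - T.1.2) <= L & cabs (T.1.1 - T.2) <= L].

Lemma diam_quarter i T L : diam_le T L -> diam_le (quarter i T) (L / 2).
Proof.
case: T => [[a b] c] [/= h1 h2 h3].
have half (x y : C) : x = y / 2 \/ x = - y / 2 -> cabs y <= L -> cabs x <= L / 2.
  by case=> ->; rewrite ?cabsN cabsM cabsV cabs_nat ?cabsN => ?; rewrite ler_pM2r ?invr_gt0.
by case: i => [[|[|[|[|//]]]] i4]; split => /=;
  first [ apply: half h1; (left; by field) || (right; by field)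
        | apply: half h2; (left; by field) || (right; by field)
        | apply: half h3; (left; by field) || (right; by field)].
Qed.

(** The trapezoidal sums over a closed triangle are exactly additive under the
    subdivision into four similar triangles, so the classical bisection argument
    applies to them directly: nested triangles on which the sums stay large,
    relative to the area, shrink to a point where [F] is not differentiable. The
    argument uses pointwise differentiability alone. *)
Lemma goursat (D : C -> Prop) F a b c eta : midconvex D ->
  (forall u p K, (forall k, D (u k)) -> (forall k, cabs (u k - p) <= K / 2 ^+ k) -> D p) ->
  (forall t, D t -> exists l, cderiv F t l) ->
  D a -> D b -> D c -> 0 < eta -> ~ tri_large F eta (a, b, c).
Proof.
move=> Dc Dcl Dd Da Db Dc' eta0 large.
pose inD (T : C * C * C) := [/\ D T.1.1, D T.1.2 & D T.2].
have inD_quarter i T : inD T -> inD (quarter i T).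
  case: T => [[x y] z] [/= Dx Dy Dz].
  by case: i => [[|[|[|[|//]]]] i4]; split => //=; apply: Dc.
have [L [L0 dL]] : exists L, 0 < L /\ diam_le (a, b, c) L.
  exists (1 + cabs (b - a) + cabs (c - b) + cabs (a - c)).
  have := (cabs_ge0 (b - a), cabs_ge0 (c - b), cabs_ge0 (a - c)).
  by move=> [[h1 h2] h3]; split; [lra|split => /=; lra].
pose ch k T : 'I_4 := xget ord0 [set i | tri_large F (eta / 4 ^+ k.+1) (quarter i T)].
pose fix T k := if k is k'.+1 then quarter (ch k' (T k')) (T k') else (a, b, c).
have TD k : inD (T k) by elim: k => [//|k IH] /=; apply: inD_quarter.
have Td k : diam_le (T k) (L / 2 ^+ k).
  elim: k => [|k IH] /=; first by rewrite expr0 divr1.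
  by have := diam_quarter (ch k (T k)) IH; rewrite exprSr invfM mulrA.
have Tl k : tri_large F (eta / 4 ^+ k) (T k).
  elim: k => [|k IH] /=; first by rewrite expr0 divr1.
  have [i hi] := tri_large_quarter IH.
  rewrite -/T /ch; case: xgetP => [j _ //|/(_ i)] /=; case.
  by rewrite exprSr invfM mulrA.
pose u k := (T k).1.1.
have ustep k : cabs (u k.+1 - u k) <= L / 2 ^+ k.
  have := Td k; rewrite /u /=; case: (T k) => [[x y] z] [/= h1 h2 h3].
  have Lk0 : 0 <= L / 2 ^+ k by rewrite divr_ge0 ?ltW ?exprn_gt0.
  case: (ch k _) => [[|[|[|[|//]]]] i4] /=.
  - by rewrite subrr cabs0.
  - have -> : (x + y) / 2 - x = (y - x) / 2 by field.
    by rewrite cabsM cabsV cabs_nat; lra.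
  - have -> : (z + x) / 2 - x = - ((x - z) / 2) by field.
    by rewrite cabsN cabsM cabsV cabs_nat; lra.
  - have -> : (y + z) / 2 - x = (y - x) / 2 - (x - z) / 2 by field.
    by apply: le_trans (cabsD _ _) _; rewrite cabsN !cabsM cabsV cabs_nat; lra.
have hp := geometric_cvg ustep; set p := glim u in hp.
have Dp : D p by apply: Dcl hp => k; have [] := TD k.
have [l hl] := Dd _ Dp.
have C0 : 0 < 15 * L ^+ 2 by rewrite mulr_gt0 ?exprn_gt0.
have [d d0 hd] := hl (eta / (15 * L ^+ 2)) (divr_gt0 eta0 C0).
set e := eta / _ in hd.
(* The first vertex of the [k]-th triangle is within [4 * L / 2 ^+ k] of [p], the others
   within [5 * L / 2 ^+ k], and the perimeter is at most [3 * L / 2 ^+ k]; hence [15]. *)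
have [k hk] := geometric_small (5 * L) d0.
pose D' t := cabs (t - p) <= 5 * L / 2 ^+ k.
have D'c : midconvex D'.
  move=> x y hx hy; rewrite /D'.
  have -> : (x + y) / 2 - p = (x - p) / 2 + (y - p) / 2 by field.
  apply: le_trans (cabsD _ _) _; rewrite !cabsM cabsV cabs_nat.
  by move: hx hy; rewrite /D'; lra.
pose G t := F t - (F p - l * p + l * t).
have Gle t : D' t -> cabs (G t) <= e * (5 * L / 2 ^+ k).
  move=> Dt; have := hd (t - p) (le_lt_trans Dt hk).
  rewrite (addrC p) subrK /G => h.
  have -> : F t - (F p - l * p + l * t) = F t - F p - l * (t - p) by ring.
  apply: le_trans h _; apply: ler_wpM2l => //.
  by rewrite /e divr_ge0// ltW.
have [j [_]] := Tl k 0%N; rewrite ltNge => /negP; apply.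
have triG : forall x y z, tri F j x y z = tri G j x y z.
  by move=> x y z; rewrite /tri /G !trapB !trap_affine; field.
rewrite {}triG.
have [] := Td k; have := hp k; rewrite /u.
case: (T k) => [[x y] z] /= h0 h1 h2 h3.
have Dx : D' x by rewrite /D'; have := divr_gt0 L0 (exprn_gt0 k (@ltr0n R 2)); lra.
have Dy : D' y.
  by rewrite /D'; apply: le_trans (cabsB _ x _) _; move: h0; rewrite -!mulrA; lra.
have Dz : D' z.
  rewrite /D'; apply: le_trans (cabsB _ x _) _; rewrite cabsC.
  by move: h0; rewrite -!mulrA; lra.
apply: (@le_trans _ _ (e * (5 * L / 2 ^+ k) * (3 * (L / 2 ^+ k)))).
  have -> : 3 * (L / 2 ^+ k) = L / 2 ^+ k + L / 2 ^+ k + L / 2 ^+ k by ring.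
  have e0 : 0 <= e * (5 * L / 2 ^+ k).
    by rewrite !mulr_ge0 ?invr_ge0 ?exprn_ge0 ?ltW// mulr_gt0// ?invr_gt0.
  rewrite /tri !mulrDr.
  apply: le_trans (cabsD _ _) _; apply: lerD;
    first (apply: le_trans (cabsD _ _) _; apply: lerD);
    by apply: le_trans (trap_bound _ D'c _ _ Gle) _ => //; apply: ler_wpM2l.
rewrite /e le_eqVlt; apply/orP; left; apply/eqP.
have -> : 4 = 2 ^+ 2 :> R by ring.
by rewrite exprAC; field; rewrite expf_neq0// gt_eqF.
Qed.

End Goursat.

(** * Cauchy's estimate in one variable *)

Section CauchyEstimate.
Variable R : realType.
Local Notation C := R[i].
Local Notation "r %:K" := (r%:C%C : C) (at level 2, format "r %:K").
Local Notation I := ('i%C : C).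
Implicit Types (F : C -> C) (t w : C) (r : R).

Lemma minl_le (x y : R) : Num.min x y <= x. Proof. by rewrite ge_min lexx. Qed.

Lemma minr_le (x y : R) : Num.min x y <= y. Proof. by rewrite ge_min lexx orbT. Qed.

Lemma mulII : I * I = -1. Proof. by rewrite -expr2 sqr_i. Qed.

Lemma cderiv_cst (c : C) t : cderiv (fun=> c) t 0.
Proof.
move=> e e0; exists 1 => // u _.
by rewrite subrr mul0r subr0 cabs0 mulr_ge0 ?cabs_ge0// ltW.
Qed.

Lemma cderivD F G t l m : cderiv F t l -> cderiv G t m ->
  cderiv (fun t => F t + G t) t (l + m).
Proof.
move=> hF hG e e0; have e2 : 0 < e / 2 by rewrite divr_gt0.
have [d1 d10 h1] := hF _ e2; have [d2 d20 h2] := hG _ e2.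
exists (Num.min d1 d2) => [|u]; first by rewrite lt_min d10.
rewrite lt_min => /andP[/h1 {}h1 /h2 {}h2].
have -> : F (t + u) + G (t + u) - (F t + G t) - (l + m) * u =
  (F (t + u) - F t - l * u) + (G (t + u) - G t - m * u) by ring.
by apply: le_trans (cabsD _ _) _; lra.
Qed.

Lemma cderivM F G t l m : cderiv F t l -> cderiv G t m ->
  cderiv (fun t => F t * G t) t (l * G t + F t * m).
Proof.
move=> hF hG e e0.
pose B := 1 + cabs (F t) + cabs (G t) + cabs l + cabs m.
have [lF lG ll lm] : [/\ cabs (F t) <= B, cabs (G t) + cabs m + 1 <= B, cabs l <= B & 1 + cabs m <= B].
  have := (cabs_ge0 (F t), cabs_ge0 (G t), cabs_ge0 l, cabs_ge0 m).
  by rewrite /B => -[[[? ?] ?] ?]; split; lra.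
have B0 : 0 < B by apply: lt_le_trans lm; have := cabs_ge0 m; lra.
pose e' := Num.min 1 (e / (4 * B)).
have e'0 : 0 < e' by rewrite lt_min ltr01 divr_gt0// mulr_gt0.
have e'1 : e' <= 1 by rewrite ge_min lexx.
have e'e : e' * B <= e / 4.
  rewrite -ler_pdivlMr// (le_trans (minr_le _ _))// le_eqVlt; apply/orP; left.
  by apply/eqP; field; rewrite gt_eqF.
have [d1 d10 h1] := hF _ e'0; have [d2 d20 h2] := hG _ e'0.
exists (Num.min (Num.min d1 d2) (Num.min 1 (e / (4 * B ^+ 2)))) => [|u].
  by rewrite !lt_min d10 d20 ltr01 divr_gt0// mulr_gt0 ?exprn_gt0.
rewrite !lt_min => /andP[/andP[/h1 {}h1 /h2 {}h2] /andP[/ltW u1 ue]].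
have u0 := cabs_ge0 u.
have {}ue : B * cabs u * B <= e / 4.
  move/ltW: ue; rewrite ler_pdivlMr ?mulr_gt0 ?exprn_gt0//; lra.
have dG : cabs (G (t + u) - G t) <= (1 + cabs m) * cabs u.
  have -> : G (t + u) - G t = (G (t + u) - G t - m * u) + m * u by ring.
  apply: le_trans (cabsD _ _) _; rewrite cabsM mulrDl lerD2r (le_trans h2)//.
  by rewrite ler_wpM2r.
have Gu : cabs (G (t + u)) <= B.
  have -> : G (t + u) = G t + (G (t + u) - G t) by ring.
  apply: le_trans (cabsD _ _) _; apply: le_trans _ lG; rewrite -addrA lerD2l.
  by apply: le_trans dG _; rewrite addrC ler_piMr// addr_ge0 ?cabs_ge0.
have -> : F (t + u) * G (t + u) - F t * G t - (l * G t + F t * m) * u =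
  (F (t + u) - F t - l * u) * G (t + u) + l * u * (G (t + u) - G t)
   + F t * (G (t + u) - G t - m * u) by ring.
have -> : e * cabs u = e / 4 * cabs u + e / 4 * cabs u + e / 2 * cabs u by field.
apply: le_trans (cabsD _ _) _; apply: lerD; first apply: le_trans (cabsD _ _) _; first apply: lerD.
- rewrite cabsM; apply: le_trans (ler_pM (cabs_ge0 _) (cabs_ge0 _) h1 Gu) _.
  by rewrite mulrAC ler_wpM2r.
- rewrite !cabsM.
  apply: (@le_trans _ _ (B * cabs u * (B * cabs u))); last by rewrite mulrA ler_wpM2r.
  apply: ler_pM => //; rewrite ?mulr_ge0 ?cabs_ge0// ?ler_wpM2r//.
  by apply: le_trans dG _; rewrite ler_wpM2r.
- rewrite cabsM; apply: le_trans (ler_pM (cabs_ge0 _) (cabs_ge0 _) lF h2) _.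
  rewrite mulrA ler_wpM2r// mulrC; lra.
Qed.

Lemma cderivV t : t != 0 -> cderiv (fun t => t^-1) t (- t ^- 2).
Proof.
move=> t0 e e0; have T0 : 0 < cabs t by rewrite cabs_gt0.
exists (Num.min (cabs t / 2) (e * cabs t ^+ 3 / 2)) => [|u].
  by rewrite lt_min !divr_gt0// mulr_gt0// exprn_gt0.
rewrite lt_min => /andP[ut /ltW ue].
have tu : cabs t / 2 <= cabs (t + u).
  have := cabsB t (- u) 0; rewrite !subr0 opprK cabsN; lra.
have tu0 : t + u != 0 by rewrite -cabs_gt0; apply: lt_le_trans tu; rewrite divr_gt0.
have -> : (t + u)^-1 - t^-1 - - t ^- 2 * u = u * u / (t * t * (t + u)).
  by field; rewrite tu0 t0.
rewrite !(cabsM, cabsV) ler_pdivrMr; last by rewrite !mulr_gt0 ?cabs_gt0.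
have -> : e * cabs u * (cabs t * cabs t * cabs (t + u)) =
  cabs u * (e * (cabs t * cabs t * cabs (t + u))) by ring.
rewrite ler_wpM2l ?cabs_ge0//; apply: le_trans ue _.
have -> : e * cabs t ^+ 3 / 2 = e * (cabs t * cabs t * (cabs t / 2)) by field.
by rewrite !ler_wpM2l// ?mulr_ge0 ?cabs_ge0 ?ltW.
Qed.

(** Closed half-disc cut off by the chord from [w * r] to [w * 'i * r]: a convex
    set avoiding the origin that contains one quarter of the ring between the
    diamonds of half-diagonals [r] and [a]. *)
Definition sector (a r : R) w t :=
  r <= complex.Re (t / w) + complex.Im (t / w) /\ cabs t <= a.

Definition arc F k r w := trap F k (w * r%:K) (w * I * r%:K).

Definition diamond F k r := arc F k r 1 + arc F k r I + arc F k r (-1) + arc F k r (- I).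

Lemma sector_midconvex a r w : midconvex (sector a r w).
Proof.
move=> x y [hx xa] [hy ya]; split.
  have -> : (x + y) / 2 / w = (2^-1)%:K * (x / w + y / w).
    by rewrite fmorphV rmorph_nat -mulrDl mulrAC mulrC.
  by move: hx hy; case: (x / w) (y / w) => ? ? [? ?] /=; lra.
rewrite cabsM cabsV cabs_nat; have := cabsD x y; lra.
Qed.

Lemma sector_closed a r w (u : nat -> C) p K : cabs w = 1 ->
  (forall k, sector a r w (u k)) -> (forall k, cabs (u k - p) <= K / 2 ^+ k) ->
  sector a r w p.
Proof.
move=> w1 hs hu; split; last first.
  rewrite -subr_le0; apply: (@geometric_le0 _ _ K) => k.
  have := (hs k).2; have := cabsB p (u k) 0; have := hu k.
  by rewrite !subr0 (cabsC p); lra.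
rewrite -subr_le0; apply: (@geometric_le0 _ _ (2 * K)) => k.
have := (hs k).1.
have h : cabs (u k / w - p / w) <= K / 2 ^+ k.
  by rewrite -mulrBl cabsM cabsV w1 invr1 mulr1.
have := le_trans (Re_le_cabs _) h; have := le_trans (Im_le_cabs _) h.
case: (u k / w) (p / w) => x y [x' y'] /=.
by rewrite !ler_norml => /andP[? ?] /andP[? ?]; rewrite -mulrA; lra.
Qed.

Lemma sector_cabs a r w t : 0 < r -> cabs w = 1 -> sector a r w t ->
  r ^+ 2 / 2 <= cabs t ^+ 2.
Proof.
move=> r0 w1 [h _].
have -> : cabs t = cabs (t / w) by rewrite cabsM cabsV w1 invr1 mulr1.
rewrite cabs_sqr; move: h; case: (t / w) => x y /= h.
have : r ^+ 2 <= (x + y) ^+ 2 by rewrite ler_pXn2r ?nnegrE ?(ltW r0)// (le_trans (ltW r0)).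
by have := sqr_ge0 (x - y); lra.
Qed.

Lemma cabs_unitI : cabs I = 1.
Proof. by rewrite /cabs normc_def /= expr0n /= expr1n add0r sqrtr1. Qed.

Lemma cabs1 : cabs (1 : C) = 1. Proof. by have := @cabs_nat R 1. Qed.

Lemma cabs_scale w r : cabs w = 1 -> 0 < r -> cabs (w * r%:K) = r.
Proof. by move=> w1 r0; rewrite cabsM w1 mul1r cabs_real gtr0_norm. Qed.

Lemma sector_start a r w s : 0 < r -> r <= s -> s <= a -> cabs w = 1 ->
  sector a r w (w * s%:K).
Proof.
move=> r0 rs sa w1; have s0 := lt_le_trans r0 rs.
have w0 : w != 0 by rewrite -cabs_gt0 w1.
by split; rewrite ?cabs_scale// mulrAC divff// mul1r /= addr0.
Qed.

Lemma sector_end a r w s : 0 < r -> r <= s -> s <= a -> cabs w = 1 ->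
  sector a r w (w * I * s%:K).
Proof.
move=> r0 rs sa w1; have s0 := lt_le_trans r0 rs.
have w0 : w != 0 by rewrite -cabs_gt0 w1.
split; last by rewrite cabs_scale// cabsM w1 cabs_unitI mulr1.
have -> : w * I * s%:K / w = I * s%:K by field.
by rewrite /=; lra.
Qed.

Lemma arc_bound F m k r w : 0 < r -> cabs w = 1 ->
  (forall t, sector r r w t -> cabs (F t) <= m) -> cabs (arc F k r w) <= m * (3 / 2 * r).
Proof.
move=> r0 w1 h.
have hs := sector_start r0 (lexx r) (lexx r) w1.
have m0 : 0 <= m by apply: le_trans (h _ hs); apply: cabs_ge0.
have he := sector_end r0 (lexx r) (lexx r) w1.
apply: le_trans (trap_bound _ (@sector_midconvex r r w) hs he h) _.
have -> : w * I * r%:K - w * r%:K = (w * r%:K) * (I - 1) by ring.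
rewrite cabsM cabs_scale// [r * _]mulrC; apply: ler_wpM2l => //; apply: ler_wpM2r; first exact: ltW.
rewrite -(@ler_pXn2r _ 2) ?nnegrE ?cabs_ge0 ?divr_ge0// cabs_sqr /=; lra.
Qed.

(** The contour sums over two concentric diamonds differ by the sums over eight
    triangles filling the ring between them, none of which contains the possible
    singularity at the origin. *)
Lemma diamond_shrink F (r a : R) eta : 0 < r -> r < a -> 0 < eta ->
  (forall t, cabs t <= a -> t != 0 -> exists l, cderiv F t l) ->
  exists k, cabs (diamond F k a - diamond F k r) <= eta.
Proof.
move=> r0 ra eta0 dF.
have quad w : cabs w = 1 -> exists K, forall k, (K <= k)%N ->
    cabs (arc F k a w + trap F k (w * I * a%:K) (w * I * r%:K) - arc F k r w
      + trap F k (w * r%:K) (w * a%:K)) <= eta / 4.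
  move=> w1; have a0 := lt_trans r0 ra.
  have small x y z : sector a r w x -> sector a r w y -> sector a r w z ->
      exists K, forall k, (K <= k)%N -> cabs (tri F k x y z) <= eta / 8.
    move=> sx sy sz.
    have hd t : sector a r w t -> exists l, cderiv F t l.
      move=> st; apply: dF; first exact: st.2.
      rewrite -cabs_gt0 -(@ltr_pXn2r _ 2) ?nnegrE ?cabs_ge0// expr0n /=.
      by apply: lt_le_trans (sector_cabs r0 w1 st); rewrite divr_gt0 ?exprn_gt0.
    have e8 : 0 < eta / 8 by rewrite divr_gt0.
    have /existsNP[K hK] := goursat (@sector_midconvex a r w)
      (fun u p K => @sector_closed a r w u p K w1) hd sx sy sz e8.
    exists K => k Kk.
    by rewrite leNgt; apply/negP => h; apply: hK; exists k.
  have [K1 h1] := small _ _ _ (sector_start r0 (ltW ra) (lexx a) w1)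
    (sector_end r0 (ltW ra) (lexx a) w1) (sector_end r0 (lexx r) (ltW ra) w1).
  have [K2 h2] := small _ _ _ (sector_start r0 (ltW ra) (lexx a) w1)
    (sector_end r0 (lexx r) (ltW ra) w1) (sector_start r0 (lexx r) (ltW ra) w1).
  exists (maxn K1 K2) => k; rewrite geq_max => /andP[/h1 {}h1 /h2 {}h2].
  have := le_trans (cabsD _ _) (lerD h1 h2).
  rewrite /tri /arc (trap_rev F k (w * a%:K) (w * I * r%:K)).
  rewrite (trap_rev F k (w * r%:K) (w * I * r%:K)) => h.
  have -> : eta / 4 = eta / 8 + eta / 8 by field.
  by apply: le_trans h; rewrite le_eqVlt; apply/orP; left; apply/eqP; congr cabs; ring.
have N1 : cabs (-1 : C) = 1 by rewrite cabsN cabs1.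
have NI : cabs (- I) = 1 by rewrite cabsN cabs_unitI.
have [K0 h0] := quad _ cabs1; have [K1 h1] := quad _ cabs_unitI.
have [K2 h2] := quad _ N1; have [K3 h3] := quad _ NI.
exists (maxn (maxn K0 K1) (maxn K2 K3)); set k := maxn _ _.
have Kk := leqnn k; rewrite {1}/k !geq_max in Kk.
case/andP: Kk => /andP[/h0 {}h0 /h1 {}h1] /andP[/h2 {}h2 /h3 {}h3].
have -> : eta = eta / 4 + eta / 4 + eta / 4 + eta / 4 by field.
have := lerD (lerD (lerD h0 h1) h2) h3.
apply: le_trans; apply: le_trans _ (lerD (lerD (cabsD _ _) (lexx _)) (lexx _)).
apply: le_trans _ (lerD (cabsD _ _) (lexx _)); apply: le_trans _ (cabsD _ _).
rewrite le_eqVlt; apply/orP; left; apply/eqP; congr cabs; rewrite /diamond.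
rewrite !(mulNr, mul1r, mulII, opprK).
rewrite (trap_rev F k (I * a%:K)) (trap_rev F k (- (I * a%:K))).
rewrite (trap_rev F k a%:K) (trap_rev F k (- a%:K)).
by ring.
Qed.

Lemma eq_trap F G k a b : F =1 G -> trap F k a b = trap G k a b.
Proof. by move=> /funext ->. Qed.

Lemma diamondB F G k r : diamond (fun t => F t - G t) k r = diamond F k r - diamond G k r.
Proof. by rewrite /diamond /arc !trapB; ring. Qed.

Lemma diamondZ F q k r : diamond (fun t => q * F t) k r = q * diamond F k r.
Proof. by rewrite /diamond /arc !trapZ; ring. Qed.

(** [t ^- 2] is even, so opposite sides of the diamond cancel. *)
Lemma diamond_inv2 k r : diamond (fun t => t ^- 2) k r = 0.
Proof.
have opp w : arc (fun t => t ^- 2) k r (- w) = - arc (fun t => t ^- 2) k r w.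
  rewrite /arc; have -> : - w * r%:K = -1 * (w * r%:K) by ring.
  have -> : - w * I * r%:K = -1 * (w * I * r%:K) by ring.
  rewrite trap_scale mulN1r; congr (- _).
  by apply: eq_trap => t; rewrite mulN1r sqrrN.
by rewrite /diamond !opp; ring.
Qed.

(** The exact contour integral is [2 pi i]; the bound [4] follows from the four
    equal sides and from [Im ((I - 1) / t) >= 1 / r] on each point of the first. *)
Lemma diamond_inv_ge k r : 0 < r -> 4 <= cabs (diamond (fun t => t^-1) k r).
Proof.
move=> r0.
have rot w : arc (fun t => t^-1) k r (I * w) = arc (fun t => t^-1) k r w.
  rewrite /arc -!mulrA trap_scale -trapZ; apply: eq_trap => t.
  rewrite invfM mulrA divff ?mul1r// -cabs_gt0 cabs_unitI; exact: ltr01.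
have -> : diamond (fun t => t^-1) k r = 4 * arc (fun t => t^-1) k r 1.
  rewrite /diamond.
  have {1}-> : - I = I * (I * (I * 1)) :> C by rewrite mulr1 mulrA mulII mulN1r.
  have -> : -1 = I * (I * 1) :> C by rewrite mulr1 mulII.
  have eI : arc (fun t => t^-1) k r I = arc (fun t => t^-1) k r 1.
    by rewrite -{1}[I]mulr1 rot.
  by rewrite !rot eI; ring.
rewrite cabsM cabs_nat -[leLHS]mulr1 ler_wpM2l//.
apply: le_trans _ (le_trans (ler_norm _) (Im_le_cabs _)).
have -> : 1 = r * r^-1 by rewrite divff// gt_eqF.
apply: (@trap_Im_ge _ (sector r r 1) _ r^-1 r (I - 1)).
- exact: sector_midconvex.
- by apply: sector_start => //; exact: cabs1.
- by apply: sector_end => //; exact: cabs1.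
- move=> t st; have t2 := sector_cabs r0 cabs1 st.
  have T0 : 0 < cabs t ^+ 2 by apply: lt_le_trans t2; rewrite divr_gt0 ?exprn_gt0.
  have T1 : cabs t ^+ 2 <= r ^+ 2 by rewrite ler_pXn2r ?nnegrE ?cabs_ge0 ?(ltW r0)//; exact: st.2.
  case: st => + _; move: T0 T1; rewrite divr1 cabs_sqr; case: t {t2} => x y /= T0 T1 h.
  rewrite -[leLHS]mul1r ler_pdivrMr//.
  have -> : (0 - 1) * - (y / (x ^+ 2 + y ^+ 2)) + (1 - 0) * (x / (x ^+ 2 + y ^+ 2)) =
    (x + y) / (x ^+ 2 + y ^+ 2) by field; rewrite gt_eqF.
  by rewrite mulrAC ler_pdivlMr// mul1r; apply: le_trans T1 _; rewrite expr2 ler_wpM2r// ltW.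
- exact: ltW.
- by rewrite mul1r; ring.
Qed.

(** The contour sums of [f t / t ^ 2] over a large diamond are compared with those
    of the Taylor polynomial of degree one: the difference quotient error is
    [o (1 / t)], so that its sums over a small diamond, and hence over the large
    one, are small. The constant is [3] because [4] replaces [2 pi] and because
    the diamond is compared with the circumscribed disc. *)
Lemma cauchy_estimate f l (M rho : R) : 0 < rho ->
  (forall t, cabs t < rho -> exists l', cderiv f t l') ->
  (forall t, cabs t < rho -> cabs (f t) <= M) -> cderiv f 0 l ->
  cabs l * rho <= 3 * M.
Proof.
move=> rho0 df fM dl.
have M0 : 0 <= M by apply: le_trans (fM 0 _); rewrite ?cabs_ge0 ?cabs0.
have key a : 0 < a -> a < rho -> cabs l * a <= 3 * M.
  move=> a0 arho; apply/ler_addgt0Pr => eta eta0.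
  (* With the relative error [e], each side of the small diamond contributes at most
     [9 / 4 * e]. *)
  pose e := eta / (9 * a) * 2.
  have e0 : 0 < e by rewrite mulr_gt0// divr_gt0// mulr_gt0.
  have [d d0 hd] := dl _ e0.
  pose r := Num.min (d / 2) (a / 2).
  have r0 : 0 < r by rewrite lt_min !divr_gt0.
  have rd : r < d by apply: le_lt_trans (minl_le _ _) _; lra.
  have ra : r < a by apply: le_lt_trans (minr_le _ _) _; lra.
  pose h t := (f t * t ^- 2 - f 0 * t ^- 2) - l * t^-1.
  have dh t : cabs t <= a -> t != 0 -> exists l', cderiv h t l'.
    move=> ta t0; have [m hm] := df _ (le_lt_trans ta arho).
    have inv2 := cderivM (cderivV t0) (cderivV t0).
    have c x := cderiv_cst x t.
    have := cderivD (cderivM hm inv2) (cderivD (cderivM (c (- f 0)) inv2)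
      (cderivM (c (- l)) (cderivV t0))).
    set m' := (X in cderiv _ _ X) => hm'; exists m'.
    suff -> : h = fun t => f t * (t^-1 * t^-1) + (- f 0 * (t^-1 * t^-1) + - l * t^-1) by [].
    by apply/funext => x; rewrite /h -expr2 exprVn; ring.
  have eta2 : 0 < eta / a * 2 by rewrite mulr_gt0// divr_gt0.
  have [k hk] := diamond_shrink r0 ra eta2 dh.
  have hr w : cabs w = 1 -> cabs (arc h k r w) <= 9 / 4 * e.
    move=> w1.
    have := @arc_bound h (3 * e / (2 * r)) k r w r0 w1.
    have -> : 3 * e / (2 * r) * (3 / 2 * r) = 9 / 4 * e by field; rewrite gt_eqF.
    apply => t st; have t2 := sector_cabs r0 w1 st.
    have t23 : 2 / 3 * r <= cabs t.
      rewrite -(@ler_pXn2r _ 2) ?nnegrE ?cabs_ge0 ?mulr_ge0 ?divr_ge0 ?(ltW r0)//.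
      by apply: le_trans t2; rewrite exprMn; have := sqr_ge0 r; lra.
    have t0 : 0 < cabs t by apply: lt_le_trans t23; lra.
    have tn0 : t != 0 by rewrite -cabs_gt0.
    have -> : h t = (f (0 + t) - f 0 - l * t) / (t * t).
      by rewrite /h add0r; field.
    rewrite cabsM cabsV cabsM ler_pdivrMr ?mulr_gt0//.
    apply: le_trans (hd _ (le_lt_trans st.2 rd)) _.
    have -> : 3 * e / (2 * r) * (cabs t * cabs t) = e * cabs t * (cabs t / (2 / 3 * r)).
      by field; rewrite gt_eqF.
    have r23 : 0 < 2 / 3 * r by lra.
    by rewrite ler_peMr ?(mulr_ge0 (ltW e0) (cabs_ge0 _))// ler_pdivlMr ?mul1r.
  have hf w : cabs w = 1 -> cabs (arc (fun t => f t * t ^- 2) k a w) <= 3 * M / a.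
    move=> w1.
    have := @arc_bound (fun t => f t * t ^- 2) (M / (a ^+ 2 / 2)) k a w a0 w1.
    have -> : M / (a ^+ 2 / 2) * (3 / 2 * a) = 3 * M / a by field; rewrite gt_eqF.
    apply => t st; have t2 := sector_cabs a0 w1 st.
    rewrite cabsM cabsV expr2 cabsM -expr2; apply: ler_pM; rewrite ?cabs_ge0 ?invr_ge0 ?sqr_ge0//.
      by apply: fM; apply: le_lt_trans st.2 arho.
    by rewrite lef_pV2 // posrE; [apply: lt_le_trans t2|]; rewrite divr_gt0 ?exprn_gt0.
  have N1 : cabs (-1 : C) = 1 by rewrite cabsN cabs1.
  have NI : cabs (- I) = 1 by rewrite cabsN cabs_unitI.
  have four (c : R) (x y z' u : C) : cabs x <= c -> cabs y <= c -> cabs z' <= c -> cabs u <= c ->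
      cabs (x + y + z' + u) <= 4 * c.
    move=> hx hy hz hu; apply: le_trans (cabsD _ _) _.
    have := cabsD (x + y) z'; have := cabsD x y; lra.
  have Hr : cabs (diamond h k r) <= 9 * e.
    have := four _ _ _ _ _ (hr _ cabs1) (hr _ cabs_unitI) (hr _ N1) (hr _ NI).
    by rewrite /diamond => /le_trans; apply; lra.
  have Hf : cabs (diamond (fun t => f t * t ^- 2) k a) <= 12 * M / a.
    have := four _ _ _ _ _ (hf _ cabs1) (hf _ cabs_unitI) (hf _ N1) (hf _ NI).
    by rewrite /diamond => /le_trans; apply; lra.
  have Ha : cabs (diamond h k a) <= 9 * e + eta / a * 2.
    have := cabsB (diamond h k a) (diamond h k r) 0; rewrite !subr0; lra.
  have dE : diamond h k a = diamond (fun t => f t * t ^- 2) k a - l * diamond (fun t => t^-1) k a.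
    by rewrite /h !diamondB !diamondZ diamond_inv2 mulr0 subr0.
  have Hl : cabs (l * diamond (fun t => t^-1) k a) <= 12 * M / a + 9 * e + eta / a * 2.
    have -> : l * diamond (fun t => t^-1) k a =
       diamond (fun t => f t * t ^- 2) k a - diamond h k a by rewrite dE; ring.
    apply: le_trans (cabsD _ _) _; rewrite cabsN; lra.
  have : cabs l * 4 <= 12 * M / a + 9 * e + eta / a * 2.
    by apply: le_trans Hl; rewrite cabsM ler_wpM2l ?cabs_ge0 ?diamond_inv_ge.
  have -> : 12 * M / a + 9 * e + eta / a * 2 = 4 * ((3 * M + eta) / a).
    by rewrite /e; field; rewrite gt_eqF.
  by rewrite mulrC ler_pM2l// ler_pdivlMr.
have [->|l0] := eqVneq l 0; first by rewrite cabs0 mul0r mulr_ge0.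
rewrite leNgt [cabs l * _]mulrC -ltr_pdivrMr ?cabs_gt0//; apply/negP.
set a := _ / _ => arho; have a0 : 0 <= a by rewrite divr_ge0 ?cabs_ge0 ?mulr_ge0.
have /key h : 0 < (a + rho) / 2 by lra.
have /h {h} : (a + rho) / 2 < rho by lra.
rewrite [cabs l * _]mulrC -ler_pdivlMr ?cabs_gt0// -/a; lra.
Qed.

End CauchyEstimate.

(** * Complex gradients in several variables *)

Lemma mx_entry_le (K : numDomainType) m n (x : 'M[K]_(m, n)) i j : `|x i j| <= mx_norm x.
Proof. by rewrite mx_normE -[leLHS]nngE num_le; exact: (le_bigmax _ _ (i, j)). Qed.

Section ComplexVectors.
Variables (R : realType) (n : nat).
Local Notation K := (R[i] : numFieldType).
Local Notation C := R[i].
Local Notation V := 'rV[K]_n.+1.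
Implicit Types (z w h a : V) (r : R).

Lemma norm_cnorm z : `|z| = (cnorm z)%:C%C.
Proof. by have := normr_ge0 z; rewrite /cnorm; case: (`|z|) => x y; rewrite lecE /= => /andP[/eqP -> _]. Qed.

Lemma cnorm_ge0 z : 0 <= cnorm z.
Proof. by have := normr_ge0 z; rewrite norm_cnorm lecR. Qed.

Lemma cabs_le_cnorm z i : cabs (z 0 i) <= cnorm z.
Proof. by rewrite -lecR -normC_cabs -norm_cnorm; exact: mx_entry_le. Qed.

Lemma cnorm_le z r : 0 <= r -> (forall i, cabs (z 0 i) <= r) -> cnorm z <= r.
Proof.
move=> r0 h; have [z0|/mx_norm_neq0[[i j] /= e]] := eqVneq (mx_norm z) 0.
  by rewrite /cnorm [`|z|]z0.
by rewrite /cnorm [`|z|]e ord1; apply: h.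
Qed.

Lemma cnorm0 : cnorm (0 : V) = 0. Proof. by rewrite /cnorm normr0. Qed.

Lemma cnorm_eq0 z : (cnorm z == 0) = (z == 0).
Proof. by rewrite -(inj_eq (@complexI R)) -norm_cnorm /= normr_eq0. Qed.

Lemma cnorm_gt0 z : (0 < cnorm z) = (z != 0).
Proof. by rewrite lt0r cnorm_ge0 cnorm_eq0 andbT. Qed.

Lemma cnormN z : cnorm (- z) = cnorm z. Proof. by rewrite /cnorm normrN. Qed.

Lemma cnormD z w : cnorm (z + w) <= cnorm z + cnorm w.
Proof. by rewrite -lecR rmorphD /= -!norm_cnorm; exact: ler_normD. Qed.

Lemma cnormB z w h : cnorm (z - h) <= cnorm (z - w) + cnorm (w - h).
Proof. by apply: le_trans (cnormD _ _); rewrite addrA subrK. Qed.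

Lemma cnormZ (c : C) z : cnorm (c *: z) = cabs c * cnorm z.
Proof.
by apply: (@complexI R); rewrite rmorphM /= -norm_cnorm -normC_cabs -norm_cnorm normrZ.
Qed.

(** The pairing is bilinear and not hermitian, so that [dot a] is the
    complex-linear form with gradient [a]. *)
Definition dot a h : C := \sum_i a 0 i * h 0 i.

Lemma dotDr a h w : dot a (h + w) = dot a h + dot a w.
Proof. by rewrite -big_split; apply: eq_bigr => i _; rewrite mxE mulrDr. Qed.

Lemma dotZr a (c : C) h : dot a (c *: h) = c * dot a h.
Proof. by rewrite mulr_sumr; apply: eq_bigr => i _; rewrite mxE mulrCA. Qed.

Lemma dotDl a w h : dot (a + w) h = dot a h + dot w h.
Proof. by rewrite -big_split; apply: eq_bigr => i _; rewrite mxE mulrDl. Qed.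

Lemma dotZl a (c : C) h : dot (c *: a) h = c * dot a h.
Proof. by rewrite mulr_sumr; apply: eq_bigr => i _; rewrite mxE mulrA. Qed.

Lemma dotNl a h : dot (- a) h = - dot a h.
Proof. by rewrite -scaleN1r dotZl mulN1r. Qed.

Lemma dotBl a w h : dot (a - w) h = dot a h - dot w h.
Proof. by rewrite dotDl dotNl. Qed.

Lemma dotBr a h w : dot a (h - w) = dot a h - dot a w.
Proof. by rewrite -[- w]scaleN1r dotDr dotZr mulN1r. Qed.

Lemma dot0r a : dot a 0 = 0.
Proof. by rewrite /dot big1// => i _; rewrite mxE mulr0. Qed.

Lemma dot0l h : dot 0 h = 0.
Proof. by rewrite /dot big1// => i _; rewrite mxE mul0r. Qed.

Lemma dot_delta a i : dot a (delta_mx 0 i) = a 0 i.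
Proof.
rewrite /dot (bigD1 i)//= mxE !eqxx mulr1 big1 ?addr0// => j /negPf ji.
by rewrite mxE ji andbF mulr0.
Qed.

Lemma cnorm_delta i : cnorm (delta_mx 0 i : V) = 1.
Proof.
apply/eqP; rewrite eq_le; apply/andP; split.
  by apply: cnorm_le => // j; rewrite mxE eqxx /=; case: eqP => _; rewrite ?cabs1 ?cabs0.
by rewrite -(cabs1 R); apply: le_trans (cabs_le_cnorm _ i); rewrite mxE !eqxx.
Qed.

Lemma dot_bound a h r : (forall i, cabs (a 0 i) <= r) -> cabs (dot a h) <= n.+1%:R * r * cnorm h.
Proof.
move=> ar; apply: le_trans (cabs_sum _ _ _) _.
apply: (@le_trans _ _ (\sum_(i < n.+1) (r * cnorm h))).
  apply: ler_sum => i _; rewrite cabsM.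
  by apply: ler_pM; rewrite ?cabs_ge0// cabs_le_cnorm.
by rewrite sumr_const card_ord -mulrA mulr_natl.
Qed.

(** [a] is the complex gradient of [f] at [z]. Estimates use this elementary
    formulation; products, inverses and composites go through [differentiable]. *)
Definition cdiff (f : V -> C) z a := forall e : R, 0 < e -> exists2 d : R, 0 < d &
  forall h, cnorm h < d -> cabs (f (z + h) - f z - dot a h) <= e * cnorm h.

Lemma cdiff_unique (f : V -> C) z a b : cdiff f z a -> cdiff f z b -> a = b.
Proof.
move=> ha hb; apply/rowP => i; apply/eqP; rewrite -subr_eq0 -cabs_eq0 eq_le cabs_ge0 andbT.
apply/ler_addgt0Pr => e e0; rewrite add0r.
have e2 : 0 < e / 2 by rewrite divr_gt0.
have [d1 d10 h1] := ha _ e2; have [d2 d20 h2] := hb _ e2.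
pose t := Num.min d1 d2 / 2.
have m0 : 0 < Num.min d1 d2 by rewrite lt_min d10.
have t0 : 0 < t by rewrite divr_gt0.
have [l1 l2] := (minl_le d1 d2, minr_le d1 d2).
have ht : cnorm (t%:C%C *: delta_mx 0 i : V) = t.
  by rewrite cnormZ cnorm_delta mulr1 cabs_real gtr0_norm.
have {}h1 := h1 (t%:C%C *: delta_mx 0 i); have {}h2 := h2 (t%:C%C *: delta_mx 0 i).
rewrite ht !dotZr !dot_delta in h1 h2.
rewrite -(ler_pM2r t0) -{1}(gtr0_norm t0) -cabs_real -cabsM.
set D := f _ - f z in h1 h2.
have -> : (a 0 i - b 0 i) * t%:C%C = (D - t%:C%C * b 0 i) - (D - t%:C%C * a 0 i) by ring.
apply: le_trans (cabsD _ _) _; rewrite cabsN.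
have {}h1 := h1 _; have tm : t < Num.min d1 d2 by rewrite /t; lra.
have := h1 (lt_le_trans tm l1); have := h2 (lt_le_trans tm l2); lra.
Qed.

Lemma cdiff_line (f : V -> C) z a h (t : C) : cdiff f (z + t *: h) a ->
  cderiv (fun t => f (z + t *: h)) t (dot a h).
Proof.
move=> ha e e0; have h0 := cnorm_ge0 h.
have c0 : 0 < cnorm h + 1 by lra.
have [d d0 hd] := ha _ (divr_gt0 e0 c0).
exists (d / (cnorm h + 1)) => [|u]; first by rewrite divr_gt0.
rewrite ltr_pdivlMr// => ud.
have un : cnorm (u *: h) < d.
  by rewrite cnormZ; apply: le_lt_trans ud; rewrite ler_wpM2l ?cabs_ge0//; lra.
have := hd _ un; rewrite dotZr scalerDl addrA [u * _]mulrC => /le_trans; apply.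
rewrite cnormZ mulrAC ler_pdivrMr// -mulrA ler_wpM2l ?(ltW e0)//.
by rewrite ler_wpM2l ?cabs_ge0//; lra.
Qed.

Lemma cdiff_cst (c : C) z : cdiff (fun=> c) z 0.
Proof.
move=> e e0; exists 1 => // h _.
by rewrite subrr dot0l subr0 cabs0 mulr_ge0 ?cnorm_ge0 ?ltW.
Qed.

Lemma cdiff_dot b z : cdiff (dot b) z b.
Proof.
move=> e e0; exists 1 => // h _.
have -> : dot b (z + h) - dot b z - dot b h = 0 by rewrite dotDr; ring.
by rewrite cabs0 mulr_ge0 ?cnorm_ge0 ?ltW.
Qed.

Lemma cdiffD (f g : V -> C) z a b : cdiff f z a -> cdiff g z b ->
  cdiff (fun z => f z + g z) z (a + b).
Proof.
move=> hF hG e e0; have e2 : 0 < e / 2 by rewrite divr_gt0.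
have [d1 d10 h1] := hF _ e2; have [d2 d20 h2] := hG _ e2.
exists (Num.min d1 d2) => [|h]; first by rewrite lt_min d10.
rewrite lt_min => /andP[/h1 {}h1 /h2 {}h2]; rewrite dotDl.
have -> : f (z + h) + g (z + h) - (f z + g z) - (dot a h + dot b h) =
  (f (z + h) - f z - dot a h) + (g (z + h) - g z - dot b h) by ring.
by apply: le_trans (cabsD _ _) _; lra.
Qed.

Lemma cdiffZ (c : C) (f : V -> C) z a : cdiff f z a -> cdiff (fun z => c * f z) z (c *: a).
Proof.
move=> hF e e0; have c0 : 0 < cabs c + 1 by have := cabs_ge0 c; lra.
have [d d0 hd] := hF _ (divr_gt0 e0 c0); exists d => // h /hd {}hd.
rewrite dotZl -!mulrBr cabsM.
apply: le_trans (ler_wpM2l (cabs_ge0 _) hd) _; rewrite mulrA ler_wpM2r ?cnorm_ge0//.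
by rewrite mulrA ler_pdivrMr// mulrC ler_wpM2l ?(ltW e0)//; lra.
Qed.

Lemma cdiffB (f g : V -> C) z a b : cdiff f z a -> cdiff g z b ->
  cdiff (fun z => f z - g z) z (a - b).
Proof.
move=> hf hg; have := cdiffD hf (cdiffZ (-1) hg); rewrite scaleN1r.
by congr cdiff; apply/funext => x; rewrite mulN1r.
Qed.

Lemma cdiff_shift (f : V -> C) z h a : cdiff f (z + h) a -> cdiff (fun w => f (w + h)) z a.
Proof.
by move=> hf e /hf[d d0 hd]; exists d => // u /hd; rewrite (addrAC z).
Qed.

End ComplexVectors.

(** * Local consequences of Cauchy's estimate *)

Section LocalEstimates.
Variables (R : realType) (n : nat).
Local Notation K := (R[i] : numFieldType).
Local Notation C := R[i].
Local Notation V := 'rV[K]_n.+1.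
Implicit Types (f g : V -> C) (z w h a : V) (r : R).

(** A bound on the derivative bounds the increment: otherwise one of the two
    halves of the interval also violates the bound, and nested halves shrink to a
    point where the derivative is too large. For complex values the
    mean slope need not be attained as a derivative. *)
Lemma straddle (phi : R -> C) (L : R) :
  (forall t, 0 <= t <= 1 -> exists2 l, cabs l <= L & forall e, 0 < e ->
     exists2 d : R, 0 < d & forall u, `|u| < d ->
       cabs (phi (t + u) - phi t - l * u%:C%C) <= e * `|u|) ->
  cabs (phi 1 - phi 0) <= L.
Proof.
move=> hphi; apply/ler_addgt0Pr => eta eta0; rewrite leNgt; apply/negP => large.
pose bad x k := (L + eta) / 2 ^+ k < cabs (phi (x + (2 ^+ k)^-1) - phi x).
pose fix x k : R := if k is k'.+1 then
  (if `[< bad (x k') k'.+1 >] then x k' else x k' + (2 ^+ k'.+1)^-1) else 0.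
have p2 k : (2 ^+ k)^-1 = (2 ^+ k.+1)^-1 + (2 ^+ k.+1)^-1 :> R.
  by rewrite exprS; field; rewrite expf_neq0.
have pp k : 0 < (2 ^+ k)^-1 :> R by rewrite invr_gt0 exprn_gt0.
have hbad k : bad (x k) k.
  elim: k => [|k IH] /=; first by rewrite /bad expr0 invr1 mulr1 add0r.
  case: asboolP => // hN; rewrite /bad ltNge; apply/negP => hN2.
  move: IH; rewrite /bad ltNge => /negP; apply.
  move/negP: hN; rewrite -leNgt => hN1.
  apply: le_trans (cabsB _ (phi (x k + (2 ^+ k.+1)^-1)) _) _.
  by move: hN1 hN2; rewrite -addrA -p2 [_ / 2 ^+ k]mulrC (p2 k); lra.
have x01 k : 0 <= x k /\ x k + (2 ^+ k)^-1 <= 1.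
  elim: k => [|k [h0 h1]] /=; first by rewrite expr0 invr1 add0r.
  by move: h1 (pp k.+1); rewrite (p2 k); case: asboolP => _; split; lra.
have xstep k : `|x k.+1 - x k| <= 1 / 2 ^+ k.
  rewrite mul1r /=; case: asboolP => _; first by rewrite subrr normr0 ltW.
  by rewrite addrAC subrr add0r gtr0_norm// (p2 k) lerDl ltW.
have [p hp] := real_geometric_cvg xstep.
have p01 : 0 <= p <= 1.
  apply/andP; split.
    rewrite -oppr_le0; apply: (@geometric_le0 _ _ 2) => k.
    by have := hp k; have := x01 k; rewrite ler_norml mulr1 => -[? ?] /andP[]; lra.
  rewrite -subr_le0; apply: (@geometric_le0 _ _ 2) => k.
  by have := hp k; have := x01 k; have := pp k; rewrite ler_norml mulr1 => ? [? ?] /andP[]; lra.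
have [l lL hl] := hphi _ p01.
(* The end points are within [2 / 2 ^+ k] and [3 / 2 ^+ k] of [p]. *)
have e0 : 0 < eta / 5 by rewrite divr_gt0.
have [d d0 hd] := hl _ e0; have [k hk] := geometric_small 3 d0.
have := hbad k; rewrite /bad ltNge => /negP; apply.
have hpk := hp k; rewrite mulr1 in hpk; have ppk := pp k.
have u1 : `|x k + (2 ^+ k)^-1 - p| <= 3 / 2 ^+ k.
  by move: hpk; rewrite !ler_norml => /andP[? ?]; apply/andP; split; lra.
have u2 : `|x k - p| < d by apply: le_lt_trans hpk _; lra.
have := hd _ (le_lt_trans u1 hk); have := hd _ u2; rewrite ![p + _]addrC !subrK.
set A := phi (x k) - phi p; set B := phi (_ + _) - phi p => hA hB.
have -> : phi (x k + (2 ^+ k)^-1) - phi (x k) =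
  (B - l * (x k + (2 ^+ k)^-1 - p)%:C%C) - (A - l * (x k - p)%:C%C) + l * ((2 ^+ k)^-1)%:C%C.
  by rewrite /A /B !rmorphB rmorphD /=; ring.
apply: le_trans (cabsD _ _) _; rewrite [cabs (l * _)]cabsM cabs_real (gtr0_norm ppk).
have := cabsD (B - l * (x k + (2 ^+ k)^-1 - p)%:C%C) (- (A - l * (x k - p)%:C%C)).
rewrite cabsN.
have h1 : cabs l * (2 ^+ k)^-1 <= L * (2 ^+ k)^-1 by rewrite ler_wpM2r// ltW.
have h2 : eta / 5 * `|x k + (2 ^+ k)^-1 - p| <= eta / 5 * (3 / 2 ^+ k) by rewrite ler_wpM2l// ltW.
have h3 : eta / 5 * `|x k - p| <= eta / 5 * (2 / 2 ^+ k) by rewrite ler_wpM2l// ltW.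
by rewrite mulrDl; lra.
Qed.

Lemma mvt f z h (L : R) :
  (forall t : R, 0 <= t <= 1 -> exists2 a, cdiff f (z + t%:C%C *: h) a & cabs (dot a h) <= L) ->
  cabs (f (z + h) - f z) <= L.
Proof.
move=> hf; have := @straddle (fun t => f (z + t%:C%C *: h)) L.
rewrite scale1r scale0r addr0; apply => t /hf[a ha aL].
exists (dot a h) => // e e0; have [d d0 hd] := cdiff_line ha e0.
exists d => // u ud; have := hd u%:C%C; rewrite cabs_real rmorphD; exact.
Qed.

Definition holo_ball f z r (M : R) :=
  forall h, cnorm h < r -> (exists a, cdiff f (z + h) a) /\ cabs (f (z + h)) <= M.

Lemma holo_ball_shift f z u r s M : cnorm u + s <= r -> holo_ball f z r M -> holo_ball f (z + u) s M.
Proof.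
move=> us hf h hs; rewrite -addrA; apply: hf.
by apply: le_lt_trans (cnormD _ _) _; lra.
Qed.

Lemma holo_ball_le f z s r M : s <= r -> holo_ball f z r M -> holo_ball f z s M.
Proof. by move=> sr hf h hs; apply: hf; apply: lt_le_trans sr. Qed.

Lemma holo_ball_ge0 f z r M : 0 < r -> holo_ball f z r M -> 0 <= M.
Proof. by move=> r0 /(_ 0); rewrite cnorm0 => /(_ r0)[_]; apply: le_trans; apply: cabs_ge0. Qed.

(** Cauchy's estimate on the complex line through [z] in the direction [h]. *)
Lemma gradient_bound f z a h r M : 0 < r -> holo_ball f z r M -> cdiff f z a ->
  cabs (dot a h) * r <= 3 * M * cnorm h.
Proof.
move=> r0 hf ha; have [->|h0] := eqVneq h 0; first by rewrite dot0r cabs0 mul0r cnorm0 mulr0.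
have H0 : 0 < cnorm h by rewrite cnorm_gt0.
rewrite -ler_pdivrMr// -mulrA.
have small t : cabs t < r / cnorm h -> cnorm (t *: h) < r.
  by rewrite cnormZ ltr_pdivlMr.
apply: (@cauchy_estimate _ (fun t => f (z + t *: h)) (dot a h) M).
- by rewrite divr_gt0.
- move=> t /small /hf[[b hb] _]; exists (dot b h); exact: cdiff_line.
- by move=> t /small /hf[].
- by apply: cdiff_line; rewrite scale0r addr0.
Qed.

Lemma holo_lipschitz f z r M u w : 0 < r -> holo_ball f z r M ->
  cnorm u <= r / 2 -> cnorm w <= r / 2 ->
  cabs (f (z + w) - f (z + u)) <= 6 * M / r * cnorm (w - u).
Proof.
move=> r0 hf ur wr; have -> : z + w = z + u + (w - u) by rewrite -addrA [u + _]addrC subrK.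
apply: mvt => t /andP[t0 t1].
set v := t%:C%C *: (w - u).
have uv : cnorm (u + v) <= r / 2.
  have -> : u + v = (1 - t)%:C%C *: u + t%:C%C *: w.
    rewrite /v scalerBr rmorphB scalerBl scale1r; rewrite addrA [RHS]addrAC; done.
  apply: le_trans (cnormD _ _) _; rewrite !cnormZ !cabs_real !ger0_norm ?subr_ge0//.
  have -> : r / 2 = (1 - t) * (r / 2) + t * (r / 2) by ring.
  by apply: lerD; rewrite ler_wpM2l ?subr_ge0.
have [[a ha] _] := hf (u + v) ltac:(lra).
rewrite -addrA; exists a => //.
have r2 : 0 < r / 2 by rewrite divr_gt0.
have := @gradient_bound f (z + (u + v)) a (w - u) (r / 2) M r2 _ ha.
rewrite -ler_pdivlMr//; have -> : 3 * M * cnorm (w - u) / (r / 2) = 6 * M / r * cnorm (w - u).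
  by field; rewrite gt_eqF.
by apply; apply: holo_ball_shift hf; lra.
Qed.

(** Cauchy's estimate applied to the increment [w |-> f (w + u) - f w], which is
    bounded by a multiple of [cnorm u]. *)
Lemma holo_gradient_lipschitz f z r M a b u h : 0 < r -> holo_ball f z r M ->
  cnorm u <= r / 4 -> cdiff f z a -> cdiff f (z + u) b ->
  cabs (dot (b - a) h) <= 72 * M / r ^+ 2 * cnorm u * cnorm h.
Proof.
move=> r0 hf ur ha hb; have r4 : 0 < r / 4 by rewrite divr_gt0.
have := @gradient_bound (fun w => f (w + u) - f w) z (b - a) h (r / 4) (6 * M / r * cnorm u) r4 _
  (cdiffB (cdiff_shift hb) ha).
rewrite -ler_pdivlMr//; set X := (X in _ <= X).
have -> : 72 * M / r ^+ 2 * cnorm u * cnorm h = X by rewrite /X; field; rewrite gt_eqF.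
apply => v vr; split.
  have [[c hc] _] := hf v ltac:(lra).
  have vu : cnorm (v + u) < r by apply: le_lt_trans (cnormD _ _) _; lra.
  have [[d hd] _] := hf _ vu; exists (d - c).
  by apply: cdiffB => //; apply: cdiff_shift; rewrite -addrA.
have vu : cnorm (v + u) <= r / 2 by apply: le_trans (cnormD _ _) _; lra.
have := holo_lipschitz r0 hf _ vu; rewrite -addrA => /(_ v).
by rewrite [v + u - v]addrAC subrr add0r; apply; lra.
Qed.

(** A second-order Taylor estimate whose constant depends only on the bound [M] and
    on the radius, as needed for passing to limits. *)
Lemma holo_quadratic f z r M a h : 0 < r -> holo_ball f z r M -> cnorm h <= r / 4 ->
  cdiff f z a -> cabs (f (z + h) - f z - dot a h) <= 72 * M / r ^+ 2 * cnorm h ^+ 2.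
Proof.
move=> r0 hf hr ha; have M0 := holo_ball_ge0 r0 hf.
have := @mvt (fun w => f w - dot a w) z h (72 * M / r ^+ 2 * cnorm h ^+ 2).
have -> : f (z + h) - dot a (z + h) - (f z - dot a z) = f (z + h) - f z - dot a h.
  by rewrite dotDr; ring.
apply => t /andP[t0 t1].
have th : cnorm (t%:C%C *: h) <= cnorm h.
  by rewrite cnormZ cabs_real ger0_norm// ler_piMl ?cnorm_ge0.
have [[b hb] _] := hf (t%:C%C *: h) ltac:(lra).
exists (b - a); first by apply: cdiffB => //; apply: cdiff_dot.
apply: le_trans (holo_gradient_lipschitz _ r0 hf _ ha hb) _; first by lra.
rewrite expr2 mulrA ler_wpM2r ?cnorm_ge0// ler_wpM2l// divr_ge0 ?sqr_ge0//.
by rewrite mulr_ge0.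
Qed.

Lemma quadratic_cdiff f z a r (B : R) : 0 < r -> 0 <= B ->
  (forall h, cnorm h <= r -> cabs (f (z + h) - f z - dot a h) <= B * cnorm h ^+ 2) ->
  cdiff f z a.
Proof.
move=> r0 B0 hf e e0; have B1 : 0 < B + 1 by lra.
exists (Num.min r (e / (B + 1))) => [|h]; first by rewrite lt_min r0 divr_gt0.
rewrite lt_min ltr_pdivlMr// => /andP[/ltW hr /ltW he]; apply: le_trans (hf _ hr) _.
rewrite expr2 mulrA ler_wpM2r ?cnorm_ge0//; apply: le_trans he.
by rewrite mulrC ler_wpM2l ?cnorm_ge0//; lra.
Qed.

(** Weierstrass' theorem: Cauchy's estimate for [fk k.+1 - fk k] makes the gradients
    converge, and the uniform bound on the second-order Taylor remainder survives
    in the limit. *)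
Lemma holo_limit (fk : nat -> V -> C) f z (ak : nat -> V) r (M A : R) : 0 < r ->
  (forall k, holo_ball (fk k) z r M) ->
  (forall h, cnorm h < r -> forall k, cabs (fk k (z + h) - f (z + h)) <= A / 2 ^+ k) ->
  (forall k, cdiff (fk k) z (ak k)) ->
  exists2 a, cdiff f z a & exists B, forall k i, cabs (ak k 0 i - a 0 i) <= B / 2 ^+ k.
Proof.
move=> r0 hk hlim hak.
have A0 : 0 <= A.
  have := hlim 0 _ 0%N; rewrite cnorm0 expr0 divr1 => /(_ r0); apply: le_trans; exact: cabs_ge0.
have step k i : cabs (ak k.+1 0 i - ak k 0 i) <= (6 * A / r) / 2 ^+ k.
  have := @gradient_bound (fun w => fk k.+1 w - fk k w) z (ak k.+1 - ak k) (delta_mx 0 i) r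
    (2 * (A / 2 ^+ k)) r0 _ (cdiffB (hak _) (hak _)).
  rewrite dot_delta !mxE cnorm_delta mulr1 -ler_pdivlMr// => h.
  have -> : 6 * A / r / 2 ^+ k = 3 * (2 * (A / 2 ^+ k)) / r.
    by field; rewrite expf_neq0// gt_eqF.
  apply: h => v vr; split.
    have [[b hb] _] := hk k.+1 v vr; have [[c hc] _] := hk k v vr.
    by exists (b - c); apply: cdiffB.
  apply: le_trans (cabsB _ (f (z + v)) _) _; rewrite (cabsC (f _)).
  have := hlim v vr k; have := hlim v vr k.+1.
  have : A / 2 ^+ k.+1 <= A / 2 ^+ k.
    by rewrite ler_wpM2l// lef_pV2 ?posrE ?exprn_gt0// exprS ler_peMl ?exprn_ge0// ler1n.
  lra.
pose a : V := \row_i glim (fun k => ak k 0 i).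
have ha k i : cabs (ak k 0 i - a 0 i) <= (24 * A / r) / 2 ^+ k.
  have := geometric_cvg (fun k => step k i) k; rewrite mxE.
  by have -> : 4 * (6 * A / r) / 2 ^+ k = 24 * A / r / 2 ^+ k by field; rewrite expf_neq0// gt_eqF.
exists a; last by exists (24 * A / r).
have r4 : 0 < r / 4 by rewrite divr_gt0.
have M0 := holo_ball_ge0 r0 (hk 0%N).
apply: (@quadratic_cdiff _ _ _ (r / 4) (72 * M / r ^+ 2)) => //.
  by rewrite divr_ge0 ?sqr_ge0// mulr_ge0.
move=> h hr; rewrite -subr_le0.
apply: (@geometric_le0 _ _ (2 * A + n.+1%:R * (24 * A / r) * cnorm h)) => k.
have h0 := hlim 0 ltac:(by rewrite cnorm0) k; rewrite addr0 in h0.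
have h1 := hlim h ltac:(lra) k.
have h2 : cabs (dot (ak k - a) h) <= n.+1%:R * (24 * A / r / 2 ^+ k) * cnorm h.
  by apply: dot_bound => i; rewrite 2!mxE; apply: ha.
have h3 := holo_quadratic r0 (hk k) hr (hak k).
have -> : f (z + h) - f z - dot a h =
   (fk k (z + h) - fk k z - dot (ak k) h) - (fk k (z + h) - f (z + h)) + (fk k z - f z)
   + dot (ak k - a) h by rewrite dotBl; ring.
have t1 := cabsD (fk k (z + h) - fk k z - dot (ak k) h - (fk k (z + h) - f (z + h)) + (fk k z - f z))
  (dot (ak k - a) h).
have t2 := cabsD (fk k (z + h) - fk k z - dot (ak k) h - (fk k (z + h) - f (z + h))) (fk k z - f z).
have t3 := cabsD (fk k (z + h) - fk k z - dot (ak k) h) (- (fk k (z + h) - f (z + h))).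
rewrite cabsN in t3.
have e : n.+1%:R * (24 * A / r / 2 ^+ k) * cnorm h = n.+1%:R * (24 * A / r) * cnorm h / 2 ^+ k by ring.
rewrite e in h2.
have -> : (2 * A + n.+1%:R * (24 * A / r) * cnorm h) / 2 ^+ k =
  2 * (A / 2 ^+ k) + n.+1%:R * (24 * A / r) * cnorm h / 2 ^+ k by ring.
lra.
Qed.

Definition grad f z : V := xget 0 [set a | cdiff f z a].

Lemma gradE f z a : cdiff f z a -> grad f z = a.
Proof.
move=> ha; rewrite /grad; case: xgetP => [b _ hb|/(_ a)//].
exact: cdiff_unique hb ha.
Qed.

Lemma gradP f z a : cdiff f z a -> cdiff f z (grad f z).
Proof. by move=> ha; rewrite (gradE ha). Qed.

(** Partial derivatives of holomorphic functions are holomorphic, being locally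
    uniform limits of difference quotients. *)
Lemma grad_cdiff f z r M i : 0 < r -> holo_ball f z r M ->
  exists a, cdiff (fun w => grad f w 0 i) z a.
Proof.
move=> r0 hf; have M0 := holo_ball_ge0 r0 hf.
pose t k : R := r / 8 / 2 ^+ k; pose e : V := delta_mx 0 i.
have t0 k : 0 < t k by rewrite !divr_gt0 ?exprn_gt0.
have tr k : t k <= r / 8.
  rewrite /t ler_pdivrMr ?exprn_gt0// ler_peMr ?divr_ge0 ?(ltW r0)//.
  by rewrite exprn_ege1 ?ler1n.
have te k : cnorm ((t k)%:C%C *: e) = t k.
  by rewrite cnormZ cnorm_delta mulr1 cabs_real gtr0_norm.
have tC k : (t k)%:C%C != 0 :> C by rewrite -cabs_gt0 cabs_real gtr0_norm.
pose fk k w : C := ((t k)%:C%C)^-1 * (f (w + (t k)%:C%C *: e) - f w).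
have hd w k : cnorm w <= r / 8 -> exists b, cdiff (fk k) (z + w) b.
  move=> wr; have [[b hb] _] := hf w ltac:(lra).
  have wt : cnorm (w + (t k)%:C%C *: e) < r.
    by apply: le_lt_trans (cnormD _ _) _; rewrite te; have := tr k; lra.
  have [[c hc] _] := hf _ wt.
  exists ((t k)%:C%C^-1 *: (c - b)); apply: cdiffZ; apply: cdiffB => //.
  by apply: cdiff_shift; rewrite -addrA.
have r8 : 0 < r / 8 by rewrite divr_gt0.
have h0 : cnorm (0 : V) <= r / 8 by rewrite cnorm0 ltW.
have /choice[ak hak] := fun k => hd 0 k h0; rewrite addr0 in hak.
have [|h hr k|a ha _] := @holo_limit fk (fun w => grad f w 0 i) z ak (r / 8) (6 * M / r)
   (72 * M / (r / 2) ^+ 2 * (r / 8)) r8 _ _ hak.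
- move=> k h hr; split; first by apply: hd; apply: ltW.
  rewrite /fk cabsM cabsV cabs_real gtr0_norm// ler_pdivrMl// mulrC.
  have ht : cnorm (h + (t k)%:C%C *: e) <= r / 2.
    by apply: le_trans (cnormD _ _) _; rewrite te; have := tr k; lra.
  have := holo_lipschitz (u := h) r0 hf ltac:(lra) ht.
  by rewrite addrA [h + _ - h]addrAC subrr add0r te.
- have [[b hb] _] := hf h ltac:(lra); rewrite (gradE hb) /fk.
  have r2 : 0 < r / 2 by rewrite divr_gt0.
  have hs : holo_ball f (z + h) (r / 2) M by apply: holo_ball_shift hf; lra.
  have ht4 : cnorm ((t k)%:C%C *: e) <= r / 2 / 4 by rewrite te; have := tr k; lra.
  have := holo_quadratic r2 hs ht4 hb.
  rewrite te dotZr dot_delta.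
  have -> : (t k)%:C%C^-1 * (f (z + h + (t k)%:C%C *: e) - f (z + h)) - b 0 i =
    (t k)%:C%C^-1 * (f (z + h + (t k)%:C%C *: e) - f (z + h) - (t k)%:C%C * b 0 i).
    by rewrite [RHS]mulrBr mulrA mulVf// mul1r.
  rewrite cabsM cabsV cabs_real gtr0_norm// ler_pdivrMl// => /le_trans; apply.
  set X := 72 * M / _; have -> // : t k * (X * (r / 8) / 2 ^+ k) = X * t k ^+ 2.
  by rewrite /t; ring.
- by exists a.
Qed.

End LocalEstimates.

(** * Complex gradients and Frechet differentials *)

Section LibraryBridge.
Variables (R : realType) (n : nat).
Local Notation K := (R[i] : numFieldType).
Local Notation C := R[i].
Local Notation V := 'rV[K]_n.+1.
Implicit Types (z w h a : V) (r : R).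

Lemma gt0_complexE (e : K) : 0 < e -> e = (complex.Re e)%:C%C.
Proof. by case: e => x y; rewrite ltcE /= => /andP[/eqP -> _]. Qed.

Lemma nbhs0_cnorm (P : V -> Prop) : (\forall h \near (0 : V), P h) <->
  exists2 d : R, 0 < d & forall h, cnorm h < d -> P h.
Proof.
split=> [/nbhs_normP[d /= d0 hd]|[d d0 hd]].
  have dE := gt0_complexE d0.
  exists (complex.Re d) => [|h hr]; first by move: d0; rewrite dE ltcR.
  by apply: hd; rewrite /= sub0r normrN norm_cnorm dE ltcR.
apply/nbhs_normP; exists d%:C%C => /=; first by rewrite ltcR.
by move=> h; rewrite /= sub0r normrN norm_cnorm ltcR; exact: hd.
Qed.

Lemma differentiable_eps (W : normedModType K) (F : V -> W) z : differentiable F z ->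
  forall e : R, 0 < e -> exists2 d : R, 0 < d &
    forall h, cnorm h < d -> `|F (z + h) - F z - 'd F z h| <= e%:C%C * `|h|.
Proof.
move=> /diff_locallyP[_ /eqaddoP hF] e e0.
have /hF/nbhs0_cnorm[d d0 hd] : (0 : K) < e%:C%C by rewrite ltcR.
by exists d => // h /hd; rewrite [z + h]addrC -[_ - _ - _]addrA -opprD; apply.
Qed.

(** Uniqueness of the differential identifies it with the linear part of any
    first-order expansion. *)
Lemma differentiable_from (W : normedModType K) (F : V -> W) (L : {linear V -> W}) z (B : R) :
  (forall h, `|L h| <= B%:C%C * `|h|) ->
  (forall e : R, 0 < e -> exists2 d : R, 0 < d &
    forall h, cnorm h < d -> `|F (z + h) - F z - L h| <= e%:C%C * `|h|) ->
  differentiable F z /\ 'd F z = L :> (V -> W).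
Proof.
move=> hB hF.
have Lc : continuous L.
  apply: bounded_linear_continuous; apply/linear_boundedP; exists B%:C%C; split.
    by apply/complex_realP; exists B.
  by move=> M BM h; apply: le_trans (hB h) _; rewrite ler_wpM2r// ltW.
have hL : F \o shift z = cst (F z) + L +o_ (0 : V) id.
  apply/eqaddoP => e e0.
  have eE := gt0_complexE e0.
  have /hF[d d0 hd] : 0 < complex.Re e by move: e0; rewrite {1}eE ltcR.
  by apply/nbhs0_cnorm; exists d => // h /hd; rewrite -eE [z + h]addrC -[_ - _ - _]addrA -opprD; apply.
have dE := diff_unique Lc hL; split => //.
by apply/diff_locallyP; rewrite dE.
Qed.

Lemma linear_rowE (W : lmodType K) (L : {linear V -> W}) h : L h = \sum_i h 0 i *: L (delta_mx 0 i).
Proof. by rewrite {1}[h]row_sum_delta linear_sum; apply: eq_bigr => i _; rewrite linearZ. Qed.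

Lemma differentiable_cdiff (f : V -> K) z : differentiable f z ->
  cdiff f z (\row_i ('d f z (delta_mx 0 i) : K)).
Proof.
move=> hf e e0; have [d d0 hd] := differentiable_eps hf e0.
exists d => // h /hd; rewrite normC_cabs norm_cnorm -rmorphM lecR /= => h1.
rewrite (_ : dot _ h = 'd f z h)// linear_rowE.
by apply: eq_bigr => i _; rewrite mxE mulrC.
Qed.

Lemma dot_linear a : linear (dot a : V -> K).
Proof. by move=> c h w; rewrite dotDr dotZr. Qed.

Lemma cdiff_differentiable (f : V -> K) z a : cdiff f z a -> differentiable f z.
Proof.
move=> ha.
pose lin := GRing.isLinear.Build _ _ _ _ _ (dot_linear a).
pose L : {linear V -> K} := HB.pack (dot a : V -> K) lin.
have [] // := @differentiable_from _ f L z (n.+1%:R * cnorm a).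
  move=> h; rewrite normC_cabs norm_cnorm -rmorphM lecR /=.
  by apply: dot_bound => i; apply: cabs_le_cnorm.
move=> e /ha[d d0 hd]; exists d => // h /hd.
by rewrite normC_cabs norm_cnorm -rmorphM lecR.
Qed.

Lemma differentiable_comp_cdiff (F : V -> V) z j : differentiable F z ->
  cdiff (fun w => F w 0 j) z (\row_i ('J F z) i j).
Proof.
move=> hf e e0; have [d d0 hd] := differentiable_eps hf e0.
exists d => // h /hd; rewrite !norm_cnorm -rmorphM lecR /= => /le_trans h1.
apply: le_trans _ (h1 _ (lexx _)); apply: le_trans _ (cabs_le_cnorm _ j).
rewrite !mxE (_ : dot _ h = ('d F z h) 0 j)// linear_rowE summxE.
by apply: eq_bigr => i _; rewrite !mxE mulrC.
Qed.

Lemma row_dot_linear (a : 'I_n.+1 -> V) : linear (fun h => \row_j dot (a j) h : V).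
Proof. by move=> c h w; apply/rowP => j; rewrite !mxE dotDr dotZr. Qed.

Lemma cdiff_comp_differentiable (F : V -> V) z (a : 'I_n.+1 -> V) :
  (forall j, cdiff (fun w => F w 0 j) z (a j)) ->
  differentiable F z /\ 'd F z = (fun h => \row_j dot (a j) h) :> (V -> V).
Proof.
move=> ha.
pose lin := GRing.isLinear.Build _ _ _ _ _ (row_dot_linear a).
pose L : {linear V -> V} := HB.pack (fun h => \row_j dot (a j) h : V) lin.
apply: (@differentiable_from _ F L z (n.+1%:R * \sum_j cnorm (a j))).
  move=> h; rewrite !norm_cnorm -rmorphM lecR /=.
  apply: cnorm_le => [|j].
    by rewrite !mulr_ge0 ?cnorm_ge0 ?sumr_ge0// => i _; apply: cnorm_ge0.
  rewrite mxE; apply: dot_bound => i; apply: le_trans (cabs_le_cnorm _ _) _.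
  by rewrite (bigD1 j)//= lerDl sumr_ge0// => k _; apply: cnorm_ge0.
move=> e e0.
have hd' : forall j, exists d, 0 < d /\ forall h, cnorm h < d ->
    cabs (F (z + h) 0 j - F z 0 j - dot (a j) h) <= e * cnorm h.
  by move=> j; have [d' ? ?] := ha j e e0; exists d'.
have {hd'}/choice[dd hdd] := hd'.
exists (\big[Num.min/1]_j dd j).
  by apply/bigmin_gtP; split => // j _; have [] := hdd j.
move=> h /bigmin_gtP[_ hh]; rewrite !norm_cnorm -rmorphM lecR /=.
apply: cnorm_le => [|j]; first by rewrite mulr_ge0 ?cnorm_ge0 ?ltW.
by rewrite !mxE; have [_] := hdd j; apply; apply: hh.
Qed.

End LibraryBridge.

(** * Real-analytic functions on strips *)

Section Strips.
Variables (R : realType) (n : nat).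
Local Notation K := (R[i] : numFieldType).
Local Notation C := R[i].
Local Notation V := 'rV[K]_n.+1.
Implicit Types (z w h a : V) (r s : R) (k : 'rV[int]_n.+1).

Lemma row_norm_ltP m (x : 'rV[R]_m) r :
  `|x| < r <-> 0 < r /\ forall i, `|x 0 i| < r.
Proof.
split=> [h|[r0 h]].
  by split=> [|i]; [apply: le_lt_trans h | apply: le_lt_trans (mx_entry_le _ _ _) h].
have [x0|/mx_norm_neq0[[i j] /= e]] := eqVneq (mx_norm x) 0; first by rewrite [`|x|]x0.
by rewrite [`|x|]e ord1.
Qed.

Lemma stripP r z : strip r z <-> 0 < r /\ forall i, `|complex.Im (z 0 i)| < r.
Proof.
rewrite /strip /= row_norm_ltP.
by split=> -[r0 h]; split=> // i; have := h i; rewrite mxE.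
Qed.

Lemma strip_le r s z : r <= s -> strip r z -> strip s z.
Proof. by move=> rs h; apply: lt_le_trans rs. Qed.

Lemma strip_add r s z h : cnorm h <= s -> strip r z -> strip (r + s) (z + h).
Proof.
move=> hs /stripP[r0 hz]; have s0 := le_trans (cnorm_ge0 h) hs.
apply/stripP; split=> [|i]; first by rewrite ltr_wpDr.
rewrite mxE; have := hz i; have := le_trans (cabs_le_cnorm h i) hs.
move: (Im_le_cabs (h 0 i)); case: (z 0 i) (h 0 i) => x y [x' y'] /=.
by have := ler_normD y y'; lra.
Qed.

Lemma strip_sub r s z h : cnorm h <= s -> strip (r - s) z -> strip r (z + h).
Proof. by move=> hs /(strip_add hs); rewrite subrK. Qed.

Lemma strip_open r z : strip r z -> exists2 d : R, 0 < d & strip (r - d) z.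
Proof.
rewrite /strip /= => h; exists ((r - `|map_mx (@complex.Im R) z|) / 2); first by rewrite divr_gt0 ?subr_gt0.
lra.
Qed.

(** Strips only see imaginary parts, so they are invariant under all real
    translations; averages along real directions lose no analyticity. *)
Lemma strip_real_shift r z h : is_real_vec h -> strip r (z + h) <-> strip r z.
Proof.
move=> /rowP h0; rewrite !stripP; split=> -[r0 hz]; split => // i.
  by have := hz i; have := h0 i; rewrite !mxE; case: (z 0 i) (h 0 i) => x y [x' y'] /= ->; rewrite addr0.
by have := hz i; have := h0 i; rewrite !mxE; case: (z 0 i) (h 0 i) => x y [x' y'] /= ->; rewrite addr0.
Qed.

Lemma is_real_vecP z : is_real_vec z <-> forall i, complex.Im (z 0 i) = 0.
Proof.
split=> [/rowP h i|h]; first by have := h i; rewrite !mxE.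
by apply/rowP => i; rewrite !mxE h.
Qed.

Lemma is_real_vecD z w : is_real_vec z -> is_real_vec w -> is_real_vec (z + w).
Proof.
move=> /is_real_vecP hz /is_real_vecP hw; apply/is_real_vecP => i; rewrite mxE.
by move: (hz i) (hw i); case: (z 0 i) (w 0 i) => x y [x' y'] /= -> ->; rewrite addr0.
Qed.

Lemma is_real_vecZ (t : R) z : is_real_vec z -> is_real_vec (t%:C%C *: z).
Proof.
move=> /is_real_vecP hz; apply/is_real_vecP => i; rewrite mxE.
by move: (hz i); case: (z 0 i) => x y /= ->; rewrite mulr0 mul0r addr0.
Qed.

Lemma is_real_int_vec k : is_real_vec (int_vec R k).
Proof.
apply/is_real_vecP => i; rewrite mxE -(rmorph_int (real_complex R)).
by [].
Qed.

Definition holomorphic_on r (f : V -> C) := forall z, strip r z -> exists a, cdiff f z a.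

Definition bounded_on r (f : V -> C) (M : R) := forall z, strip r z -> cabs (f z) <= M.

Lemma strip_holo_ball r s (f : V -> C) M z : holomorphic_on r f -> bounded_on r f M ->
  strip (r - s) z -> holo_ball f z s M.
Proof.
move=> hf bf hz h /ltW hs; have := strip_sub hs hz.
by move=> hzh; split; [apply: hf | apply: bf].
Qed.

Lemma holomorphic_on_differentiable r (f : V -> K) :
  holomorphic_on r f <-> forall z, strip r z -> differentiable f z.
Proof.
split=> hf z /hf; first by move=> [a]; exact: cdiff_differentiable.
by move=> /differentiable_cdiff; eexists; eassumption.
Qed.

End Strips.

Section RealAnalyticScalars.
Variables (R : realType) (n : nat).
Local Notation K := (R[i] : numFieldType).
Local Notation C := R[i].
Local Notation V := 'rV[K]_n.+1.
Implicit Types (z w h a : V) (r s : R) (f g : V -> C).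

(** Scalar counterpart of [real_analytic_vector_field]; the three conditions are
    bundled because every closure property below holds for all of them at once. *)
Definition real_analytic r f :=
  [/\ forall z k, strip r z -> f (z + int_vec R k) = f z, holomorphic_on r f &
      forall z, strip r z -> is_real_vec z -> complex.Im (f z) = 0].

Lemma strip_int r z k : strip r z -> strip r (z + int_vec R k).
Proof. by rewrite strip_real_shift//; apply: is_real_int_vec. Qed.

Lemma cdiff_local f g z a (d : R) : 0 < d -> (forall h, cnorm h < d -> f (z + h) = g (z + h)) ->
  cdiff f z a -> cdiff g z a.
Proof.
move=> d0 fg hf e /hf[d' d'0 hd]; exists (Num.min d d') => [|h]; first by rewrite lt_min d0.
rewrite lt_min => /andP[hd1 /hd]; rewrite fg//.
by have := fg 0; rewrite cnorm0 addr0 => ->.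
Qed.

Lemma real_analytic_ext r f g : (forall z, strip r z -> f z = g z) -> real_analytic r f -> real_analytic r g.
Proof.
move=> fg [pf hf rf]; split=> [z k hz|z hz|z hz zr].
- by rewrite -!fg ?pf//; apply: strip_int.
- have [a ha] := hf z hz; exists a; have [d d0 hd] := strip_open hz.
  by apply: cdiff_local d0 _ ha => h /ltW hh; apply: fg; apply: strip_sub hd.
- by rewrite -fg ?rf.
Qed.

Lemma real_analytic_le r s f : s <= r -> real_analytic r f -> real_analytic s f.
Proof.
move=> sr [pf hf rf]; split=> [z k|z|z] /(strip_le sr); [exact: pf|exact: hf|exact: rf].
Qed.

Lemma real_analytic_cst r (c : R) : real_analytic r (fun=> c%:C%C).
Proof. by split=> // z _; exists 0; apply: cdiff_cst. Qed.

Lemma real_analyticD r f g : real_analytic r f -> real_analytic r g -> real_analytic r (fun z => f z + g z).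
Proof.
move=> [pf hf rf] [pg hg rg]; split=> [z k hz|z hz|z hz zr].
- by rewrite pf ?pg.
- by have [a ha] := hf z hz; have [b hb] := hg z hz; exists (a + b); apply: cdiffD.
- have := rf z hz zr; have := rg z hz zr.
  by case: (f z) (g z) => x y [x' y'] /= -> ->; rewrite addr0.
Qed.

Lemma real_analyticM r f g : real_analytic r f -> real_analytic r g -> real_analytic r (fun z => f z * g z).
Proof.
move=> [pf hf rf] [pg hg rg]; split=> [z k hz|z|z hz zr].
- by rewrite pf ?pg.
- move: z; apply/holomorphic_on_differentiable => z hz; apply: differentiableM.
    by move/holomorphic_on_differentiable: hf; apply.
  by move/holomorphic_on_differentiable: hg; apply.
- have := rf z hz zr; have := rg z hz zr.
  by case: (f z) (g z) => x y [x' y'] /= -> ->; rewrite mulr0 mul0r addr0.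
Qed.

Lemma real_analyticZ r (c : R) f : real_analytic r f -> real_analytic r (fun z => c%:C%C * f z).
Proof. by move=> hf; apply: real_analyticM hf; apply: real_analytic_cst. Qed.

Lemma real_analyticB r f g : real_analytic r f -> real_analytic r g -> real_analytic r (fun z => f z - g z).
Proof.
move=> hf hg; have := real_analyticD hf (real_analyticZ (-1) hg); apply: real_analytic_ext => z _.
by rewrite rmorphN1 mulN1r.
Qed.

Lemma real_analytic_sum (I : Type) (s : seq I) (P : pred I) r (F : I -> V -> C) :
  (forall i, real_analytic r (F i)) -> real_analytic r (fun z => \sum_(i <- s | P i) F i z).
Proof.
move=> hF; elim: s => [|i s IH].
  by have := real_analytic_cst r 0; apply: real_analytic_ext => z _; rewrite big_nil.
have := if P i as b return real_analytic r (fun z => if b then F i z + \sum_(j <- s | P j) F j z else \sum_(j <- s | P j) F j z) then real_analyticD (hF i) IH else IH.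
by apply: real_analytic_ext => z _; rewrite big_cons.
Qed.

Lemma real_analytic_prod (I : Type) (s : seq I) (P : pred I) r (F : I -> V -> C) :
  (forall i, real_analytic r (F i)) -> real_analytic r (fun z => \prod_(i <- s | P i) F i z).
Proof.
move=> hF; elim: s => [|i s IH].
  by have := real_analytic_cst r 1; apply: real_analytic_ext => z _; rewrite big_nil.
have := if P i as b return real_analytic r (fun z => if b then F i z * \prod_(j <- s | P j) F j z else \prod_(j <- s | P j) F j z) then real_analyticM (hF i) IH else IH.
by apply: real_analytic_ext => z _; rewrite big_cons.
Qed.

Lemma real_analyticV r f : (forall z, strip r z -> f z != 0) -> real_analytic r f -> real_analytic r (fun z => (f z)^-1).
Proof.
move=> f0 [pf hf rf]; split=> [z k hz|z|z hz zr].
- by rewrite pf.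
- move: z; apply/holomorphic_on_differentiable => z hz; apply: (@differentiableV _ _ (f : V -> K)) (f0 z hz).
  by move/holomorphic_on_differentiable: hf; apply.
- by have := rf z hz zr; case: (f z) => x y /= ->; rewrite mul0r oppr0.
Qed.

Lemma real_analytic_sign r (k : nat) : real_analytic r (fun=> (-1) ^+ k).
Proof.
have := real_analytic_cst r ((-1) ^+ k); apply: real_analytic_ext => z _.
by rewrite rmorphXn /= rmorphN1.
Qed.

Lemma real_analytic_det m r (A : V -> 'M[C]_m) : (forall i j, real_analytic r (fun z => A z i j)) ->
  real_analytic r (fun z => \det (A z)).
Proof.
move=> hA; apply: real_analytic_sum => s; apply: real_analyticM; last by apply: real_analytic_prod => i; apply: hA.
exact: real_analytic_sign.
Qed.

(** By Cramer's rule. *)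
Lemma real_analytic_invmx m r (A : V -> 'M[C]_m) i j : (forall z, strip r z -> A z \in unitmx) ->
  (forall i j, real_analytic r (fun z => A z i j)) -> real_analytic r (fun z => invmx (A z) i j).
Proof.
move=> uA hA.
have h : real_analytic r (fun z => (\det (A z))^-1 * cofactor (A z) j i).
  apply: real_analyticM.
    apply: real_analyticV; last exact: real_analytic_det.
    by move=> z /uA; rewrite unitmxE unitfE.
  rewrite /cofactor; apply: real_analyticM; first exact: real_analytic_sign.
  apply: real_analytic_det => i' j'.
  by have := hA (lift j i') (lift i j'); apply: real_analytic_ext => z _; rewrite !mxE.
by apply: real_analytic_ext h => z /uA uz; rewrite /invmx uz !mxE.
Qed.

Lemma real_analytic_mulmx m p q r (A : V -> 'M[C]_(m, p)) (B : V -> 'M[C]_(p, q)) i j :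
  (forall i j, real_analytic r (fun z => A z i j)) -> (forall i j, real_analytic r (fun z => B z i j)) ->
  real_analytic r (fun z => (A z *m B z) i j).
Proof.
move=> hA hB.
have h : real_analytic r (fun z => \sum_l A z i l * B z l j) by apply: real_analytic_sum => l; apply: real_analyticM.
by apply: real_analytic_ext h => z _; rewrite mxE.
Qed.

Lemma Im_geometric_limit (u : nat -> C) p (A : R) : (forall k, complex.Im (u k) = 0) ->
  (forall k, cabs (u k - p) <= A / 2 ^+ k) -> complex.Im p = 0.
Proof.
move=> hu hp; apply/eqP; rewrite -normr_eq0 eq_le normr_ge0 andbT.
apply: (@geometric_le0 _ _ A) => k; apply: le_trans _ (hp k); apply: le_trans _ (Im_le_cabs _).
by have := hu k; case: (u k) (p) => x y [x' y'] /= ->; rewrite sub0r normrN.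
Qed.

Lemma geometric_limit_unique (u : nat -> C) p q (A B : R) :
  (forall k, cabs (u k - p) <= A / 2 ^+ k) -> (forall k, cabs (u k - q) <= B / 2 ^+ k) -> p = q.
Proof. by move=> hp hq; exact: etrans (esym (glim_unique hp)) (glim_unique hq). Qed.

Definition loc_geometric r (fk : nat -> V -> C) f := forall z, strip r z ->
  exists2 d : R, 0 < d & exists A, forall h, cnorm h < d -> forall k,
    cabs (fk k (z + h) - f (z + h)) <= A / 2 ^+ k.

Lemma loc_geometric_pt r fk f z : loc_geometric r fk f -> strip r z ->
  exists A, forall k, cabs (fk k z - f z) <= A / 2 ^+ k.
Proof.
move=> lg /lg[d d0 [A hA]]; exists A => k.
by have := hA 0; rewrite cnorm0 addr0; apply.
Qed.

Lemma real_analytic_limit r (fk : nat -> V -> C) f M :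
  (forall k, real_analytic r (fk k)) -> (forall k, bounded_on r (fk k) M) -> loc_geometric r fk f -> real_analytic r f.
Proof.
move=> hk bk lg; split=> [z k hz|z hz|z hz zr].
- have [A hA] := loc_geometric_pt lg hz.
  have [B hB] := loc_geometric_pt lg (strip_int k hz).
  apply: geometric_limit_unique hB _ => j; have [-> // _ _] := hk j; exact: hA.
- have [d d0 [A hA]] := lg z hz; have [e e0 he] := strip_open hz.
  have m0 : 0 < Num.min d e by rewrite lt_min d0.
  have /choice[ak hak] : forall k, exists a, cdiff (fk k) z a by move=> k; have [_ + _] := hk k; apply.
  have hb k : holo_ball (fk k) z (Num.min d e) M.
    by apply: holo_ball_le (minr_le _ _) _; apply: strip_holo_ball he => //; have [] := hk k.
  have [|a ha _] := holo_limit m0 hb _ hak (f := f) (A := A); last by exists a.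
  by move=> h hh; apply: hA; apply: lt_le_trans hh (minl_le _ _).
- have [A hA] := loc_geometric_pt lg hz.
  by apply: Im_geometric_limit hA => k; have [_ _] := hk k; apply.
Qed.

(** The derivative along a real direction of a function that is real at real points
    is a limit of real difference quotients. *)
Lemma real_analytic_grad r f M i : real_analytic r f -> bounded_on r f M -> real_analytic r (fun z => grad f z 0 i).
Proof.
move=> [pf hf rf] bf; split=> [z k hz|z hz|z hz zr].
- have [a ha] := hf z hz; rewrite (gradE ha); congr (fun v : V => v 0 i); apply: gradE.
  have [d d0 hd] := strip_open hz.
  apply: (@cdiff_local (fun w => f (w - int_vec R k)) _ _ _ d) => //.
    move=> h /ltW hh; rewrite addrAC addrK -(pf _ k); last exact: strip_sub hd.
    by congr f; rewrite addrAC.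
  by apply: cdiff_shift; rewrite addrK.
- have [d d0 hd] := strip_open hz.
  exact: grad_cdiff d0 (strip_holo_ball hf bf hd).
- have [a ha] := hf z hz; rewrite (gradE ha).
  have [d d0 hd] := strip_open hz; have hb := strip_holo_ball hf bf hd.
  pose t k : R := d / 4 / 2 ^+ k; pose e : V := delta_mx 0 i.
  have t0 k : 0 < t k by rewrite !divr_gt0 ?exprn_gt0.
  have er : is_real_vec e.
    by apply/is_real_vecP => j; rewrite mxE; case: (_ && _).
  have tr k : t k <= d / 4.
    rewrite /t ler_pdivrMr ?exprn_gt0// ler_peMr ?divr_ge0 ?(ltW d0)//.
    by rewrite exprn_ege1 ?ler1n.
  have te k : cnorm ((t k)%:C%C *: e) = t k.
    by rewrite cnormZ cnorm_delta mulr1 cabs_real gtr0_norm.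
  have tC k : (t k)%:C%C != 0 :> C by rewrite -cabs_gt0 cabs_real gtr0_norm.
  apply: (@Im_geometric_limit (fun k => ((t k)^-1)%:C%C * (f (z + (t k)%:C%C *: e) - f z))
     _ (72 * M / d ^+ 2 * (d / 4))) => k.
    have zr' : is_real_vec (z + (t k)%:C%C *: e) by apply: is_real_vecD => //; apply: is_real_vecZ.
    have hz' : strip r (z + (t k)%:C%C *: e) by apply/strip_real_shift => //; apply: is_real_vecZ.
    have := rf _ hz' zr'; have := rf _ hz zr.
    by case: (f z) (f (z + _)) => x y [x' y'] /= -> ->; rewrite subr0 mulr0 mul0r addr0.
  have := holo_quadratic d0 hb (h := (t k)%:C%C *: e) (a := a); rewrite te => /(_ (tr k) ha).
  rewrite dotZr dot_delta.
  have -> : ((t k)^-1)%:C%C * (f (z + (t k)%:C%C *: e) - f z) - a 0 i =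
    ((t k)^-1)%:C%C * (f (z + (t k)%:C%C *: e) - f z - (t k)%:C%C * a 0 i).
    by rewrite [RHS]mulrBr [X in _ = _ - X]mulrA fmorphV (mulVf (tC k)) mul1r.
  rewrite cabsM cabs_real gtr0_norm ?invr_gt0// ler_pdivrMl// => /le_trans; apply.
  set X := 72 * M / _; have -> // : t k * (X * (d / 4) / 2 ^+ k) = X * t k ^+ 2.
  by rewrite /t; ring.
Qed.

Lemma real_analytic_vector_fieldP r (F : V -> V) :
  real_analytic_vector_field r F <-> forall j, real_analytic r (fun z => F z 0 j).
Proof.
split=> [[pF hF rF] j|h]; split=> [z k hz|z hz|z hz zr].
- by rewrite pF.
- by eexists; apply: differentiable_comp_cdiff; apply: hF.
- by have /is_real_vecP := rF z hz zr.
- by apply/rowP => j; have [+ _ _] := h j; apply.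
- have /choice[a ha] : forall j, exists a, cdiff (fun w => F w 0 j) z a.
    by move=> j; have [_ + _] := h j; apply.
  by have [] := cdiff_comp_differentiable ha.
- by apply/is_real_vecP => j; have [_ _] := h j; apply.
Qed.

Lemma real_analytic_comp r s (F : V -> V) f : (forall j, real_analytic r (fun z => F z 0 j)) ->
  (forall z, strip r z -> strip s (z + F z)) -> real_analytic s f -> real_analytic r (fun z => f (z + F z)).
Proof.
move=> /real_analytic_vector_fieldP[pF hF rF] rs [pf hf rf].
split=> [z k hz|z|z hz zr].
- by rewrite pF// addrAC pf//; apply: rs.
- move: z; apply/holomorphic_on_differentiable => z hz.
  have dF : differentiable (fun z => z + F z) z.
    have idd : differentiable (id : V -> V) z by [].
    by apply: (differentiableD idd); apply: hF.
  apply: (@differentiable_comp _ _ _ _ (fun z : V => z + F z) (f : V -> K) z dF).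
  by move/holomorphic_on_differentiable: hf; apply; apply: rs.
- by apply: rf; [exact: rs | apply: is_real_vecD => //; exact: rF].
Qed.

End RealAnalyticScalars.

(** * Averages along integer vectors *)

Section DyadicSums.
Variable R : realType.
Local Notation C := R[i].
Implicit Types (phi : R -> C) (k m : nat).

Definition node k (j : nat) : R := j%:R / 2 ^+ k.

Definition rsum phi k : C := ((2 ^+ k)^-1)%:C%C * \sum_(j < 2 ^ k) phi (node k j).

Lemma sum_double (F : nat -> C) m :
  \sum_(j < m.*2) F j = \sum_(j < m) (F j.*2 + F j.*2.+1).
Proof.
elim: m => [|m IH]; first by rewrite !big_ord0.
by rewrite doubleS !big_ord_recr /= IH addrA.
Qed.

Lemma node01 k j : (j <= 2 ^ k)%N -> 0 <= node k j <= 1.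
Proof.
move=> jk; rewrite /node divr_ge0 ?exprn_ge0//= ler_pdivrMr ?exprn_gt0// mul1r.
by rewrite -natrX ler_nat.
Qed.

Lemma node_double k j : node k.+1 j.*2 = node k j.
Proof. by rewrite /node -muln2 natrM exprSr; field; rewrite expf_neq0. Qed.

Lemma rsum_bound phi (B : R) k : (forall t, 0 <= t <= 1 -> cabs (phi t) <= B) ->
  cabs (rsum phi k) <= B.
Proof.
move=> hB; rewrite /rsum cabsM cabs_real gtr0_norm ?invr_gt0 ?exprn_gt0//.
rewrite ler_pdivrMl ?exprn_gt0//; apply: le_trans (cabs_sum _ _ _) _.
apply: (@le_trans _ _ (\sum_(j < 2 ^ k) B)).
  by apply: ler_sum => j _; apply: hB; apply: node01; apply: ltnW.
by rewrite sumr_const card_ord -[_ *+ (_ ^ _)%N]mulr_natl natrX.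
Qed.

(** Refining the subdivision moves every second node by half a step. *)
Lemma rsum_step phi (L : R) k :
  (forall s t, 0 <= s <= 1 -> 0 <= t <= 1 -> cabs (phi s - phi t) <= L * `|s - t|) ->
  cabs (rsum phi k.+1 - rsum phi k) <= L / 2 ^+ k.
Proof.
move=> hL; have L0 : 0 <= L.
  have := hL 1 0; rewrite !lexx ler01 subr0 normr1 mulr1 => h.
  by apply: le_trans (cabs_ge0 _) (h _ _).
have p0 j : 0 < (2 ^+ j)^-1 :> R by rewrite invr_gt0 exprn_gt0.
have -> : rsum phi k.+1 - rsum phi k =
   ((2 ^+ k.+1)^-1)%:C%C * \sum_(j < 2 ^ k) (phi (node k.+1 j.*2.+1) - phi (node k j)).
  rewrite /rsum expnS mul2n (sum_double (fun j => phi (node k.+1 j))) !big_split /= sumrN.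
  under eq_bigr do rewrite node_double.
  have -> : ((2 ^+ k)^-1)%:C%C = 2 * ((2 ^+ k.+1)^-1)%:C%C :> C.
    have -> : 2 = 2%:R%:C%C :> C by rewrite rmorph_nat.
    by rewrite -rmorphM exprS invfM mulrA divff ?mul1r.
  by ring.
rewrite cabsM cabs_real gtr0_norm//.
have h1 : cabs (\sum_(j < 2 ^ k) (phi (node k.+1 j.*2.+1) - phi (node k j))) <=
    \sum_(j < 2 ^ k) (L * (2 ^+ k.+1)^-1).
  apply: le_trans (cabs_sum _ _ _) _; apply: ler_sum => j _.
  have hj : (j.*2.+1 <= 2 ^ k.+1)%N.
    by have jl := ltn_ord j; rewrite expnS; lia.
  apply: le_trans (hL _ _ (node01 hj) (node01 (ltnW (ltn_ord j)))) _.
  rewrite -(node_double k j) ler_wpM2l// /node -mulrBl -natrB ?leqnSn// subSnn mul1r.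
  by rewrite gtr0_norm.
apply: le_trans (ler_wpM2l (ltW (p0 _)) h1) _.
rewrite sumr_const card_ord -[_ *+ (_ ^ _)%N]mulr_natl natrX.
have -> : (2 ^+ k.+1)^-1 * (2 ^+ k * (L * (2 ^+ k.+1)^-1)) = L / 2 ^+ k * 4^-1.
  by rewrite exprS; field; rewrite expf_neq0.
by rewrite ler_piMr ?divr_ge0 ?exprn_ge0// invf_le1// ler1n.
Qed.

(** Summation by parts; it stands for the integration by parts that solves the
    cohomological equation. *)
Lemma abel_sum (w u : nat -> C) m :
  \sum_(j < m) w j * (u j.+1 - u j) =
  w m * u m - w 0%N * u 0%N - \sum_(j < m) (w j.+1 - w j) * u j.+1.
Proof.
elim: m => [|m IH]; first by rewrite !big_ord0 !subrr.
by rewrite !big_ord_recr /= IH; ring.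
Qed.

End DyadicSums.

Section WeightedMeans.
Variables (R : realType) (n : nat).
Local Notation K := (R[i] : numFieldType).
Local Notation C := R[i].
Local Notation V := 'rV[K]_n.+1.
Implicit Types (z h a y : V) (r s : R) (f g : V -> C) (w : R -> R) (x : 'rV[int]_n.+1).

Definition wsum w x f k z : C :=
  rsum (fun t => (w t)%:C%C * f (z + t%:C%C *: int_vec R x)) k.

(** The integral of [w t * f (z + t x)] over [0 <= t <= 1]. It is realised as the
    limit of the Riemann sums [wsum w x f k z], which are finite combinations of
    real translates of [f]. *)
Definition wmean w x f z : C := glim (fun k => wsum w x f k z).

Definition flow_invariant r f y :=
  forall z (t : R), strip r z -> f (z + t%:C%C *: y) = f z.

Definition good_weight w (B : R) :=
  (forall t, 0 <= t <= 1 -> `|w t| <= B) /\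
  (forall s t, 0 <= s <= 1 -> 0 <= t <= 1 -> `|w s - w t| <= `|s - t|).

Lemma strip_line r z (t : R) x : strip r (z + t%:C%C *: int_vec R x) <-> strip r z.
Proof. by apply: strip_real_shift; apply: is_real_vecZ; apply: is_real_int_vec. Qed.

Lemma real_analytic_real_shift r f h : is_real_vec h -> real_analytic r f -> real_analytic r (fun z => f (z + h)).
Proof.
move=> hr [pf hf rf]; split=> [z k hz|z hz|z hz zr].
- by rewrite addrAC pf//; apply/strip_real_shift.
- have [|a ha] := hf (z + h); first exact/strip_real_shift.
  by exists a; apply: cdiff_shift.
- by apply: rf; [apply/strip_real_shift | apply: is_real_vecD].
Qed.

Lemma real_analytic_wsum r w x f k : real_analytic r f -> real_analytic r (wsum w x f k).
Proof.
move=> hf; apply: real_analyticZ; apply: real_analytic_sum => j; apply: real_analyticZ; apply: real_analytic_real_shift => //.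
by apply: is_real_vecZ; apply: is_real_int_vec.
Qed.

Lemma bounded_wsum r w x f k (B M : R) : good_weight w B -> bounded_on r f M -> bounded_on r (wsum w x f k) (B * M).
Proof.
move=> [wB _] bf z hz; apply: rsum_bound => t t01; rewrite cabsM cabs_real.
by apply: ler_pM => //; [exact: cabs_ge0 | exact: wB | apply: bf; apply/strip_line].
Qed.

Lemma strip_increment r (d : R) f M h z : 0 < d -> holomorphic_on r f -> bounded_on r f M -> is_real_vec h ->
  strip (r - d) z -> cabs (f (z + h) - f z) <= 3 * M / d * cnorm h.
Proof.
move=> d0 hf bf hr hz; apply: mvt => t _.
have hzt : strip (r - d) (z + t%:C%C *: h) by apply/strip_real_shift => //; apply: is_real_vecZ.
have hb := strip_holo_ball hf bf hzt.
have [|a ha] := hf (z + t%:C%C *: h); first by apply: strip_le hzt; lra.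
by exists a => //; rewrite mulrAC ler_pdivlMr//; exact: (gradient_bound h d0 hb ha).
Qed.

Lemma wsum_step r (d : R) w x f (B M : R) z k : 0 < d -> good_weight w B -> holomorphic_on r f -> bounded_on r f M ->
  strip (r - d) z ->
  cabs (wsum w x f k.+1 z - wsum w x f k z) <= (M + B * (3 * M / d * cnorm (int_vec R x))) / 2 ^+ k.
Proof.
move=> d0 [wB wL] hf bf hz; apply: rsum_step => s t s01 t01.
have hzr : strip r z by apply: strip_le hz; lra.
set fs := f _; set ft := f _.
have -> : (w s)%:C%C * fs - (w t)%:C%C * ft = (w s - w t)%:C%C * fs + (w t)%:C%C * (fs - ft).
  by rewrite rmorphB /=; ring.
apply: le_trans (cabsD _ _) _; rewrite !cabsM !cabs_real mulrDl.
have M0 : 0 <= M by apply: le_trans (bf z hzr); apply: cabs_ge0.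
apply: lerD.
  rewrite mulrC; apply: ler_pM; rewrite ?cabs_ge0 ?wL//.
  by apply: bf; apply/strip_line.
rewrite -mulrA; apply: ler_pM; rewrite ?cabs_ge0 ?wB//.
have := @strip_increment r d f M ((s - t)%:C%C *: int_vec R x) (z + t%:C%C *: int_vec R x) d0 hf bf.
rewrite -addrA -scalerDl -rmorphD /= [t + _]addrC subrK cnormZ cabs_real [`|_| * _]mulrC mulrA; apply.
  by apply: is_real_vecZ; apply: is_real_int_vec.
exact/strip_line.
Qed.

Lemma wsum_geometric r w x f (B M : R) : good_weight w B -> holomorphic_on r f -> bounded_on r f M ->
  loc_geometric r (fun k => wsum w x f k) (wmean w x f).
Proof.
move=> wB hf bf z hz; have [d d0 hd] := strip_open hz.
have d2 : 0 < d / 2 by rewrite divr_gt0.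
exists (d / 2) => //.
exists (4 * (M + B * (3 * M / (d / 2) * cnorm (int_vec R x)))) => h hh k.
have hzh : strip (r - d / 2) (z + h).
  by apply: (strip_sub (ltW hh)); apply: strip_le hd; lra.
exact: (geometric_cvg (fun k => wsum_step x k d2 wB hf bf hzh)).
Qed.

Lemma real_analytic_wmean r w x f (B M : R) : good_weight w B -> real_analytic r f -> bounded_on r f M -> real_analytic r (wmean w x f).
Proof.
move=> wB hf bf; have [_ hf' _] := hf.
apply: (@real_analytic_limit _ _ _ (fun k => wsum w x f k) _ (B * M)).
- by move=> k; apply: real_analytic_wsum.
- by move=> k; apply: bounded_wsum.
- exact: wsum_geometric wB hf' bf.
Qed.

Lemma bounded_wmean r w x f (B M : R) : good_weight w B -> holomorphic_on r f -> bounded_on r f M ->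
  bounded_on r (wmean w x f) (B * M).
Proof.
move=> wB hf bf z hz; have [A hA] := loc_geometric_pt (wsum_geometric x wB hf bf) hz.
rewrite -subr_le0; apply: (@geometric_le0 _ _ A) => k.
have := bounded_wsum x k wB bf hz; have := hA k.
have := cabsB (wmean w x f z) (wsum w x f k z) 0; rewrite !subr0 (cabsC (wmean w x f z)); lra.
Qed.

Lemma flow_invariant_wmean r w x f y : is_real_vec y -> flow_invariant r f y ->
  flow_invariant r (wmean w x f) y.
Proof.
move=> yr hf z t hz; rewrite /wmean; congr glim; apply/funext => k.
rewrite /wsum /rsum; congr (_ * _); apply: eq_bigr => j _; congr (_ * _).
by rewrite addrAC hf//; apply/strip_line.
Qed.

Lemma flow_invariant_gradient r f y z a : flow_invariant r f y -> strip r z -> cdiff f z a ->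
  dot a y = 0.
Proof.
move=> fy hz ha; apply/eqP; rewrite -cabs_eq0 eq_le cabs_ge0 andbT.
apply/ler_addgt0Pr => e e0; rewrite add0r.
have y1 : 0 < cnorm y + 1 by have := cnorm_ge0 y; lra.
have [d d0 hd] := ha _ (divr_gt0 e0 y1).
pose t := d / (cnorm y + 1) / 2; have t0 : 0 < t by rewrite !divr_gt0.
have ty : cnorm (t%:C%C *: y) = t * cnorm y by rewrite cnormZ cabs_real gtr0_norm.
have td : cnorm (t%:C%C *: y) < d.
  rewrite ty; apply: (@le_lt_trans _ _ (t * (cnorm y + 1))); first by rewrite ler_wpM2l ?(ltW t0)//; lra.
  by have -> : t * (cnorm y + 1) = d / 2 by [rewrite /t; field; rewrite gt_eqF|]; lra.
have := hd _ td; rewrite fy// subrr sub0r cabsN dotZr cabsM cabs_real gtr0_norm// ty.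
rewrite mulrCA ler_pM2l// => /le_trans; apply.
rewrite mulrAC ler_pdivrMr// ler_wpM2l ?(ltW e0)//; lra.
Qed.

Lemma gradient_flow_invariant r f y : is_real_vec y -> holomorphic_on r f ->
  (forall z a, strip r z -> cdiff f z a -> dot a y = 0) -> flow_invariant r f y.
Proof.
move=> yr hf h0 z t hz; apply/eqP; rewrite -subr_eq0 -cabs_eq0 eq_le cabs_ge0 andbT.
apply: mvt => u _.
have hz' : strip r (z + u%:C%C *: (t%:C%C *: y)).
  by apply/strip_real_shift => //; do 2 apply: is_real_vecZ.
by have [a ha] := hf _ hz'; exists a => //; rewrite dotZr (h0 _ _ hz' ha) mulr0 cabs0.
Qed.

(** The derivative along [x] of a weighted mean is the limit of the difference
    quotients of its Riemann sums with step [1 / 2 ^ k], the step for which the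
    increments are computable by [abel_sum]. *)
Lemma wmean_derivative r w x f (B M A : R) z a (q : nat -> C) q0 : good_weight w B ->
  real_analytic r f -> bounded_on r f M -> strip r z -> cdiff (wmean w x f) z a ->
  (forall k, wsum w x f k (z + ((2 ^+ k)^-1)%:C%C *: int_vec R x) - wsum w x f k z =
     ((2 ^+ k)^-1)%:C%C * q k) ->
  (forall k, cabs (q k - q0) <= A / 2 ^+ k) ->
  dot a (int_vec R x) = q0.
Proof.
move=> wB rf bf hz ha hq hA; have [_ hf _] := rf.
have [d d0 hd] := strip_open hz.
have [e e0 [E hE]] := wsum_geometric x wB hf bf hz.
pose m := Num.min d e; have m0 : 0 < m by rewrite lt_min d0.
have hb k : holo_ball (wsum w x f k) z m (B * M).
  apply: holo_ball_le (minl_le _ _) _; apply: strip_holo_ball hd.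
    by have [] := real_analytic_wsum w x k rf.
  exact: bounded_wsum.
have /choice[ak hak] : forall k, exists a, cdiff (wsum w x f k) z a.
  by move=> k; have [_ + _] := real_analytic_wsum w x k rf; apply.
have [|a' ha' [D hD]] := holo_limit m0 hb _ hak (f := wmean w x f) (A := E).
  by move=> h hh; apply: hE; apply: lt_le_trans hh (minr_le _ _).
have {}ha' : a' = a := cdiff_unique ha' ha; subst a'.
set X := int_vec R x.
have m4 : 0 < m / 4 by rewrite divr_gt0.
(* The Taylor estimate needs a step smaller than [m / 4]. *)
have [k0 hk0] := geometric_small (cnorm X) m4.
apply/eqP; rewrite -subr_eq0 -cabs_eq0 eq_le cabs_ge0 andbT.
pose S := n.+1%:R * D * cnorm X + 72 * (B * M) / m ^+ 2 * cnorm X ^+ 2 + A.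
have S0 k : (k0 <= k)%N -> cabs (dot a X - q0) <= S / 2 ^+ k.
  move=> kk; pose t : R := (2 ^+ k)^-1.
  have t0 : 0 < t by rewrite invr_gt0 exprn_gt0.
  have tX : cnorm (t%:C%C *: X) = t * cnorm X by rewrite cnormZ cabs_real gtr0_norm.
  have tXm : cnorm (t%:C%C *: X) <= m / 4.
    rewrite tX; apply: le_trans (ltW hk0); rewrite mulrC ler_wpM2l ?cnorm_ge0//.
    by rewrite lef_pV2 ?posrE ?exprn_gt0// ler_weXn2l// ler1n.
  have := holo_quadratic m0 (hb k) tXm (hak k); rewrite hq -/t dotZr -mulrBr cabsM.
  rewrite cabs_real (gtr0_norm t0) tX exprMn => h1.
  have {}h1 : cabs (q k - dot (ak k) X) <= 72 * (B * M) / m ^+ 2 * cnorm X ^+ 2 * t.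
    rewrite -(ler_pM2l t0); apply: le_trans h1 _; rewrite le_eqVlt; apply/orP; left.
    by apply/eqP; ring.
  have h2 : cabs (dot (ak k - a) X) <= n.+1%:R * (D / 2 ^+ k) * cnorm X.
    by apply: dot_bound => i; rewrite 2!mxE; apply: hD.
  have -> : dot a X - q0 = - dot (ak k - a) X - (q k - dot (ak k) X) + (q k - q0).
    by rewrite dotBl; ring.
  apply: le_trans (cabsD _ _) _.
  have := cabsD (- dot (ak k - a) X) (- (q k - dot (ak k) X)); rewrite !cabsN.
  have -> : S / 2 ^+ k = n.+1%:R * (D / 2 ^+ k) * cnorm X +
     72 * (B * M) / m ^+ 2 * cnorm X ^+ 2 * t + A / 2 ^+ k by rewrite /S /t; ring.
  by have := hA k; lra.
have S1 : 0 <= S.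
  have := le_trans (cabs_ge0 _) (S0 _ (leqnn k0)).
  by rewrite pmulr_lge0 // invr_gt0 exprn_gt0.
apply: (@geometric_le0 _ _ S) => k; apply: le_trans (S0 _ (leq_addr k k0)) _.
rewrite ler_wpM2l// lef_pV2 ?posrE ?exprn_gt0// ler_weXn2l ?ler1n//; exact: leq_addl.
Qed.

Definition mean := wmean (fun=> 1).

Definition primitive := wmean (fun t => t - 2^-1).

Lemma good_weight_cst1 : good_weight (fun=> 1) 1.
Proof. by split=> [t _|s t _ _]; rewrite ?normr1// subrr normr0. Qed.

Lemma good_weight_half : good_weight (fun t => t - 2^-1) 2^-1.
Proof.
split=> [t /andP[t0 t1]|s t _ _]; first by rewrite ler_norml; apply/andP; split; lra.
by rewrite opprB addrA subrK.
Qed.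

(** Translation by [x / 2 ^ k] permutes the nodes cyclically, because [f] is periodic
    along the integer vector [x]. *)
Lemma wsum_shift w x f k r z (u : nat -> C) : (forall z k, strip r z -> f (z + int_vec R k) = f z) ->
  strip r z -> (forall j, u j = f (z + (node R k j)%:C%C *: int_vec R x)) ->
  [/\ u (2 ^ k)%N = u 0%N,
      wsum w x f k z = ((2 ^+ k)^-1)%:C%C * \sum_(j < 2 ^ k) (w (node R k j))%:C%C * u j &
      wsum w x f k (z + ((2 ^+ k)^-1)%:C%C *: int_vec R x) =
        ((2 ^+ k)^-1)%:C%C * \sum_(j < 2 ^ k) (w (node R k j))%:C%C * u j.+1].
Proof.
move=> pf hz hu; split.
- rewrite !hu /node natrX divff ?expf_neq0// scale1r pf//.
  by rewrite mul0r scale0r addr0.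
- by congr (_ * _); apply: eq_bigr => j _; rewrite hu.
- congr (_ * _); apply: eq_bigr => j _; rewrite hu -addrA -scalerDl -rmorphD /=.
  by congr (_ * f (z + _%:C%C *: _)); rewrite /node -[j.+1]addn1 natrD; ring.
Qed.

(** The Riemann sums with [2 ^ k] nodes are exactly invariant under translation by
    [x / 2 ^ k]. *)
Lemma mean_invariant r x f M : real_analytic r f -> bounded_on r f M -> flow_invariant r (mean x f) (int_vec R x).
Proof.
move=> rf bf; have [pf _ _] := rf.
have [_ hm _] := real_analytic_wmean x good_weight_cst1 rf bf.
apply: gradient_flow_invariant hm _ => [|z a hz ha]; first exact: is_real_int_vec.
apply: (@wmean_derivative r _ x f 1 M 0 z a (fun=> 0) 0 good_weight_cst1 rf bf hz ha); last first.
  by move=> k; rewrite subrr cabs0 mul0r.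
move=> k; pose u j := f (z + (node R k j)%:C%C *: int_vec R x).
have [u0 -> ->] := wsum_shift (fun=> 1) pf hz (fun j => erefl (u j)).
rewrite mulr0 -mulrBr -sumrB; under eq_bigr do rewrite -mulrBr.
rewrite (abel_sum (fun=> 1) u) u0 subrr sub0r big1 ?oppr0 ?mulr0// => j _.
by rewrite subrr mul0r.
Qed.

(** The cohomological equation along [x], solved without small divisors. Centring
    the weight at [1/2] halves the bound on the solution. *)
Lemma primitive_derivative r x f M z a : real_analytic r f -> bounded_on r f M -> strip r z ->
  cdiff (primitive x f) z a -> dot a (int_vec R x) = f z - mean x f z.
Proof.
move=> rf bf hz ha; have [pf hf _] := rf.
have [A hA] := loc_geometric_pt (wsum_geometric x good_weight_cst1 hf bf) hz.
apply: (@wmean_derivative r _ x f 2^-1 M A z a (fun k => f z - wsum (fun=> 1) x f k z) _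
   good_weight_half rf bf hz ha) => k; last first.
  have -> : f z - wsum (fun=> 1) x f k z - (f z - mean x f z) = - (wsum (fun=> 1) x f k z - mean x f z) by ring.
  by rewrite cabsN; apply: hA.
pose u j := f (z + (node R k j)%:C%C *: int_vec R x).
have [u0 -> ->] := wsum_shift (fun t => t - 2^-1) pf hz (fun j => erefl (u j)).
have [_ -> _] := wsum_shift (fun=> 1) pf hz (fun j => erefl (u j)).
rewrite -mulrBr -sumrB; under eq_bigr do rewrite -mulrBr.
rewrite (abel_sum (fun j => (node R k j - 2^-1)%:C%C) u) u0.
have -> : f z = u 0%N by rewrite /u /node mul0r scale0r addr0.
have nS j : (node R k j.+1 - 2^-1)%:C%C - (node R k j - 2^-1)%:C%C = ((2 ^+ k)^-1)%:C%C :> C.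
  by rewrite -rmorphB /node -[j.+1]addn1 natrD; congr (_%:C%C); ring.
under eq_bigr do rewrite nS.
rewrite -mulr_sumr; congr (_ * (_ - _)).
  have -> : node R k (2 ^ k) = 1 by rewrite /node natrX divff ?expf_neq0.
  have -> : node R k 0 = 0 by rewrite /node mul0r.
  by rewrite -mulrBl -rmorphB /= opprB addrA subrK subr0 mul1r.
congr (_ * _); rewrite -(big_mkord xpredT (fun j => u j.+1)) -(big_mkord xpredT (fun j => 1 * u j)).
under [in RHS]eq_bigr do rewrite mul1r.
have k0 : (0 < 2 ^ k)%N by rewrite expn_gt0.
rewrite [RHS]big_ltn// -{1}(prednK k0) big_nat_recr//= prednK// u0 addrC; congr (_ + _).
by rewrite -{2}(prednK k0) big_add1.
Qed.

End WeightedMeans.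

(** * One averaging step *)

Section AveragingStep.
Variables (R : realType) (n : nat).
Local Notation K := (R[i] : numFieldType).
Local Notation C := R[i].
Local Notation V := 'rV[K]_n.+1.
Implicit Types (z h a y : V) (r s : R) (f g : V -> C) (x : 'rV[int]_n.+1).

Variables (al : V) (c : 'rV[int]_n.+1 -> R) (T eta : R).

(** Up to an error [eta], the multiple [c x] of [al] is the integer vector [x]. *)
Definition resonant x := `|c x| <= T /\ cnorm ((c x)%:C%C *: al - int_vec R x) <= eta.

Fixpoint mean_all (xs : seq 'rV[int]_n.+1) f : V -> C :=
  if xs is x :: xs' then mean_all xs' (mean x f) else f.

(** First-order generator of the change of variables that replaces [f] by its
    average along all of [xs]: a sum of solutions of the cohomological equations
    along the successive directions, rescaled so that its derivative along [al] is
    close to [f - mean_all xs f]. *)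
Fixpoint generator (xs : seq 'rV[int]_n.+1) f z : C :=
  if xs is x :: xs' then (c x)%:C%C * primitive x f z + generator xs' (mean x f) z else 0.

Lemma real_analytic_mean r x f M : real_analytic r f -> bounded_on r f M -> real_analytic r (mean x f).
Proof. exact: (real_analytic_wmean x (good_weight_cst1 R)). Qed.

Lemma bounded_mean r x f M : real_analytic r f -> bounded_on r f M -> bounded_on r (mean x f) M.
Proof. by move=> [_ hf _] bf; have := bounded_wmean x (good_weight_cst1 R) hf bf; rewrite mul1r. Qed.

Lemma real_analytic_primitive r x f M : real_analytic r f -> bounded_on r f M -> real_analytic r (primitive x f).
Proof. exact: (real_analytic_wmean x (good_weight_half R)). Qed.

Lemma bounded_primitive r x f M : real_analytic r f -> bounded_on r f M -> bounded_on r (primitive x f) (2^-1 * M).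
Proof. by move=> [_ hf _] bf; exact: (bounded_wmean x (good_weight_half R) hf bf). Qed.

Lemma mean_allP r xs f M : real_analytic r f -> bounded_on r f M ->
  [/\ real_analytic r (mean_all xs f), bounded_on r (mean_all xs f) M,
      forall x, x \in xs -> flow_invariant r (mean_all xs f) (int_vec R x) &
      forall y, is_real_vec y -> flow_invariant r f y -> flow_invariant r (mean_all xs f) y].
Proof.
elim: xs f => [|x xs IH] f rf bf; first by split.
have rm := real_analytic_mean x rf bf; have bm := bounded_mean x rf bf.
have [h1 h2 h3 h4] := IH _ rm bm; split => //= [y|y yr fy].
  rewrite inE => /orP[/eqP ->|]; last exact: h3.
  by apply: h4; [exact: is_real_int_vec | exact: mean_invariant rf bf].
by apply: h4 => //; apply: flow_invariant_wmean.
Qed.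

Lemma generatorP r xs f M : 0 <= M -> (forall x, x \in xs -> resonant x) -> real_analytic r f -> bounded_on r f M ->
  real_analytic r (generator xs f) /\ bounded_on r (generator xs f) ((size xs)%:R * (T * M / 2)).
Proof.
move=> M0; elim: xs f => [|x xs IH] f hc rf bf.
  split; first by apply: real_analytic_ext (real_analytic_cst _ r 0).
  by move=> z _; rewrite cabs0 mul0r.
have rm := real_analytic_mean x rf bf; have bm := bounded_mean x rf bf.
have [h1 h2] := IH _ (fun x' hx => hc x' (@mem_behead _ (x :: xs) _ hx)) rm bm; split.
  by apply: real_analyticD => //; apply: real_analyticZ; apply: real_analytic_primitive rf bf.
move=> z hz; apply: le_trans (cabsD _ _) _; rewrite [size _]/= -[(size xs).+1]addn1 natrD mulrDl mul1r addrC.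
apply: lerD; first exact: h2.
rewrite cabsM cabs_real -mulrA [M / 2]mulrC.
apply: ler_pM => //; rewrite ?cabs_ge0//; last exact: bounded_primitive rf bf _ hz.
by have [] := hc x (mem_head _ _).
Qed.

(** The derivatives along [c x *: al] differ from those along [x] by Cauchy's estimate
    times [eta]; the main terms [mean - mean of mean] telescope. *)
Lemma generator_derivative r s xs f M z a : 0 < s -> 0 <= M -> (forall x, x \in xs -> resonant x) ->
  real_analytic r f -> bounded_on r f M -> strip (r - s) z -> cdiff (generator xs f) z a ->
  cabs (f z - mean_all xs f z - dot a al) <= (size xs)%:R * (3 / 2 * M / s * eta).
Proof.
move=> s0 M0; elim: xs f a => [|x xs IH] f a hc rf bf hz ha.
  have -> : a = 0 by apply: cdiff_unique ha _; apply: cdiff_cst.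
  by rewrite dot0l !subrr cabs0 mul0r.
have rm := real_analytic_mean x rf bf; have bm := bounded_mean x rf bf.
have hzr : strip r z by apply: strip_le hz; lra.
have hc' x' : x' \in xs -> resonant x' := fun hx => hc x' (@mem_behead _ (x :: xs) _ hx).
have [[_ hg _] _] := generatorP M0 hc' rm bm; have [b hb] := hg z hzr.
have [_ hp _] := real_analytic_primitive x rf bf; have [w hw] := hp z hzr.
have -> : a = (c x)%:C%C *: w + b by apply: cdiff_unique ha _; apply: cdiffD => //; apply: cdiffZ.
have h1 := IH _ _ hc' rm bm hz hb.
have h2 := primitive_derivative rf bf hzr hw.
have h3 := gradient_bound ((c x)%:C%C *: al - int_vec R x) s0
  (strip_holo_ball hp (bounded_primitive x rf bf) hz) hw.
have [_ h4] := hc x (mem_head _ _).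
have -> : f z - mean_all (x :: xs) f z - dot ((c x)%:C%C *: w + b) al =
  (mean x f z - mean_all xs (mean x f) z - dot b al) - dot w ((c x)%:C%C *: al - int_vec R x).
  by rewrite dotDl dotZl dotBr dotZr h2 [mean_all (_ :: _) _]/=; ring.
apply: le_trans (cabsD _ _) _; rewrite cabsN [size _]/= -[(size xs).+1]addn1 natrD mulrDl mul1r; apply: lerD => //.
have {}h3 : cabs (dot w ((c x)%:C%C *: al - int_vec R x)) <=
   3 / 2 * M / s * cnorm ((c x)%:C%C *: al - int_vec R x).
  by rewrite mulrAC ler_pdivlMr//; apply: le_trans h3 _; rewrite mulrA.
by apply: le_trans h3 _; rewrite ler_wpM2l ?divr_ge0 ?(ltW s0)// !mulr_ge0.
Qed.

End AveragingStep.

Section NearIdentity.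
Variables (R : realType) (n : nat).
Local Notation K := (R[i] : numFieldType).
Local Notation C := R[i].
Local Notation V := 'rV[K]_n.+1.
Implicit Types (z h a y : V) (r s : R) (U F : V -> V).

Lemma row_entryB a h l : (a - h) 0 l = a 0 l - h 0 l. Proof. by rewrite !mxE. Qed.

Lemma row_entryD a h l : (a + h) 0 l = a 0 l + h 0 l. Proof. by rewrite !mxE. Qed.

Definition coord_fun F l : V -> C := fun z => F z 0 l.

(** The Jacobian matrix expressed by gradients; vectors being rows, it acts from the
    right. *)
Definition jac F z : 'M[K]_n.+1 := \matrix_(i, l) grad (coord_fun F l) z 0 i.

Definition vbounded_on r F (M : R) := forall z, strip r z -> cnorm (F z) <= M.

Lemma mul_jacE F z h l : (h *m jac F z) 0 l = dot (grad (coord_fun F l) z) h.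
Proof. by rewrite mxE; apply: eq_bigr => i _; rewrite mxE mulrC. Qed.

Lemma vbounded_coord r F M l : vbounded_on r F M -> bounded_on r (coord_fun F l) M.
Proof. by move=> bF z /bF; apply: le_trans; apply: cabs_le_cnorm. Qed.

Lemma jac_bound r s F M z h : 0 < s -> (forall l, real_analytic r (coord_fun F l)) -> vbounded_on r F M ->
  strip (r - s) z -> cnorm (h *m jac F z) <= 3 * M / s * cnorm h.
Proof.
move=> s0 rF bF hz; have hzr : strip r z by apply: strip_le hz; lra.
have M0 : 0 <= M by apply: le_trans (bF _ hzr); apply: cnorm_ge0.
apply: cnorm_le => [|l]; first by rewrite !mulr_ge0 ?cnorm_ge0 ?invr_ge0 ?(ltW s0).
rewrite mul_jacE mulrAC ler_pdivlMr//.
have [_ hl _] := rF l; have [a ha] := hl z hzr.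
exact: (gradient_bound h s0 (strip_holo_ball hl (vbounded_coord l bF) hz) (gradP ha)).
Qed.

Lemma vincrement r s F M z h : 0 < s -> (forall l, real_analytic r (coord_fun F l)) -> vbounded_on r F M -> 0 <= M ->
  (forall t : R, 0 <= t <= 1 -> strip (r - s) (z + t%:C%C *: h)) ->
  cnorm (F (z + h) - F z) <= 3 * M / s * cnorm h.
Proof.
move=> s0 rF bF M0 hz.
apply: cnorm_le => [|l]; first by rewrite !mulr_ge0 ?cnorm_ge0 ?invr_ge0 ?(ltW s0).
rewrite !mxE -/(coord_fun F l _) -/(coord_fun F l z); apply: mvt => t /hz hzt.
have [_ hl _] := rF l.
have hzr : strip r (z + t%:C%C *: h) by apply: strip_le hzt; lra.
have [a ha] := hl _ hzr; exists a => //; rewrite mulrAC ler_pdivlMr//.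
exact: (gradient_bound h s0 (strip_holo_ball hl (vbounded_coord l bF) hzt) ha).
Qed.

Lemma strip_convex r z h (t : R) : 0 <= t <= 1 -> strip r z -> strip r (z + h) ->
  strip r (z + t%:C%C *: h).
Proof.
move=> /andP[t0 t1] /stripP[r0 hz] /stripP[_ hw]; apply/stripP; split => // i.
have := hz i; have := hw i; rewrite !mxE; case: (z 0 i) (h 0 i) => p q [p' q'] /=.
rewrite mul0r addr0 => h1 h2.
have -> : q + t * q' = (1 - t) * q + t * (q + q') by ring.
have t1' : 0 <= 1 - t by rewrite subr_ge0.
apply: le_lt_trans (ler_normD _ _) _; rewrite !normrM (ger0_norm t0) (ger0_norm t1').
have [e|tn] := eqVneq t 0; first by rewrite e subr0 mul1r mul0r addr0.
have tp : 0 < t by rewrite lt_neqAle eq_sym tn.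
have : t * `|q + q'| < t * r by rewrite ltr_pM2l.
have : (1 - t) * `|q| <= (1 - t) * r by rewrite ler_wpM2l ?subr_ge0// ltW.
lra.
Qed.

Lemma contraction_unit (A : 'M[K]_n.+1) (k : R) : k < 1 ->
  (forall h : V, cnorm (h *m A) <= k * cnorm h) -> 1%:M + A \in unitmx.
Proof.
move=> k1 hA; rewrite -row_free_unit -kermx_eq0; apply/eqP/row_matrixP => i.
rewrite row0; set h := row i _.
have h0 : h *m (1%:M + A) = 0 by rewrite -row_mul mulmx_ker row0.
apply/eqP; rewrite -cnorm_eq0 eq_le cnorm_ge0 andbT.
have e : cnorm h <= k * cnorm h.
  move: h0; rewrite mulmxDr mulmx1 => /eqP; rewrite addr_eq0 => /eqP {1}->.
  by rewrite cnormN.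
have : (1 - k) * cnorm h <= 0 by lra.
by rewrite pmulr_rle0// subr_gt0.
Qed.

(** The equation for [P'] in the last conclusion is linear. Its right-hand side is
    the sum of four small terms: the increments of [N] and [P] along [U], the
    defect [P - A - DU alpha], and [DU (N + A)]. The first smallness hypothesis
    makes [DU] a contraction by [1 / 16], so that inverting [1 + DU] costs a factor
    [16 / 15]; the second bounds the four terms by [15 / 32 * rho], whence the
    bound [rho / 2]. The increments are estimated with Cauchy's estimate on balls
    of radius [s / 2], since [z + U z] may approach the boundary. *)
Lemma averaging_step (al : 'rV[R]_n.+1) (c : 'rV[int]_n.+1 -> R) (T eta r s nu rho : R)
    (xs : seq 'rV[int]_n.+1) (N P : V -> V) :
  let alC := map_mx (real_complex R) al in
  let u := (size xs)%:R * (T * rho / 2) in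
  0 < s -> 0 <= nu -> 0 <= rho -> (forall x, x \in xs -> resonant alC c T eta x) ->
  48 * u <= s ->
  (size xs)%:R * (9 / 2 * T * (nu + rho) + 3 / 2 * eta) <= 15 / 32 * s ->
  (forall l, real_analytic r (coord_fun N l)) -> (forall l, real_analytic r (coord_fun P l)) ->
  vbounded_on r N nu -> vbounded_on r P rho ->
  (forall x l, x \in xs -> flow_invariant r (coord_fun N l) (int_vec R x)) ->
  exists U N' P' : V -> V,
    [/\ [/\ forall l, real_analytic r (coord_fun U l), vbounded_on r U u &
            forall z w, strip (r - s) z -> strip (r - s) w ->
              cnorm (U w - U z) <= 2^-1 * cnorm (w - z)],
        [/\ forall l, real_analytic r (coord_fun N' l), vbounded_on r N' (nu + rho) &
            forall x l, x \in xs -> flow_invariant r (coord_fun N' l) (int_vec R x)],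
        (forall l, real_analytic (r - s) (coord_fun P' l)) /\ vbounded_on (r - s) P' (rho / 2) &
        forall z, strip (r - s) z ->
          (alC + N' z + P' z) *m (1%:M + jac U z) = alC + N (z + U z) + P (z + U z)].
Proof.
move=> alC u s0 nu0 rho0 hc us hs rN rP bN bP iN.
have bPc l := vbounded_coord l bP; have bNc l := vbounded_coord l bN.
pose U z : V := \row_l generator c xs (coord_fun P l) z.
pose A z : V := \row_l mean_all xs (coord_fun P l) z.
pose N' z : V := N z + A z.
have cU l : coord_fun U l = generator c xs (coord_fun P l) by apply/funext => z; rewrite /coord_fun mxE.
have cA l : coord_fun A l = mean_all xs (coord_fun P l) by apply/funext => z; rewrite /coord_fun mxE.
have cN' l : coord_fun N' l = fun z => coord_fun N l z + coord_fun A l z by apply/funext => z; rewrite /coord_fun mxE.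
have hU l := generatorP rho0 hc (rP l) (bPc l).
have hA l := mean_allP xs (rP l) (bPc l).
have rU l : real_analytic r (coord_fun U l) by rewrite cU; have [] := hU l.
have rA l : real_analytic r (coord_fun A l) by rewrite cA; have [] := hA l.
have rN' l : real_analytic r (coord_fun N' l) by rewrite cN'; apply: real_analyticD.
have T0 : 0 <= u.
  case: (xs) hc @u us => [|x xs'] hc u _; first by rewrite /u mul0r.
  have [h _] := hc x (mem_head _ _); rewrite /u !mulr_ge0//; exact: le_trans h.
have bU : vbounded_on r U u.
  by move=> z hz; apply: cnorm_le => // l; rewrite -/(coord_fun U l z) cU; have [_] := hU l; apply.
have bA : vbounded_on r A rho.
  by move=> z hz; apply: cnorm_le => // l; rewrite -/(coord_fun A l z) cA; have [_ + _ _] := hA l; apply.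
have bN' : vbounded_on r N' (nu + rho).
  by move=> z hz; apply: le_trans (cnormD _ _) (lerD (bN _ hz) (bA _ hz)).
have lip z h : strip (r - s) z -> cnorm (h *m jac U z) <= 16^-1 * cnorm h.
  move=> hz; apply: le_trans (jac_bound h s0 rU bU hz) _.
  by rewrite ler_wpM2r ?cnorm_ge0// ler_pdivrMr//; lra.
pose J z := 1%:M + jac U z.
have uJ z : strip (r - s) z -> J z \in unitmx.
  by move=> hz; apply: (@contraction_unit _ 16^-1) => [|h]; [lra | apply: lip].
pose G z : V := alC + N (z + U z) + P (z + U z) - (alC + N' z) *m J z.
pose P' z : V := G z *m invmx (J z).
have shift z (t : R) : 0 <= t <= 1 -> strip (r - s) z -> strip (r - s / 2) (z + t%:C%C *: U z).
  move=> /andP[t0 t1] hz; have hzr : strip r z by apply: strip_le hz; lra.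
  have -> : r - s / 2 = r - s + s / 2 by field.
  apply: strip_add => //; rewrite cnormZ cabs_real ger0_norm//.
  by apply: le_trans (ler_piMl (cnorm_ge0 _) t1) _; apply: le_trans (bU _ hzr) _; lra.
have shift1 z : strip (r - s) z -> strip r (z + U z).
  move=> hz; have := shift z 1; rewrite scale1r lexx ler01 => /(_ isT hz).
  by apply: strip_le; lra.
have rs : r - s <= r by lra.
have rJ i l : real_analytic (r - s) (fun z => J z i l).
  have h : real_analytic (r - s) (fun z => (i == l)%:R%:C%C + grad (coord_fun U l) z 0 i).
    apply: real_analyticD; first exact: real_analytic_cst.
    by apply: real_analytic_le rs _; apply: real_analytic_grad (rU l) (vbounded_coord l bU).
  by apply: real_analytic_ext h => z _; rewrite /J !mxE rmorph_nat.
have rcomp (F : V -> V) l : (forall l, real_analytic r (coord_fun F l)) -> real_analytic (r - s) (fun z => F (z + U z) 0 l).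
  by move=> rF; apply: (@real_analytic_comp _ _ (r - s) r U (coord_fun F l)) => // j; apply: real_analytic_le rs (rU j).
have rG l : real_analytic (r - s) (coord_fun G l).
  have h : real_analytic (r - s) (fun z => ((al 0 l)%:C%C + N (z + U z) 0 l + P (z + U z) 0 l)
      - ((fun z => alC + N' z) z *m J z) 0 l).
    apply: real_analyticB; first by apply: real_analyticD; [apply: real_analyticD; [exact: real_analytic_cst | exact: rcomp] | exact: rcomp].
    apply: real_analytic_mulmx rJ => i j; rewrite ord1.
    have h := real_analyticD (real_analytic_cst n (r - s) (al 0 j)) (real_analytic_le rs (rN' j)).
    by apply: real_analytic_ext h => z _; rewrite /coord_fun [RHS]row_entryD [alC 0 j]mxE.
  by apply: real_analytic_ext h => z _; rewrite /coord_fun /G row_entryB !row_entryD [alC 0 l]mxE.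
have rP' l : real_analytic (r - s) (coord_fun P' l).
  apply: real_analytic_mulmx; first by move=> i j; rewrite ord1; exact: rG.
  by move=> i j; apply: real_analytic_invmx.
have bG z : strip (r - s) z -> cnorm (G z) <= 15 / 32 * rho.
  move=> hz; have hzr := strip_le rs hz.
  have s20 : 0 < s / 2 by rewrite divr_gt0.
  have hsh t t01 := shift z t t01 hz.
  have h1 := vincrement s20 rN bN nu0 hsh.
  have h2 := vincrement s20 rP bP rho0 hsh.
  have h3 := jac_bound (N' z) s0 rU bU hz.
  have h4 : cnorm (P z - A z - alC *m jac U z) <= (size xs)%:R * (3 / 2 * rho / s * eta).
    apply: cnorm_le => [|l].
      case: (xs) hc => [|x xs'] hc'; first by rewrite mul0r.
      have [_ h] := hc' x (mem_head _ _); apply: mulr_ge0 => //.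
      by rewrite mulr_ge0 ?(le_trans (cnorm_ge0 _) h)// divr_ge0 ?(ltW s0)// mulr_ge0.
    rewrite !row_entryB mul_jacE -/(coord_fun P l z) -/(coord_fun A l z) cA.
    have [[_ hg _] _] := hU l; have [a ha] := hg z hzr.
    rewrite cU (gradE ha).
    exact: generator_derivative s0 rho0 hc (rP l) (bPc l) hz ha.
  have -> : G z = (N (z + U z) - N z) + (P (z + U z) - P z) + (P z - A z - alC *m jac U z)
     - N' z *m jac U z.
    rewrite /G /J /N' mulmxDr mulmx1 mulmxDl; apply/rowP => l; rewrite !mxE; ring.
  apply: le_trans (cnormD _ _) _; rewrite cnormN.
  have := cnormD (N (z + U z) - N z + (P (z + U z) - P z)) (P z - A z - alC *m jac U z).
  have := cnormD (N (z + U z) - N z) (P (z + U z) - P z).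
  have uz := bU z hzr; have nz := bN' z hzr.
  have k1 : 3 * nu / (s / 2) * cnorm (U z) <= 6 * nu / s * u.
    have -> : 3 * nu / (s / 2) = 6 * nu / s by field; rewrite gt_eqF.
    by rewrite ler_wpM2l// divr_ge0 ?(ltW s0)// mulr_ge0.
  have k2 : 3 * rho / (s / 2) * cnorm (U z) <= 6 * rho / s * u.
    have -> : 3 * rho / (s / 2) = 6 * rho / s by field; rewrite gt_eqF.
    by rewrite ler_wpM2l// divr_ge0 ?(ltW s0)// mulr_ge0.
  have k3 : 3 * u / s * cnorm (N' z) <= 3 * u / s * (nu + rho).
    by rewrite ler_wpM2l// divr_ge0 ?(ltW s0)// mulr_ge0.
  have k4 : (6 * nu / s * u) + (6 * rho / s * u) + (size xs)%:R * (3 / 2 * rho / s * eta)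
     + 3 * u / s * (nu + rho) <= 15 / 32 * rho.
    have -> : (6 * nu / s * u) + (6 * rho / s * u) + (size xs)%:R * (3 / 2 * rho / s * eta)
     + 3 * u / s * (nu + rho) =
     rho * ((size xs)%:R * (9 / 2 * T * (nu + rho) + 3 / 2 * eta)) / s.
      by rewrite /u; field; rewrite gt_eqF.
    rewrite ler_pdivrMr//; apply: le_trans (ler_wpM2l rho0 hs) _.
    by rewrite le_eqVlt; apply/orP; left; apply/eqP; ring.
  lra.
exists U, N', P'; split.
- split=> // z w hz hw.
  have hw' : strip (r - s) (z + (w - z)) by rewrite [z + _]addrC subrK.
  have := @vincrement r s U u z (w - z) s0 rU bU T0 (fun t t01 => strip_convex t01 hz hw').
  rewrite [z + _]addrC subrK => /le_trans; apply.
  by rewrite ler_wpM2r ?cnorm_ge0// ler_pdivrMr//; lra.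
- split=> // x l xxs z t hz; rewrite cN' cA.
  by rewrite iN//; have [_ _ hi _] := hA l; rewrite hi.
- split=> // z hz.
  have e : G z = P' z + P' z *m jac U z.
    by rewrite -[X in X + _]mulmx1 -mulmxDr -/(J z) /P' mulmxKV// uJ.
  have := bG z hz; have := lip z (P' z) hz.
  have := cnormB (P' z) (G z) 0; rewrite !subr0 {1}e opprD addrA subrr sub0r cnormN; lra.
- move=> z hz; by rewrite -/(J z) mulmxDl mulmxKV ?uJ// /G [LHS]addrC subrK.
Qed.

End NearIdentity.

(** * Iteration of the averaging step *)

Section Iteration.
Variables (R : realType) (n : nat).
Local Notation K := (R[i] : numFieldType).
Local Notation C := R[i].
Local Notation V := 'rV[K]_n.+1.
Implicit Types (z h a y : V) (r s : R) (U F : V -> V).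

Lemma mul_rV_jacobian (F : V -> V) z h : h *m 'J F z = 'd F z h.
Proof. exact: mul_rV_lin1. Qed.

Lemma coord_fun_gradient r F l z : real_analytic r (coord_fun F l) -> strip r z ->
  cdiff (fun w => F w 0 l) z (grad (coord_fun F l) z).
Proof. by move=> [_ hF _] /hF[a ha]; exact: (gradP ha). Qed.

Lemma diff_field r F z h : (forall l, real_analytic r (coord_fun F l)) -> strip r z ->
  differentiable F z /\ 'd F z h = h *m jac F z.
Proof.
move=> rF hz.
have [dF ->] := cdiff_comp_differentiable (fun l => coord_fun_gradient (rF l) hz).
by split => //; apply/rowP => l; rewrite mxE mul_jacE.
Qed.

Lemma diff_near_id r F z : (forall l, real_analytic r (coord_fun F l)) -> strip r z ->
  differentiable (fun w => w + F w) z /\ 'J (fun w => w + F w) z = 1%:M + jac F z.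
Proof.
move=> rF hz; have idd : differentiable (id : V -> V) z by [].
have [dF _] := diff_field 0 rF hz.
split; first exact: (differentiableD idd dF).
apply/row_matrixP => i; rewrite !rowE mul_rV_jacobian mulmxDr mulmx1.
have -> : 'd (fun w => w + F w) z = 'd (id : V -> V) z \+ 'd F z :> (V -> V) := diffD idd dF.
have [_ <-] := diff_field (delta_mx 0 i) rF hz.
by congr (_ + _); rewrite (@diff_val _ _ _ _ _ _ _ (is_diff_id z)).
Qed.

Lemma jacobian_comp (F G : V -> V) z : differentiable F z -> differentiable G (F z) ->
  'J (fun w => G (F w)) z = 'J F z *m 'J G (F z).
Proof.
move=> dF dG; apply/row_matrixP => i; rewrite 2!rowE mulmxA.
set e : V := delta_mx 0 i.
have hF := mul_rV_jacobian F z e.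
have hG := mul_rV_jacobian G (F z) ('d F z e).
have hGF := mul_rV_jacobian (fun w => G (F w)) z e.
have hd : 'd (fun w => G (F w)) z e = 'd G (F z) ('d F z e).
  exact: (congr1 (fun L : V -> V => L e) (@diff_comp K V V V F G z dF dG)).
exact: (etrans hGF (etrans hd (esym (etrans (congr1 (fun v => v *m 'J G (F z)) hF) hG)))).
Qed.

(** A vector in the kernel of the Jacobian would be a direction of sublinear growth. *)
Lemma expanding_immersion (Phi : V -> V) z (k d : R) : 0 < k -> 0 < d -> differentiable Phi z ->
  (forall h, cnorm h < d -> k * cnorm h <= cnorm (Phi (z + h) - Phi z)) ->
  'J Phi z \in unitmx.
Proof.
move=> k0 d0 dPhi hk.
rewrite -row_free_unit -kermx_eq0; apply/eqP/row_matrixP => i.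
rewrite row0; set h := row i _.
have h0 : 'd Phi z h = 0 by rewrite -mul_rV_jacobian -row_mul mulmx_ker row0.
apply/eqP; rewrite -cnorm_eq0 eq_le cnorm_ge0 andbT leNgt; apply/negP => hpos.
have [e e0 he] := differentiable_eps dPhi (divr_gt0 k0 (ltr0n R 2)).
pose t := Num.min d e / cnorm h / 2.
have m0 : 0 < Num.min d e by rewrite lt_min d0.
have t0 : 0 < t by rewrite !divr_gt0.
have th : cnorm (t%:C%C *: h) = Num.min d e / 2.
  by rewrite cnormZ cabs_real gtr0_norm// /t; field; rewrite gt_eqF.
have [hd hee] := (minl_le d e, minr_le d e).
have := he (t%:C%C *: h) ltac:(rewrite th; lra); have := hk (t%:C%C *: h) ltac:(rewrite th; lra).
rewrite linearZ h0 /= scaler0 subr0 !norm_cnorm -rmorphM lecR th; nra.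
Qed.

(** Each step halves the remainder, so the sizes of the successive changes of
    variables and of the increments of [N] are geometric. The conjugacy equation is
    kept in the form without inverses, which composes by the chain rule; the lower
    bound on distances is what makes the composite an embedding in the end. *)
Lemma near_identity_iteration (al : 'rV[R]_n.+1) (c : 'rV[int]_n.+1 -> R) (T eta s sg eps : R)
    (xs : seq 'rV[int]_n.+1) (P : V -> V) (i : nat) :
  let alC := map_mx (real_complex R) al in
  let d : R := (size xs)%:R in
  0 < sg -> 0 <= eps -> 0 <= T -> (forall x, x \in xs -> resonant alC c T eta x) ->
  24 * d * T * eps <= sg ->
  d * (27 / 2 * T * eps + 3 / 2 * eta) <= 15 / 32 * sg ->
  (forall l, real_analytic s (coord_fun P l)) -> vbounded_on s P eps ->
  let r := s - i%:R * sg in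
  exists F N P' : V -> V,
    [/\ [/\ forall l, real_analytic r (coord_fun F l), vbounded_on r F (d * T * eps * (1 - (2 ^+ i)^-1)),
            forall z, strip r z -> strip s (z + F z) &
            exists2 k : R, 0 < k & forall z w, strip r z -> strip r w ->
              k * cnorm (w - z) <= cnorm (w + F w - (z + F z))],
        [/\ forall l, real_analytic r (coord_fun N l), vbounded_on r N (2 * eps * (1 - (2 ^+ i)^-1)) &
            forall x l, x \in xs -> flow_invariant r (coord_fun N l) (int_vec R x)],
        (forall l, real_analytic r (coord_fun P' l)) /\ vbounded_on r P' (eps / 2 ^+ i) &
        forall z, strip r z ->
          (alC + N z + P' z) *m 'J (fun w => w + F w) z = alC + P (z + F z)].
Proof.
move=> alC d sg0 eps0 T0 hc h24 h27 rP bP.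
have zero_analytic r l : real_analytic r (coord_fun (fun=> 0 : V) l).
  by have := real_analytic_cst n r 0; apply: real_analytic_ext => z _; rewrite /coord_fun mxE.
elim: i => [|i [F [N [P' [[rF bF sF [k k0 hk]] [rN bN iN] [rP' bP'] eq1]]]]] /=.
  rewrite mul0r subr0 expr0 invr1 subrr !mulr0 mulr1.
  exists (fun=> 0), (fun=> 0), P; split.
  - split=> [l||z|].
    + exact: zero_analytic.
    + by move=> z _; rewrite cnorm0.
    + by rewrite addr0.
    + by exists 1 => // z w _ _; rewrite !addr0 mul1r.
  - split=> [l||x l _ z t _]; [exact: zero_analytic | by move=> z _; rewrite cnorm0 | by rewrite /coord_fun !mxE].
  - by [].
  - move=> z hz; have [_ ->] := diff_near_id (fun l => zero_analytic s l) hz.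
    have -> : jac (fun=> 0) z = 0 :> 'M[K]_n.+1.
      apply/matrixP => j l; rewrite !mxE.
      have -> : coord_fun (fun=> 0 : V) l = (fun=> 0 : C) by apply/funext => w; rewrite /coord_fun mxE.
      by rewrite (gradE (cdiff_cst 0 z)) mxE.
    by rewrite !addr0 mulmx1.
set r := s - i%:R * sg in rF bF sF hk rN bN iN rP' bP' eq1 *.
have -> : s - i.+1%:R * sg = r - sg by rewrite /r -addn1 natrD; ring.
pose p : R := (2 ^+ i)^-1.
have p0 : 0 < p by rewrite invr_gt0 exprn_gt0.
have p1 : p <= 1 by rewrite invf_le1 ?exprn_gt0// exprn_ege1// ler1n.
have pS : (2 ^+ i.+1)^-1 = p / 2 :> R by rewrite exprS invfM mulrC.
have d0 : 0 <= d by rewrite ler0n.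
have nu0 : 0 <= 2 * eps * (1 - p) by rewrite !mulr_ge0 ?subr_ge0.
have rho0 : 0 <= eps / 2 ^+ i by rewrite divr_ge0 ?exprn_ge0.
have pe : eps / 2 ^+ i = eps * p by [].
have [||U [N' [Q [[rU bU lU] [rN' bN' iN'] [rQ bQ] eq2]]]] :=
  averaging_step (al := al) (s := sg) sg0 nu0 rho0 hc _ _ rN rP' bN bP' iN.
- have : d * T * eps * p <= d * T * eps by rewrite ler_piMr// !mulr_ge0.
  rewrite pe -/d; lra.
- apply: le_trans h27; rewrite -/d ler_wpM2l// lerD2r.
  have : T * (2 * eps * (1 - p) + eps * p) <= T * (3 * eps).
    rewrite ler_wpM2l//; have : 0 <= eps * p by rewrite mulr_ge0// ltW.
    lra.
  by rewrite pe; lra.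
have rsg : r - sg <= r by lra.
have hU z : strip (r - sg) z -> strip r (z + U z).
  move=> hz; apply: (strip_sub (s := sg)) => //.
  apply: le_trans (bU _ (strip_le rsg hz)) _; rewrite pe -/d.
  have : d * T * eps * p <= d * T * eps by rewrite ler_piMr// !mulr_ge0.
  have : 0 <= d * T * eps by rewrite !mulr_ge0.
  lra.
pose F' z := U z + F (z + U z).
have F'E z : z + F' z = (z + U z) + F (z + U z) by rewrite addrA.
exists F', N', Q; split.
- split=> [l|z hz|z hz|].
  + have h1 := real_analytic_le rsg (rU l).
    have h2 : real_analytic (r - sg) (fun z => coord_fun F l (z + U z)).
      by apply: real_analytic_comp hU (rF l) => j; apply: real_analytic_le rsg (rU j).
    by apply: real_analytic_ext (real_analyticD h1 h2) => z _; rewrite /coord_fun mxE.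
  + apply: le_trans (cnormD _ _) _.
    have := bU z (strip_le rsg hz); have := bF _ (hU z hz); rewrite pS -/p -/d; lra.
  + by rewrite F'E; apply: sF; apply: hU.
  + exists (k / 2) => [|z w hz hw]; first by rewrite divr_gt0.
    rewrite !F'E; apply: le_trans (hk _ _ (hU z hz) (hU w hw)).
    rewrite -mulrA ler_pM2l//.
    have := lU z w hz hw.
    have := cnormB (w - z) (- (U w - U z)) 0; rewrite !subr0 opprK cnormN.
    have -> : w - z + (U w - U z) = w + U w - (z + U z) by rewrite opprD addrACA.
    lra.
- split=> [l|z hz|x l xxs z t hz].
  + exact: real_analytic_le rsg (rN' l).
  + by have := bN' z (strip_le rsg hz); rewrite pS pe -/p; have : 0 <= eps * p; [rewrite mulr_ge0// ltW | lra].
  + by apply: iN' => //; apply: strip_le rsg hz.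
- by split=> // z hz; have := bQ z hz; rewrite exprSr invfM mulrA.
- move=> z hz; have hz' := hU z hz; have hzr := strip_le rsg hz.
  have [dU JU] := diff_near_id rU hzr; have [dF _] := diff_near_id rF hz'.
  have -> : (fun w => w + F' w) = (fun w => (fun v => v + F v) ((fun v => v + U v) w)).
    by apply/funext => w; rewrite F'E.
  by rewrite (jacobian_comp dU dF) mulmxA JU eq2// eq1// F'E.
Qed.

End Iteration.

(** * Simultaneous rational approximation *)

Section Resonances.
Variables (R : realType) (n : nat).
Local Notation K := (R[i] : numFieldType).
Local Notation C := R[i].
Local Notation V := 'rV[K]_n.+1.
Implicit Types (al : 'rV[R]_n.+1) (x : 'rV[int]_n.+1).

Lemma cnorm_real (v : 'rV[R]_n.+1) : cnorm (map_mx (real_complex R) v : V) = `|v|.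
Proof.
apply/eqP; rewrite eq_le; apply/andP; split.
  by apply: cnorm_le => // i; rewrite mxE cabs_real; exact: mx_entry_le.
have [v0|/mx_norm_neq0[[i j] /= e]] := eqVneq (mx_norm v) 0; first by rewrite [`|v|]v0 cnorm_ge0.
rewrite [`|v|]e ord1 -cabs_real.
by apply: le_trans (cabs_le_cnorm _ j); rewrite mxE.
Qed.

Lemma num_frequencies_gt0 al : al != 0 -> (0 < num_frequencies al)%N.
Proof.
move=> al0; have [_ hal _] := rational_hullP al.
rewrite lt0n /num_frequencies dimv_eq0; apply: contra al0 => /eqP h0.
by rewrite h0 memv0 in hal.
Qed.

(** The integer vectors span [al] over the reals, so a complex-linear form that
    vanishes on them vanishes at [al]. *)
Lemma dot_span (a : V) al (xs : seq 'rV[int]_n.+1) :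
  al \in <<[seq map_mx intr x : 'rV[R]_n.+1 | x <- xs]>>%VS ->
  (forall x, x \in xs -> dot a (int_vec R x) = 0) ->
  dot a (map_mx (real_complex R) al) = 0.
Proof.
move=> hal h0; set X := [seq _ | x <- xs] in hal.
rewrite (coord_span (X := in_tuple X) hal) raddf_sum /=.
elim/big_rec: _ => [|i y _ hy]; first by rewrite dot0r.
rewrite dotDr hy addr0 map_mxZ dotZr.
have iX : (i < size xs)%N by rewrite (leq_trans (ltn_ord i))// size_map.
rewrite (nth_map 0)//.
have -> : map_mx (real_complex R) (map_mx intr (nth 0 xs i)) = int_vec R (nth 0 xs i) :> V.
  by apply/matrixP => j l; rewrite !mxE rmorph_int.
by rewrite h0 ?mulr0// mem_nth.
Qed.

Lemma kappa_gt0 al : al != 0 -> 0 < kappa al.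
Proof.
move=> al0; have d0 := num_frequencies_gt0 al0.
rewrite /kappa /= !mulr_gt0 ?exprn_gt0 ?ltr0n// ?invr_gt0 ?normr_gt0//.
by rewrite subr_gt0 exprn_egt1 ?ltr1n// -lt0n.
Qed.

(** Near-optimal simultaneous rational approximations of [al]. The factors [4 / 5] and
    [5 / 4] absorb the fact that the supremum defining [Delta_star] and the infimum
    defining [Psi] may fail to be attained. *)
Lemma resonant_directions al (eps Q : R) : al != 0 -> `|al| = `|al 0 0| -> 0 < eps ->
  Q = Delta_star al (2 * eps)^-1 -> 1 < Q ->
  let q := (Q * `|al|)^-1 in
  exists (xs : seq 'rV[int]_n.+1) (T eta : R),
    [/\ size xs = num_frequencies al,
        al \in <<[seq map_mx intr x : 'rV[R]_n.+1 | x <- xs]>>%VS,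
        forall x, x \in xs ->
          resonant (map_mx (real_complex R) al) (fun x => (x 0 0)%:~R / al 0 0) T eta x &
        [/\ 0 <= T, T * eps <= 4 / 5 * q & eta <= 5 / 4 * q]].
Proof.
move=> al0 al00 eps0 QE Q1 q.
set S := [set Q : R | 1 <= Q /\ (Delta al Q <= ((2 * eps)^-1)%:E)%E].
have QS : Q = sup S by [].
have hS : has_sup S.
  by apply: contrapT => /sup_out h; move: Q1; rewrite QS h ltr10.
have Q0 : 0 < Q := lt_trans ltr01 Q1.
have Q5 : 0 < Q / 5 by rewrite divr_gt0.
have [Q' [Q'1 hQ'] hQ'Q] := sup_adherent Q5 hS; rewrite -QS in hQ'Q.
have Q'0 : 0 < Q' by lra.
have A0 : 0 < `|al| by rewrite normr_gt0.
have B0 : 0 < 5 / 4 * (2 * eps * Q')^-1.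
  by rewrite mulr_gt0 ?divr_gt0// invr_gt0 !mulr_gt0.
have hPsi : (Psi al Q' < (5 / 4 * (2 * eps * Q')^-1)%:E)%E.
  have h : (Psi al Q' <= ((2 * eps * Q')^-1)%:E)%E.
    move: hQ'; rewrite /Delta muleC -lee_pdivlMr// -EFinM => /le_trans; apply.
    by rewrite lee_fin -invfM.
  apply: le_lt_trans h _; rewrite lte_fin.
  have i0 : 0 < (2 * eps * Q')^-1 by rewrite invr_gt0 !mulr_gt0.
  lra.
have [_ [k [k0 [x [xfree hx]]] <-]] := ereal_inf_lt hPsi.
rewrite lte_fin => hk.
exists (x : seq _), (k / `|al|), ((Q' * `|al|)^-1); split.
- exact: size_tuple.
- have [_ hal _] := rational_hullP al.
  suff -> : <<[seq map_mx intr y : 'rV[R]_n.+1 | y <- x]>>%VS = rational_hull al by [].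
  apply/eqP; rewrite eqEdim; apply/andP; split.
    by apply/span_subvP => _ /mapP[y yx ->]; have [] := hx y yx.
  by move: xfree => /eqP ->; rewrite size_map size_tuple.
- move=> y yx; have [_ hy1 hy2] := hx y yx; split.
    rewrite normrM normfV -al00 ler_wpM2r ?invr_ge0 ?normr_ge0//.
    by apply: le_trans hy1; have := mx_entry_le (map_mx intr y : 'rV[R]_n.+1) 0 0; rewrite mxE.
  have a00 : al 0 0 != 0 by rewrite -normr_gt0 -al00.
  have -> : ((y 0 0)%:~R / al 0 0)%:C%C *: map_mx (real_complex R) al - int_vec R y =
     map_mx (real_complex R) ((al 0 0)^-1 *: ((y 0 0)%:~R *: al - al 0 0 *: map_mx intr y)) :> V.
    apply/rowP => j; rewrite !mxE !(rmorphM, rmorphB, fmorphV, rmorph_int) /=.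
    by field; rewrite -cabs_gt0 cabs_real normr_gt0.
  rewrite cnorm_real normrZ normfV -al00 invfM mulrC.
  by rewrite ler_pM2r ?invr_gt0.
- have hq : q = (Q^-1) / `|al| by rewrite /q invfM.
  have QQ : Q'^-1 <= 5 / 4 * Q^-1.
    rewrite -(ler_pM2r Q'0) mulVf ?gt_eqF// -(ler_pM2r Q0).
    have -> : 5 / 4 * Q^-1 * Q' * Q = 5 / 4 * Q' by field; rewrite gt_eqF.
    lra.
  have Ai : 0 < `|al|^-1 by rewrite invr_gt0.
  split.
  + by rewrite divr_ge0 ?(ltW k0)// ltW.
  + rewrite hq mulrAC mulrA ler_pM2r//.
    apply: (@le_trans _ _ (5 / 8 * Q'^-1)).
      have -> : 5 / 8 * Q'^-1 = 5 / 4 * (2 * eps * Q')^-1 * eps by field; rewrite !gt_eqF.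
      by rewrite ler_wpM2r ?(ltW eps0)// ltW.
    have : 0 < Q^-1 by rewrite invr_gt0.
    lra.
  + by rewrite hq invfM mulrA ler_pM2r.
Qed.

End Resonances.

(** * The normal form *)

Section Conclusion.
Variables (R : realType) (n : nat).
Local Notation K := (R[i] : numFieldType).
Local Notation C := R[i].
Local Notation V := 'rV[K]_n.+1.
Implicit Types (z h w : V) (r s : R).

Lemma vector_field_coord_fun r (F : V -> V) :
  real_analytic_vector_field r F <-> forall l, real_analytic r (coord_fun F l).
Proof. exact: real_analytic_vector_fieldP. Qed.

Lemma sup_norm_le r (F : V -> V) (M : R) : vbounded_on r F M -> (sup_norm r F <= M%:E)%E.
Proof. by move=> h; apply: ge_ereal_sup => _ [z hz <-]; rewrite lee_fin; apply: h. Qed.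

Lemma sup_norm_vbounded r (F : V -> V) (M : R) : (sup_norm r F <= M%:E)%E -> vbounded_on r F M.
Proof.
move=> h z hz; rewrite -lee_fin; apply: le_trans h.
by apply: ereal_sup_ubound; exists z.
Qed.

(** A lower bound on distances gives injectivity, immersivity and continuity of the
    inverse at once. Periodicity of [F] reduces injectivity modulo integer vectors
    to injectivity. *)
Lemma near_identity_embedding r s (F : V -> V) (k : R) : (forall l, real_analytic r (coord_fun F l)) ->
  (forall z, strip r z -> strip s (z + F z)) -> 0 < k ->
  (forall z w, strip r z -> strip r w -> k * cnorm (w - z) <= cnorm (w + F w - (z + F z))) ->
  real_analytic_embedding r s (fun z => z + F z).
Proof.
move=> rF sF k0 hk; have [pF aF reF] := (vector_field_coord_fun r F).2 rF.
have per z m : strip r z -> z + int_vec R m + F (z + int_vec R m) = z + F z + int_vec R m.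
  by move=> hz; rewrite pF// addrAC.
split.
- by split=> // z m hz; apply: per.
- split=> [z hz|z hz zr]; first by have [] := diff_near_id rF hz.
  by apply: is_real_vecD => //; apply: reF.
- move=> z w hz hw [m hm]; exists m.
  have hz' : strip r (z + int_vec R m) by apply: strip_int.
  apply/eqP; rewrite -subr_eq0 -cnorm_eq0 eq_le cnorm_ge0 andbT.
  have := hk _ _ hz' hw; rewrite hm per// subrr cnorm0.
  by rewrite pmulr_rle0.
- move=> z hz; have [d d0 hd] := strip_open hz; have [dF _] := diff_near_id rF hz.
  apply: (expanding_immersion k0 d0 dF) => h /ltW hh.
  by have := hk _ _ hz (strip_sub hh hd); rewrite [z + h - z]addrAC subrr add0r.
- move=> z hz e e0; exists (k * e) => [|w hw hwz]; first by rewrite mulr_gt0.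
  exists 0; have -> : int_vec R (0 : 'rV_n.+1) = 0 :> V by apply/rowP => j; rewrite !mxE.
  by rewrite addr0 -(ltr_pM2l k0); apply: le_lt_trans (hk _ _ hz hw) hwz.
Qed.

Lemma half_power_lt_exp (y : R) m : y < m.+1%:R -> (2 ^+ m.+1)^-1 < expR (- (ln 2 * y)).
Proof.
move=> hy; have -> : (2 ^+ m.+1)^-1 = expR (- (m.+1%:R * ln 2)) :> R.
  by rewrite expRN expRM_natl lnK// posrE.
rewrite ltr_expR ltrN2 mulrC ltr_pM2r// ln_gt0//; exact: ltr1n.
Qed.

End Conclusion.

Theorem theorem3p1 (R : realType) (n : nat) (hn : (2 <= n.+1)%N)
    (alpha : 'rV[R]_n.+1) (halpha : alpha != 0)
    (halpha0 : `|alpha| = `|alpha 0 0|)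
    (s eps : R) (hs : 0 < s) (heps : 0 < eps)
    (P : 'rV[R[i]]_n.+1 -> 'rV[R[i]]_n.+1)
    (hP : real_analytic_vector_field s P)
    (hPeps : (sup_norm s P <= eps%:E)%E)
    (d : nat) (hd : d = num_frequencies alpha)
    (Q : R) (hQ : Q = Delta_star alpha (2 * eps)^-1)
    (hQ1 : Q > Num.max 1 (d%:R * `|alpha|^-1))
    (hQ2 : Q >= kappa alpha * s^-1) :
  exists Phi N Rem : 'rV[R[i]]_n.+1 -> 'rV[R[i]]_n.+1,
    [/\ real_analytic_embedding (s / 2) s Phi,
        real_analytic_vector_field (s / 2) N /\
          real_analytic_vector_field (s / 2) Rem,
        forall z, strip (s / 2) z ->
          pullback Phi (fun w => const_field alpha w + P w) z =
            const_field alpha z + N z + Rem z,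
        forall z, strip (s / 2) z -> lie_bracket (const_field alpha) N z = 0 &
        [/\ (sup_norm (s / 2)%R (fun z => Phi z - z)%R <
               (d%:R ^+ 2 * `|alpha|^-1 * Q^-1)%R%:E)%E,
            (sup_norm (s / 2)%R N < (2 * eps)%R%:E)%E &
            (sup_norm (s / 2)%R Rem <
               (2 * eps * expR (- (ln 2 * (kappa alpha)^-1 * s * Q)))%R%:E)%E]].
Proof.
have Q1 : 1 < Q by apply: le_lt_trans hQ1; rewrite le_max lexx.
have Q0 : 0 < Q := lt_trans ltr01 Q1.
have A0 : 0 < `|alpha| by rewrite normr_gt0.
have [xs [T [eta [sxs span_xs res_xs [T0 Teps eta_le]]]]] :=
  resonant_directions halpha halpha0 heps hQ Q1.
set q := (Q * `|alpha|)^-1 in Teps eta_le.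
have q0 : 0 < q by rewrite invr_gt0 mulr_gt0.
pose D : R := d%:R.
have D1 : 1 <= D by rewrite ler1n hd num_frequencies_gt0.
have kappa0 := kappa_gt0 halpha.
have [y yE] : exists y, y = s * Q / kappa alpha by exists (s * Q / kappa alpha).
have y1 : 1 <= y by rewrite yE ler_pdivlMr// mul1r -ler_pdivrMl// mulrC.
have y0 : 0 <= y by lra.
have [m [m1 my ym]] : exists m : nat, [/\ (1 <= m)%N, m%:R <= y & y < m.+1%:R].
  exists (Num.truncn y); have /andP[my ym] := truncn_itv y0.
  by split=> //; rewrite (truncn_ge_nat _ y0).
have m0 : 0 < m%:R :> R by rewrite ltr0n.
(* The loss of width in each of the [m] steps. *)
pose sg := s / (2 * m%:R).
have sg0 : 0 < sg by rewrite divr_gt0// mulr_gt0.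
have sgE : s - m%:R * sg = s / 2 by rewrite /sg; field; rewrite gt_eqF.
have sg_ge : 32 * D ^+ 2 * q <= sg.
  apply: (@le_trans _ _ (kappa alpha / (2 * Q))).
    have -> : kappa alpha / (2 * Q) = 32 * D ^+ 2 * q * (2 ^+ d - 1).
      by rewrite /kappa /D /q -hd; field; rewrite !gt_eqF.
    rewrite ler_peMr ?mulr_ge0 ?exprn_ge0 ?(ltW q0)//.
    rewrite lerBrDr; apply: (@le_trans _ _ (2 ^+ 1)); first by rewrite expr1; lra.
    by rewrite ler_weXn2l ?ler1n// hd num_frequencies_gt0.
  rewrite /sg ler_pdivrMr ?mulr_gt0// mulrAC ler_pdivlMr ?mulr_gt0//.
  move: my; rewrite yE ler_pdivlMr// => my.
  have -> : kappa alpha * (2 * m%:R) = 2 * (m%:R * kappa alpha) by ring.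
  lra.
have Dq : D * q <= D ^+ 2 * q by rewrite expr2 -mulrA ler_peMl// mulr_ge0// ltW.
have Dq0 : 0 < D * q by rewrite mulr_gt0//; lra.
have D0 : 0 <= D by lra.
have DTeps : D * T * eps <= 4 / 5 * (D * q).
  by rewrite -mulrA (mulrCA _ D) ler_wpM2l.
have Deta : D * eta <= 5 / 4 * (D * q) by rewrite (mulrCA _ D) ler_wpM2l.
have sD : (size xs)%:R = D :> R by rewrite sxs -hd.
have h24 : 24 * (size xs)%:R * T * eps <= sg by rewrite sD; lra.
have h27 : (size xs)%:R * (27 / 2 * T * eps + 3 / 2 * eta) <= 15 / 32 * sg.
  have -> : (size xs)%:R * (27 / 2 * T * eps + 3 / 2 * eta) =
    27 / 2 * (D * T * eps) + 3 / 2 * (D * eta) by rewrite sD; ring.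
  lra.
have pm0 : 0 < (2 ^+ m)^-1 :> R by rewrite invr_gt0 exprn_gt0.
have F_lt : D * T * eps * (1 - (2 ^+ m)^-1) < d%:R ^+ 2 * `|alpha|^-1 * Q^-1.
  have -> : d%:R ^+ 2 * `|alpha|^-1 * Q^-1 = D ^+ 2 * q by rewrite /q /D invfM; ring.
  have DT0 : 0 <= D * T * eps by rewrite !mulr_ge0 // ltW.
  have p1 : 1 - (2 ^+ m)^-1 <= 1 :> R by rewrite lerBlDr lerDl ltW.
  apply: le_lt_trans (ler_piMr DT0 p1) _; apply: le_lt_trans DTeps _.
  by apply: lt_le_trans Dq; rewrite gtr_pMl//; lra.
have N_lt : 2 * eps * (1 - (2 ^+ m)^-1) < 2 * eps.
  by rewrite gtr_pMr ?mulr_gt0// ltrBlDr ltrDl.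
have R_lt : eps / 2 ^+ m < 2 * eps * expR (- (ln 2 * (kappa alpha)^-1 * s * Q)).
  have -> : ln 2 * (kappa alpha)^-1 * s * Q = ln 2 * y by rewrite yE; ring.
  have -> : eps / 2 ^+ m = 2 * eps * (2 ^+ m.+1)^-1.
    by rewrite exprS; field; rewrite expf_neq0.
  by rewrite ltr_pM2l ?mulr_gt0// half_power_lt_exp.
have [F [N [Rem [[rF bF sF [k k0 hk]] [rN bN iN] [rR bR] eqF]]]] :=
  near_identity_iteration m sg0 (ltW heps) T0 res_xs h24 h27
    ((vector_field_coord_fun s P).1 hP) (sup_norm_vbounded hPeps).
rewrite sgE sD in rF bF sF hk rN bN iN rR bR eqF.
have emb := near_identity_embedding rF sF k0 hk.
exists (fun z => z + F z), N, Rem; split.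
- exact: emb.
- by split; apply/vector_field_coord_fun.
- move=> z hz; have [_ _ _ /(_ z hz) uJ _] := emb.
  by rewrite /pullback /const_field -eqF// mulmxK.
- move=> z hz; have [_ dN] := diff_field (const_field alpha z) rN hz.
  have dalpha : 'd (const_field alpha) z (N z) = 0.
    exact: (congr1 (fun L => L (N z)) (diff_cst (map_mx (real_complex R) alpha) z)).
  apply: etrans (congr2 (fun v w => v - w) dN dalpha) _.
  rewrite subr0; apply/rowP => l; rewrite mul_jacE mxE.
  apply: (dot_span span_xs) => x xxs.
  exact: flow_invariant_gradient (iN x l xxs) hz (coord_fun_gradient (rN l) hz).
- split.
  + apply: (@le_lt_trans _ _ (D * T * eps * (1 - (2 ^+ m)^-1))%:E); last by rewrite lte_fin.
    by apply: sup_norm_le => z hz; rewrite addrC addKr; apply: bF.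
  + by apply: le_lt_trans (sup_norm_le bN) _; rewrite lte_fin.
  + by apply: le_lt_trans (sup_norm_le bR) _; rewrite lte_fin.
Qed.
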